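(* Let $0\le\alpha<n$. Suppose $a(x,\xi)$, $x,\xi\in\mathbb{R}^n$, satisfies i) $\displaystyle\int_{\mathbb{R}^n}\int_{\mathbb{R}^n}|a(x,\xi)|^{\frac{2n}{n-\alpha}}\,d\xi\,dx<\infty$, and ii) $\displaystyle\big\|(-\Delta_\xi)^{\alpha/2}a(x,\xi)\big\|_{L^{\frac{2n}{n+\alpha}}_\xi}\in L^{\frac{2n}{n-\alpha}}_x$. Then the pseudo-differential operator $$a(x,D)f(x):=\frac1{(2\pi)^n}\int_{\mathbb{R}^n}e^{ix\cdot\xi}a(x,\xi)\hat f(\xi)\,d\xi$$ is bounded on $L^2(\mathbb{R}^n)$ with $$\|a(x,D)f\|_{L^2}\le c_{\alpha,n}\|f\|_{L^2}\,\big\|(-\Delta_\xi)^{\alpha/2}a(x,\xi)\big\|_{L_x^{\frac{2n}{n-\alpha}}L_\xi^{\frac{2n}{n+\alpha}}} .$$ Moreover, one has the pointwise bound $$|a(x,D)f(x)|\le c_{\alpha,n}\,(Mf(x))^{\alpha/n}\,\big\|(-\Delta_\xi)^{\alpha/2}a(x,\cdot)\big\|_{L^{\frac{2n}{n+\alpha}}}\,\|f\|_{L^2}^{1-\frac\alpha n}$$ for a.e. $x$. Here $c_{\alpha,n}$ depends only on $\alpha$ and $n$.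
   Context: $\hat f(\xi)=\int_{\mathbb{R}^n}e^{-ix\cdot\xi}f(x)\,dx$. $M$ is the Hardy–Littlewood maximal operator. The mixed norm is $\|F\|_{L^q_xL^p_\xi}=\big(\int(\int|F(x,\xi)|^p\,d\xi)^{q/p}\,dx\big)^{1/q}$. $(-\Delta_\xi)^{\alpha/2}$ is the fractional Laplacian (multiplier $|\cdot|^\alpha$) acting in the $\xi$ variable. The operator $a(x,D)$ is defined by the integral on Schwartz functions $f$ and extended by continuity to $L^2$. *)

(* Defs.v *)
From HB Require Import structures.
From mathcomp Require Import all_boot all_order all_algebra.
From mathcomp Require Import all_classical all_reals all_analysis.
From mathcomp Require Import complex.

Set Implicit Arguments.
Unset Strict Implicit.
Unset Printing Implicit Defensive.

Import Order.TTheory GRing.Theory Num.Theory.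
Import numFieldNormedType.Exports.

Local Open Scope classical_set_scope.
Local Open Scope ring_scope.
Local Open Scope complex_scope.

Definition rV_display : measure_display -> measure_display.
Proof. exact. Qed.

Section measurable_rV.
Context {d} {T : measurableType d} (n : nat).

Let coors : 'I_n -> 'rV[T]_n -> T := fun i v => v ord0 i.

Let rV_set0 : g_sigma_preimage coors set0.
Proof. exact: sigma_algebra0. Qed.

Let rV_setC A : g_sigma_preimage coors A -> g_sigma_preimage coors (~` A).
Proof. exact: sigma_algebraC. Qed.

Let rV_bigcup (F : _^nat) : (forall i, g_sigma_preimage coors (F i)) ->
  g_sigma_preimage coors (\bigcup_i (F i)).
Proof. exact: sigma_algebra_bigcup. Qed.

HB.instance Definition _ := @isMeasurable.Build (rV_display d)
  'rV[T]_n (g_sigma_preimage coors) rV_set0 rV_setC rV_bigcup.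

End measurable_rV.
Lemma measurable_coord {d} {T : measurableType d} n (i : 'I_n) :
  measurable_fun [set: 'rV[T]_n] (fun v : 'rV[T]_n => v ord0 i).
Proof.
move=> _ Y mY; rewrite setTI; apply: sub_sigma_algebra => /=.
rewrite -bigcup_seq/=; exists i => /=; first by rewrite mem_index_enum.
by exists Y => //; rewrite setTI.
Qed.

Lemma measurable_fun_rVP {d1 d2} {T1 : measurableType d1}
    {T2 : measurableType d2} n (f : T1 -> 'rV[T2]_n) :
  measurable_fun [set: T1] f <->
  forall i, measurable_fun [set: T1] (fun x => f x ord0 i).
Proof.
split=> [mf i|mf].
  exact: (measurableT_comp (measurable_coord i) mf).
move=> _ A mA; rewrite setTI; move: A mA.
apply: smallest_sub.
  split => /=.
  - by rewrite preimage_set0; exact: measurable0.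
  - by move=> A mA; rewrite setTD -preimage_setC; exact: measurableC.
  - by move=> F mF; rewrite preimage_bigcup; exact: bigcupT_measurable.
move=> A; rewrite -bigcup_seq => -[i _ [B mB <-]] /=.
by rewrite setTI; have := mf i measurableT _ mB; rewrite setTI.
Qed.

Section rV_cons.
Context {R : realType} (n : nat).
Implicit Types (v : 'rV[R]_n) (w : 'rV[R]_n.+1).

Definition rV_cons (p : measurableTypeR R * 'rV[R]_n) : 'rV[R]_n.+1 :=
  \row_i (if unlift ord0 i is Some j then p.2 ord0 j else p.1).

Definition rV_uncons w : measurableTypeR R * 'rV[R]_n :=
  (w ord0 ord0, \row_j w ord0 (lift ord0 j)).

Lemma rV_consK : cancel rV_cons rV_uncons.
Proof.
move=> [x v]; congr pair; first by rewrite mxE unlift_none.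
by apply/rowP => j; rewrite !mxE liftK.
Qed.

Lemma measurable_rV_cons : measurable_fun setT rV_cons.
Proof.
apply/measurable_fun_rVP => i; case: (unliftP ord0 i) => [j ij|i0].
  rewrite (_ : (fun _ => _) = (fun v => v ord0 j) \o snd).
    by apply: measurableT_comp; [exact: measurable_coord|exact: measurable_snd].
  by apply/funext => p /=; rewrite mxE ij liftK.
rewrite (_ : (fun _ => _) = fst); first exact: measurable_fst.
by apply/funext => p /=; rewrite mxE i0 unlift_none.
Qed.

Lemma measurable_rV_uncons : measurable_fun setT rV_uncons.
Proof.
apply/measurable_fun_pairP; split; first exact: (measurable_coord ord0).
apply/measurable_fun_rVP => j.
rewrite (_ : (fun _ => _) = (fun w => w ord0 (lift ord0 j))).
  exact: measurable_coord.
by apply/funext => w /=; rewrite mxE.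
Qed.

Variable mu : {sigma_finite_measure set 'rV[R]_n -> \bar R}.

Definition lebesgue_step : set 'rV[R]_n.+1 -> \bar R :=
  pushforward (@lebesgue_measure R \x mu)%E rV_cons.

Let step0 : lebesgue_step set0 = 0%E.
Proof. by rewrite /lebesgue_step /pushforward preimage_set0 measure0. Qed.

Let step_ge0 A : (0 <= lebesgue_step A)%E.
Proof. exact: (measure_ge0 (@lebesgue_measure R \x mu)%E). Qed.

Let step_sigma_additive : semi_sigma_additive lebesgue_step.
Proof.
move=> F mF tF mUF; rewrite /lebesgue_step /pushforward preimage_bigcup.
apply: measure_semi_sigma_additive.
- by move=> k; rewrite -[X in measurable X]setTI; exact: measurable_rV_cons.
- apply/trivIsetP => /= i j _ _ ij; rewrite -preimage_setI.
  by move/trivIsetP : tF => /(_ _ _ _ _ ij) ->//; rewrite preimage_set0.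
- by rewrite -preimage_bigcup -[X in measurable X]setTI;
    exact: measurable_rV_cons.
Qed.

HB.instance Definition _ := isMeasure.Build _ _ _ lebesgue_step
  step0 step_ge0 step_sigma_additive.

Let step_sigma_finite : sigma_finite setT lebesgue_step.
Proof.
have /sigma_finiteP[F [TF ndF Foo]] := sigma_finiteT (@lebesgue_measure R).
have /sigma_finiteP[G [TG ndG Goo]] := sigma_finiteT mu.
exists (fun k => rV_uncons @^-1` (F k `*` G k)) => [|k].
  apply/seteqP; split=> // w _ /=.
  have [i _ Fi] : (\bigcup_k F k) (rV_uncons w).1 by rewrite -TF.
  have [j _ Gj] : (\bigcup_k G k) (rV_uncons w).2 by rewrite -TG.
  exists (maxn i j) => //; split.
    by move: Fi; exact/subsetPset/ndF/leq_maxl.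
  by move: Gj; exact/subsetPset/ndG/leq_maxr.
have [mF Fk] := Foo k; have [mG Gk] := Goo k; split.
  rewrite -[X in measurable X]setTI; apply: measurable_rV_uncons => //.
  exact: measurableX.
rewrite /lebesgue_step /pushforward -comp_preimage.
rewrite (_ : _ \o _ = idfun); last by apply/funext => p /=; rewrite rV_consK.
by rewrite preimage_id product_measure1E// lte_mul_pinfty// ge0_fin_numE.
Qed.

HB.instance Definition _ := Measure_isSigmaFinite.Build _ _ _ lebesgue_step
  step_sigma_finite.

End rV_cons.

(* Lebesgue measure on R^n, by iterated products; see [lebesgueRn_box]. *)
Fixpoint lebesgueRn (R : realType) (n : nat) :
    {sigma_finite_measure set 'rV[R]_n -> \bar R} :=
  match n with
  | 0 => @dirac _ 'rV[R]_0 0 R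
  | n'.+1 => lebesgue_step (lebesgueRn R n')
  end.

Lemma lebesgueRn_box (R : realType) n (B : 'I_n -> set R) :
  (forall i, measurable (B i)) ->
  (lebesgueRn R n [set v : 'rV[R]_n | forall i, B i (v ord0 i)] =
   \prod_(i < n) lebesgue_measure (B i))%E.
Proof.
elim: n B => [|n IH] B mB.
  rewrite big_ord0 /= diracE mem_set//.
  by case.
rewrite big_ord_recl -IH; last by move=> i; exact: mB.
rewrite [LHS]/= /lebesgue_step /pushforward.
rewrite (_ : _ @^-1` _ =
    B ord0 `*` [set v : 'rV[R]_n | forall i, B (lift ord0 i) (v ord0 i)]).
  rewrite product_measure1E//; first exact: mB.
  rewrite (_ : [set _ | _] = \bigcap_(i in [set: 'I_n])
      ((fun v : 'rV[R]_n => v ord0 i) @^-1` B (lift ord0 i))).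
    apply: fin_bigcap_measurable => // i _; rewrite -[X in measurable X]setTI.
    by apply: (measurable_coord i) => //; exact: mB.
  by apply/seteqP; split => v /= Bv i; [move=> _|]; exact: Bv.
apply/seteqP; split => [[x v] /= Bv|[x v] /= [Bx Bv] i].
  split; first by have := Bv ord0; rewrite mxE unlift_none.
  by move=> i; have := Bv (lift ord0 i); rewrite mxE liftK.
by rewrite mxE; case: unliftP => [j ->|->].
Qed.

Section complex_valued.
Context {d} {T : measurableType d} {R : realType}.
Variable mu : {measure set T -> \bar R}.
Implicit Types f : T -> R[i].

Definition Cmeasurable f :=
  measurable_fun setT (fun x => complex.Re (f x)) /\
  measurable_fun setT (fun x => complex.Im (f x)).

Definition Cintegrable f :=
  mu.-integrable setT (fun x => (complex.Re (f x))%:E) /\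
  mu.-integrable setT (fun x => (complex.Im (f x))%:E).

Definition Cintegral f : R[i] :=
  (\int[mu]_x complex.Re (f x)) +i* (\int[mu]_x complex.Im (f x)).

Definition CLnorm (p : R) f : \bar R :=
  Lnorm mu p%:E (fun x => (Normc.normc (f x))%:E).

Definition in_L2 f := Cmeasurable f /\ (CLnorm 2 f < +oo)%E.

End complex_valued.

Section euclidean.
Context {R : realType} {n : nat}.
Implicit Types (x y xi eta : 'rV[R]_n) (f phi u v : 'rV[R]_n -> R[i]).
Implicit Types (a F : 'rV[R]_n -> 'rV[R]_n -> R[i]).

Local Notation mu := (lebesgueRn R n).

(* The norm of the library on 'rV[R]_n is the sup norm. *)
Definition dot x y : R := \sum_(i < n) x ord0 i * y ord0 i.
Definition enorm x : R := Num.sqrt (dot x x).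
Definition eball x (r : R) : set 'rV[R]_n := [set y | enorm (y - x) < r].

Definition mixed_norm (q p : R) F : \bar R :=
  Lnorm mu q%:E (fun x => CLnorm mu p (F x)).

Definition maximal f x : \bar R :=
  ereal_sup [set ((mu (eball x r))^-1 *
    \int[mu]_(y in eball x r) (Normc.normc (f y))%:E)%E
    | r in `]0, +oo[%classic].

Definition partials (s : seq 'I_n) (h : 'rV[R]_n -> R) : 'rV[R]_n -> R :=
  foldr (fun i h' => 'D_(delta_mx 0 i) h') h s.

Definition real_schwartz (h : 'rV[R]_n -> R) :=
  forall s : seq 'I_n,
    (forall x, differentiable (partials s h) x) /\
    (forall k, exists C, forall x, enorm x ^+ k * `|partials s h x| <= C).

Definition schwartz f :=
  real_schwartz (fun x => complex.Re (f x)) /\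
  real_schwartz (fun x => complex.Im (f x)).

Definition expi (t : R) : R[i] := cos t +i* sin t.

Definition fourier f xi : R[i] :=
  Cintegral mu (fun x => expi (- dot x xi) * f x).

Definition fourier_cst : R[i] := (((2 * pi) ^+ n)^-1)%:C.

Definition frac_lap_schwartz (alpha : R) phi xi : R[i] :=
  fourier_cst * Cintegral mu (fun eta =>
    expi (dot eta xi) * ((enorm eta `^ alpha)%:C * fourier phi eta)).

(* v = (-Delta)^(alpha/2) u in the sense of distributions.  The multiplier
   |.|^alpha is even, so the transpose of (-Delta)^(alpha/2) for the bilinear
   pairing is itself.  (-Delta)^(alpha/2) phi is bounded, and
   O(|xi|^(-n-alpha)) when alpha > 0, so for u and v in Lebesgue spaces both
   integrals converge absolutely. *)
Definition is_frac_lap (alpha : R) u v :=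
  forall phi, schwartz phi ->
    Cintegral mu (fun xi => u xi * frac_lap_schwartz alpha phi xi) =
    Cintegral mu (fun xi => v xi * phi xi).

Definition psido_integrand a f x xi : R[i] :=
  expi (dot x xi) * (a x xi * fourier f xi).

Definition psido a f x : R[i] :=
  fourier_cst * Cintegral mu (psido_integrand a f x).

(* T is a linear extension to L^2 (functions, up to null sets) of the operator
   a(x,D) given by the integral on Schwartz functions.  Once T is bounded it is
   the extension by continuity, Schwartz functions being dense in L^2. *)
Definition psido_L2_extension a (T : ('rV[R]_n -> R[i]) -> 'rV[R]_n -> R[i]) :=
  [/\ forall f, in_L2 mu f -> in_L2 mu (T f),
      forall (z : R[i]) f h, in_L2 mu f -> in_L2 mu h ->
        {ae mu, forall x, T (fun y => z * f y + h y) x = z * T f x + T h x} &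
      forall f, schwartz f ->
        {ae mu, forall x, Cintegrable mu (psido_integrand a f x) /\
                          T f x = psido a f x}].

End euclidean.

(* Main.v *)
(* Write h = f(x + .), theta = alpha / n and p = 2n / (n + alpha), with
   conjugate exponent q = 2n / (n - alpha).  Since
   a(x,D)f(x) = (2 pi)^(-n) \int a(x,xi) h^(xi) dxi, testing the definition of
   g(x,.) = (-Delta)^(alpha/2) a(x,.) against the Fourier transform of
   |y|^(-alpha) h turns this into (2 pi)^(-n) \int g(x,xi) (|y|^(-alpha) h)^ dxi,
   and Hoelder's inequality in xi reduces the pointwise bound to
     || (|y|^(-alpha) h)^ ||_q <= C (Mh(0))^theta ||h||_2^(1 - theta).
   This is a Hedberg argument: |y|^(-alpha) is a superposition of the Gaussians
   exp(- e^tau |y|^2) with weight e^(alpha tau / 2); the transform u_tau of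
   exp(- e^tau |y|^2) h is at most C e^(- n tau / 2) Mh(0), and also at most
   M(h^), being a Gaussian average of h^.  Integrating the smaller of the two
   bounds in tau gives C Mh(0)^theta M(h^)^(1 - theta), and (1 - theta) q = 2,
   so that the maximal theorem and Plancherel conclude.
   For f in L^2, the operator is the limit of the g-pairings of the truncations
   of h to 1/k < |y| < k, which form a Cauchy sequence by the same bound.  To
   identify it with the integral for Schwartz f, the cutoff
   exp(- e^(-s) / s), s = (k |y|)^2, flat at the origin, keeps |y|^(-alpha) h in
   the Schwartz class; the remaining part near the origin contributes
   O(k^(-(n - alpha) / 2)).
   The maximal theorem on L^2 is proved by linearizing the supremum over finitely
   many dyadic radii: the TT* method improves any bound B on the square of its
   norm to B / 2 + C. *)
From HB Require Import structures.
Require Import Defs.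
From mathcomp Require Import all_boot all_order all_algebra.
From mathcomp Require Import all_classical all_reals all_analysis.
From mathcomp Require Import measurable_realfun complex ring lra.

Set Implicit Arguments.
Unset Strict Implicit.
Unset Printing Implicit Defensive.

Import Order.TTheory GRing.Theory Num.Theory.
Import numFieldNormedType.Exports.

Local Open Scope classical_set_scope.
Local Open Scope ring_scope.
Local Open Scope complex_scope.

(** * Lebesgue integration on R^n *)

(** The scheme closes because the L^q bound has the form C A^(theta q) ||h||_2^2, where A bounds the
    averages of |h| over balls about 0: all truncations of one h share the same A, so an error that
    is small in L^2 alone is already small in the pairing. Two truncations are used. Sharp annuli
    make |y|^(-alpha) h integrable for every h in L^2 and depend linearly on h, but only a smooth
    cutoff gives a test function against which the distributional identity can be applied. Their
    difference is dominated by |h| and tends to 0 pointwise, so the same bound removes it. The case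
    alpha = 0 is separate: the superposition of Gaussians diverges, and Plancherel alone gives the
    bound. The hypothesis alpha < n forces n > 0, makes e^(alpha tau / 2) e^(- n tau / 2) integrable
    at +oo, and gives p > 1, which makes the part near the origin vanish in the limit. In the
    maximal theorem and in Plancherel, Cauchy-Schwarz is replaced by 2ab <= t a^2 + b^2 / t, which
    remains meaningful for values in [0, +oo] and is linear under integration. *)

Section RnMeasure.
Context {R : realType}.
Implicit Types n : nat.

Lemma integral_rV_cons n (f : 'rV[R]_n.+1 -> \bar R) :
  measurable_fun [set: 'rV[R]_n.+1] f -> (forall w, 0 <= f w)%E ->
  (\int[lebesgueRn R n.+1]_w f w =
   \int[@lebesgue_measure R]_t \int[lebesgueRn R n]_v f (rV_cons (t, v)))%E.
Proof.
move=> mf f0.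
transitivity (\int[pushforward (@lebesgue_measure R \x lebesgueRn R n)%E
   (@rV_cons R n)]_y f y)%E; first by [].
rewrite (ge0_integral_pushforward (@measurable_rV_cons R n)) // preimage_setT.
rewrite (fubini_tonelli1 (f \o @rV_cons R n)) //.
  exact: (measurableT_comp mf (@measurable_rV_cons R n)).
by move=> x; exact: f0.
Qed.

Lemma integral_rV0 (f : 'rV[R]_0 -> \bar R) :
  (\int[lebesgueRn R 0]_w f w = f 0%R)%E.
Proof.
have -> : f = cst (f 0) by apply/funext => w; congr f; apply/rowP; case.
by rewrite /= integral_dirac // ?diracT ?mul1e //; exact: measurable_cst.
Qed.

(** Uniqueness of Lebesgue measure: its pushforward by the affine map, scaled by |c|, gives each
    interval []x, y]] its length. For c < 0 the preimage is closed on the left and open on the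
    right, which does not change the length. *)
Lemma integral_affine1 (c b : R) (f : R -> \bar R) : c != 0 ->
  measurable_fun [set: R] f -> (forall t, 0 <= f t)%E ->
  (`|c|%:E * \int[@lebesgue_measure R]_t f (c * t + b)%R =
   \int[@lebesgue_measure R]_t f t)%E.
Proof.
move=> c0 mf f0.
pose phi : measurableTypeR R -> measurableTypeR R := fun t => c * t + b.
have mphi : measurable_fun setT phi.
  apply: measurable_funD; last exact: measurable_cst.
  by apply: measurable_funM; [exact: measurable_cst|exact: measurable_id].
pose pm := measure_function_pushforward__canonical__measure_function_Measure
  (@lebesgue_measure R) mphi.
have nc : 0 <= `|c| by [].
pose nu := mscale (NngNum nc) pm.
have nuE A : measurable A -> lebesgue_measure A = nu A.
  apply: lebesgue_measure_unique => _ [[x y] /= xy <-].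
  rewrite /nu /mscale /= /pushforward /=.
  have [cp|cn] := ltP 0 c.
    have -> : phi @^-1` `]x, y] = `](x - b) / c, (y - b) / c]%classic.
      apply/seteqP; split => t /=; rewrite !in_itv /= /phi.
        by rewrite ltr_pdivrMr // ler_pdivlMr // ltrBlDr lerBrDr mulrC.
      by rewrite ltr_pdivrMr // ler_pdivlMr // ltrBlDr lerBrDr mulrC.
    rewrite !lebesgue_measure_itv /= !lte_fin ltr_pM2r ?invr_gt0 // ltrD2r.
    case: ifP => _; last by rewrite mule0.
    rewrite gtr0_norm // -EFinB -EFinM; congr (_%:E); field; exact: lt0r_neq0.
  have {}cn : c < 0 by rewrite lt_neqAle c0.
  have -> : phi @^-1` `]x, y] = `[(y - b) / c, (x - b) / c[%classic.
    apply/seteqP; split => t /=; rewrite !in_itv /= /phi.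
      by rewrite ltr_ndivlMr // ler_ndivrMr // ltrBlDr lerBrDr mulrC andbC.
    by rewrite ltr_ndivlMr // ler_ndivrMr // ltrBlDr lerBrDr mulrC andbC.
  rewrite !lebesgue_measure_itv /= !lte_fin ltr_nM2r ?invr_lt0 // ltrD2r.
  case: ifP => _; last by rewrite mule0.
  rewrite ltr0_norm // -EFinB -EFinM; congr (_%:E); field; exact: ltr0_neq0.
rewrite [RHS](@eq_measure_integral _ _ _ _ nu (@lebesgue_measure R)); last first.
  by move=> A mA _; first [exact: nuE | exact: (esym (nuE A mA))].
rewrite [RHS]ge0_integral_mscale //.
congr (_ * _)%E.
by rewrite (ge0_integral_pushforward mphi).
Qed.

Lemma measurable_rV_affine n (c : R) (x : 'rV[R]_n) :
  measurable_fun [set: 'rV[R]_n] (fun v : 'rV[R]_n => c *: v + x).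
Proof.
apply/measurable_fun_rVP => i.
rewrite (_ : (fun _ => _) = (fun v : 'rV[R]_n => c * v ord0 i + x ord0 i)).
  apply: measurable_funD; last exact: measurable_cst.
  apply: measurable_funM; first exact: measurable_cst.
  exact: measurable_coord.
by apply/funext => v; rewrite !mxE.
Qed.

Lemma integral_affine n (c : R) (x : 'rV[R]_n) (f : 'rV[R]_n -> \bar R) :
  c != 0 -> measurable_fun [set: 'rV[R]_n] f -> (forall t, 0 <= f t)%E ->
  ((`|c| ^+ n)%:E * \int[lebesgueRn R n]_v f (c *: v + x)%R =
   \int[lebesgueRn R n]_v f v)%E.
Proof.
move=> c0; elim: n x f => [|n IH] x f mf f0.
  by rewrite !integral_rV0 expr0 mul1e; congr f; apply/rowP; case.
have mfa := measurableT_comp mf (measurable_rV_affine c x).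
have mcons t : measurable_fun [set: 'rV[R]_n] (fun v : 'rV[R]_n => rV_cons (t, v)).
  by apply: (measurableT_comp (@measurable_rV_cons R n)); exact: pair1_measurable.
have mg t : measurable_fun [set: 'rV[R]_n] (fun v : 'rV[R]_n => f (rV_cons (t, v))).
  exact: (measurableT_comp mf (mcons t)).
have mf2 : measurable_fun setT (f \o @rV_cons R n).
  exact: (measurableT_comp mf (@measurable_rV_cons R n)).
rewrite integral_rV_cons // integral_rV_cons //.
pose x0 := x ord0 ord0; pose x' := \row_j x ord0 (lift ord0 j) : 'rV[R]_n.
have E t v : c *: rV_cons (t, v) + x = rV_cons (c * t + x0, c *: v + x').
  apply/rowP => i; rewrite !mxE; case: unliftP => [j ->|->]; by rewrite ?mxE /=.
under eq_integral => t _.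
  under eq_integral => v _ do rewrite E.
  over.
pose F t := (\int[lebesgueRn R n]_v f (rV_cons (t, v)))%E.
have mF : measurable_fun [set: R] F.
  apply: (measurable_fun_fubini_tonelli_F (m2 := lebesgueRn R n) (f \o @rV_cons R n)) => //.
  by move=> z; exact: f0.
have F0 t : (0 <= F t)%E by apply: integral_ge0.
apply: (@etrans _ _ (`|c|%:E * \int[@lebesgue_measure R]_t F (c * t + x0)%R)%E); last first.
  exact: integral_affine1.
rewrite exprS EFinM -muleA.
suff -> : ((`|c| ^+ n)%:E * \int[@lebesgue_measure R]_t \int[lebesgueRn R n]_v
    f (rV_cons (c * t + x0, c *: v + x')%R) = \int[@lebesgue_measure R]_t F (c * t + x0)%R)%E by [].
have mFc : measurable_fun [set: R] (fun t => F (c * t + x0)).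
  apply: (measurableT_comp mF); apply: measurable_funD; last exact: measurable_cst.
  by apply: measurable_funM; [exact: measurable_cst|exact: measurable_id].
under [RHS]eq_integral => t _ do
  rewrite /F -(IH x' (fun v => f (rV_cons (c * t + x0, v)))) //.
rewrite ge0_integralZl //.
- have := @measurable_fun_fubini_tonelli_F _ _ _ _ _ (lebesgueRn R n)
    (fun z : measurableTypeR R * 'rV[R]_n => f (rV_cons (c * z.1 + x0, c *: z.2 + x'))).
  apply.
    rewrite [X in measurable_fun _ X](_ : _ = (fun v => f (c *: v + x)) \o @rV_cons R n).
      exact: (measurableT_comp mfa (@measurable_rV_cons R n)).
    by apply/funext => -[t v] /=; rewrite E.
  by move=> z; exact: f0.
- by move=> t _; apply: integral_ge0.
Qed.

Lemma integral_shift n (x : 'rV[R]_n) (f : 'rV[R]_n -> \bar R) :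
  measurable_fun [set: 'rV[R]_n] f -> (forall t, 0 <= f t)%E ->
  (\int[lebesgueRn R n]_v f (v + x)%R = \int[lebesgueRn R n]_v f v)%E.
Proof.
move=> mf f0; rewrite -[RHS](@integral_affine n 1 x) ?oner_neq0 //.
by rewrite normr1 expr1n mul1e; under [in RHS]eq_integral do rewrite scale1r.
Qed.

Lemma integral_prod n (w : 'I_n -> R -> R) :
  (forall i, measurable_fun setT (w i)) -> (forall i t, 0 <= w i t) ->
  (\int[lebesgueRn R n]_v (\prod_(i < n) w i (v ord0 i))%:E =
   \prod_(i < n) \int[@lebesgue_measure R]_t (w i t)%:E)%E.
Proof.
elim: n w => [|n IH] w mw w0.
  by rewrite integral_rV0 !big_ord0.
have mprod m (u : 'I_m -> R -> R) : (forall i, measurable_fun setT (u i)) ->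
   measurable_fun [set: 'rV[R]_m] (fun v : 'rV[R]_m => (\prod_(i < m) u i (v ord0 i))%:E).
  move=> mu; apply/measurable_EFinP; apply: measurable_prod => i _.
  exact: (measurableT_comp (mu i) (measurable_coord i)).
rewrite integral_rV_cons; first last.
- by move=> v; rewrite lee_fin prodr_ge0.
- exact: mprod.
rewrite big_ord_recl -IH //.
under eq_integral => t _.
  under eq_integral => v _.
    rewrite big_ord_recl mxE unlift_none /= EFinM.
    under eq_bigr do rewrite mxE liftK /=.
    over.
  rewrite ge0_integralZl //; last 2 first.
  - by move=> v _; rewrite lee_fin prodr_ge0.
  - by rewrite lee_fin.
  over.
  exact: (mprod n (fun i => w (lift ord0 i))).
rewrite ge0_integralZr //.
- by apply/measurable_EFinP; exact: mw.
- by move=> t _; rewrite lee_fin.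
- by apply: integral_ge0 => v _; rewrite lee_fin prodr_ge0.
Qed.

(** The sigma-algebra comes from the coordinates, the topology from the sup norm. They are
    reconciled by covering U with those cubes [B (q, m)] of rational centre that it contains. The
    radius is taken below e / 2 because the centre is near v, not equal to it. *)
Lemma open_measurable_rV n (U : set 'rV[R]_n) : open U -> measurable U.
Proof.
move=> oU.
pose B (p : 'rV[rat]_n * nat) : set 'rV[R]_n :=
  [set v | forall i, `|ratr (p.1 ord0 i) - v ord0 i| < p.2.+1%:R^-1].
have mB p : measurable (B p).
  rewrite (_ : B p = \bigcap_(i in [set: 'I_n])
      ((fun v : 'rV[R]_n => v ord0 i) @^-1` [set t | `|ratr (p.1 ord0 i) - t| < p.2.+1%:R^-1])).
    apply: fin_bigcap_measurable => // i _; rewrite -[X in measurable X]setTI.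
    apply: (measurable_coord i) => //.
    rewrite (_ : [set t | _] = ball (ratr (p.1 ord0 i) : R) p.2.+1%:R^-1) //.
    exact: measurable_ball.
  by apply/seteqP; split => v /= Bv i; [move=> _|]; exact: Bv.
rewrite (_ : U = \bigcup_(p in [set p | B p `<=` U]) B p).
  rewrite bigcup_mkcond; apply: countable_bigcupT_measurable => [|p].
    exact: countableP.
  by case: ifP => _; [exact: mB|exact: measurable0].
apply/seteqP; split => [v Uv|v [p /= pU /pU]] //.
have /nbhs_ballP[e /= e0 eU] : nbhs v U by exact: open_nbhs_nbhs.
have [m me] : exists m : nat, m.+1%:R^-1 < e / 2.
  have [m] := near_infty_natSinv_lt (PosNum (divr_gt0 e0 (ltr0Sn R 1))) .
  by move=> _ /(_ m (leqnn m)) ?; exists m.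
have q_ (t : R) : exists q : rat, `|ratr q - t| < m.+1%:R^-1.
  have [q] := @rat_in_itvoo R (t - m.+1%:R^-1) (t + m.+1%:R^-1)
    ltac:(by rewrite ltrD2l gtrN // invr_gt0).
  by rewrite in_itv /= => qt; exists q; rewrite ltr_distlC -ltr_distl ltr_distlC.
pose q := \row_i (xget 0 [set q : rat | `|ratr q - v ord0 i| < m.+1%:R^-1]).
have qv : B (q, m) v.
  move=> i /=; rewrite mxE.
  exact: (xgetPex 0 (q_ (v ord0 i))).
exists (q, m) => //= w Bw; apply: eU; split => // i j.
rewrite (ord1 i) /ball /= [ltRHS]splitr.
rewrite (le_lt_trans (ler_distD (ratr (q ord0 j)) _ _)) // ltrD //.
  by rewrite distrC (lt_trans (qv j)).
by rewrite (lt_trans (Bw j)).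
Qed.

Lemma continuous_measurable_rV n (f : 'rV[R]_n -> R) :
  continuous f -> measurable_fun [set: 'rV[R]_n] f.
Proof.
move=> cf; apply: (measurability _ (RGenOpens.measurableE R)) => //.
move=> _ [_ [a [b ->] <-]]; rewrite setTI; apply: open_measurable_rV.
by have /continuousP := cf; apply; exact: interval_open.
Qed.

End RnMeasure.

(** * Euclidean geometry of row vectors *)

Section Euclid.
Context {R : realType} {n : nat}.
Implicit Types (x y z : 'rV[R]_n) (c : R).

Lemma dotC x y : dot x y = dot y x.
Proof. by apply: eq_bigr => i _; rewrite mulrC. Qed.

Lemma dotDl x y z : dot (x + y) z = dot x z + dot y z.
Proof. by rewrite -big_split; apply: eq_bigr => i _; rewrite mxE mulrDl. Qed.

Lemma dotZl c x y : dot (c *: x) y = c * dot x y.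
Proof. by rewrite /dot mulr_sumr; apply: eq_bigr => i _; rewrite mxE mulrA. Qed.

Lemma dotDr x y z : dot x (y + z) = dot x y + dot x z.
Proof. by rewrite !(dotC x) dotDl. Qed.

Lemma dotZr c x y : dot x (c *: y) = c * dot x y.
Proof. by rewrite !(dotC x) dotZl. Qed.

Lemma dotNl x y : dot (- x) y = - dot x y.
Proof. by rewrite -scaleN1r dotZl mulN1r. Qed.

Lemma dotNr x y : dot x (- y) = - dot x y.
Proof. by rewrite dotC dotNl dotC. Qed.

Lemma dot0l y : dot 0 y = 0.
Proof. by rewrite -(scale0r 0) dotZl mul0r. Qed.

Lemma dot_delta x i : dot x (delta_mx 0 i) = x ord0 i.
Proof.
rewrite /dot (bigD1 i) //= big1 ?addr0 ?mxE ?eqxx ?mulr1 // => j ji.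
by rewrite mxE (negbTE ji) andbF mulr0.
Qed.

Lemma dot_ge0 x : 0 <= dot x x.
Proof. by apply: sumr_ge0 => i _; rewrite -expr2 sqr_ge0. Qed.

Lemma dot_eq0 x : dot x x = 0 -> x = 0.
Proof.
move=> /eqP; rewrite psumr_eq0 => [/allP h|i _]; last by rewrite -expr2 sqr_ge0.
apply/rowP => i; have := h i (mem_index_enum i).
by rewrite /= -expr2 sqrf_eq0 => /eqP; rewrite (ord1 0) mxE.
Qed.

Lemma enorm_ge0 x : 0 <= enorm x.
Proof. exact: sqrtr_ge0. Qed.

Lemma enorm_sqr x : enorm x ^+ 2 = dot x x.
Proof. by rewrite sqr_sqrtr // dot_ge0. Qed.

Lemma enorm0 : enorm (0 : 'rV[R]_n) = 0.
Proof. by rewrite /enorm dot0l sqrtr0. Qed.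

Lemma enorm_eq0 x : enorm x = 0 -> x = 0.
Proof. by move=> h; apply: dot_eq0; rewrite -enorm_sqr h expr0n. Qed.

Lemma enormZ c x : enorm (c *: x) = `|c| * enorm x.
Proof.
by rewrite /enorm dotZl dotZr mulrA -expr2 sqrtrM ?sqr_ge0 // sqrtr_sqr.
Qed.

Lemma enormN x : enorm (- x) = enorm x.
Proof. by rewrite -scaleN1r enormZ normrN1 mul1r. Qed.

(** Expand the squared length of (y.y) x - (x.y) y, which is nonnegative, and divide by y.y. *)
Lemma dot_cs_sqr x y : dot x y ^+ 2 <= dot x x * dot y y.
Proof.
have [y0|y0] := eqVneq (dot y y) 0.
  by rewrite (dot_eq0 y0) (dotC x) !dot0l expr0n mulr0.
have yp : 0 < dot y y by rewrite lt_neqAle eq_sym y0 dot_ge0.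
have := dot_ge0 (dot y y *: x - dot x y *: y).
rewrite !(dotDl, dotDr, dotNl, dotNr, dotZl, dotZr) (dotC y x) => h.
rewrite -subr_ge0 -(pmulr_rge0 _ yp); apply: le_trans h _.
by rewrite le_eqVlt; apply/orP; left; apply/eqP; ring.
Qed.

Lemma normr_dot x y : `|dot x y| <= enorm x * enorm y.
Proof.
rewrite -(@ler_pXn2r _ 2) ?nnegrE ?mulr_ge0 ?enorm_ge0 //.
by rewrite exprMn !enorm_sqr real_normK ?num_real // dot_cs_sqr.
Qed.

Lemma enormD x y : enorm (x + y) <= enorm x + enorm y.
Proof.
rewrite -(@ler_pXn2r _ 2) ?nnegrE ?addr_ge0 ?enorm_ge0 //.
rewrite sqrrD !enorm_sqr !(dotDl, dotDr) (dotC y x).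
have := le_trans (ler_norm _) (normr_dot x y); lra.
Qed.

Lemma enormB_sym x y : enorm (x - y) = enorm (y - x).
Proof. by rewrite -enormN opprB. Qed.

Lemma normr_coord x i : `|x ord0 i| <= enorm x.
Proof.
rewrite -dot_delta; apply: le_trans (normr_dot _ _) _.
rewrite -[leRHS]mulr1 ler_wpM2l ?enorm_ge0 // /enorm dot_delta mxE !eqxx.
by rewrite sqrtr1.
Qed.

Lemma enorm_le_sum x : enorm x <= \sum_i `|x ord0 i|.
Proof.
rewrite -(@ler_pXn2r _ 2) ?nnegrE ?enorm_ge0 ?sumr_ge0 // enorm_sqr.
rewrite /dot expr2 mulr_suml; apply: ler_sum => i _.
rewrite -[leLHS]ger0_norm -?expr2 ?sqr_ge0 // normrX expr2 ler_wpM2l //.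
by rewrite (bigD1 i) //= lerDl sumr_ge0.
Qed.

Lemma enorm_le_mx x : enorm x <= n%:R * `|x|.
Proof.
apply: le_trans (enorm_le_sum x) _.
have -> : n%:R * `|x| = \sum_(i < n) `|x| by rewrite sumr_const card_ord mulr_natl.
apply: ler_sum => i _; rewrite {2}/Num.norm /= mx_normrE.
exact: (le_bigmax _ (fun ij : 'I_1 * 'I_n => `|x ij.1 ij.2|) (ord0, i)).
Qed.

Lemma measurable_dot d (T : measurableType d) (f g : T -> 'rV[R]_n) :
  measurable_fun setT f -> measurable_fun setT g ->
  measurable_fun setT (fun t => dot (f t) (g t)).
Proof.
move=> /measurable_fun_rVP mf /measurable_fun_rVP mg.
by apply: measurable_sum => i; apply: measurable_funM; [exact: mf|exact: mg].
Qed.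

Lemma measurable_enorm d (T : measurableType d) (f : T -> 'rV[R]_n) :
  measurable_fun setT f -> measurable_fun setT (fun t => enorm (f t)).
Proof.
move=> mf; apply: (@measurableT_comp _ _ _ _ _ _ (@Num.sqrt R)).
  by apply: continuous_measurable_fun; exact: sqrt_continuous.
exact: measurable_dot.
Qed.

Lemma measurable_addrV d (T : measurableType d) (f g : T -> 'rV[R]_n) :
  measurable_fun setT f -> measurable_fun setT g ->
  measurable_fun setT (fun t => f t + g t).
Proof.
move=> /measurable_fun_rVP mf /measurable_fun_rVP mg; apply/measurable_fun_rVP => i.
under eq_fun do rewrite mxE.
by apply: measurable_funD; [exact: mf|exact: mg].
Qed.

Lemma measurable_scalerV d (T : measurableType d) c (f : T -> 'rV[R]_n) :
  measurable_fun setT f -> measurable_fun setT (fun t => c *: f t).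
Proof.
move=> /measurable_fun_rVP mf; apply/measurable_fun_rVP => i.
under eq_fun do rewrite mxE.
by apply: measurable_funM; [exact: measurable_cst|exact: mf].
Qed.

Lemma measurable_subrV d (T : measurableType d) (f g : T -> 'rV[R]_n) :
  measurable_fun setT f -> measurable_fun setT g ->
  measurable_fun setT (fun t => f t - g t).
Proof.
move=> mf mg; under eq_fun do rewrite -scaleN1r.
by apply: measurable_addrV => //; exact: measurable_scalerV.
Qed.

Lemma measurable_eball x (r : R) : measurable (eball x r).
Proof.
rewrite /eball -[X in measurable X]setTI.
have m1 : measurable_fun [set: 'rV[R]_n] (fun y => enorm (y - x)).
  apply: measurable_enorm; apply: measurable_subrV; first exact: measurable_id.
  exact: measurable_cst.
have := @measurable_fun_ltr _ _ _ _ _ _ m1 (@measurable_cst _ _ _ _ _ r).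
by move=> /(_ measurableT [set true] ltac:(by [])); rewrite setTI.
Qed.

End Euclid.

(** * Volumes of balls, Gaussian integrals and an integrable weight *)

Section EuclidMeasure.
Context {R : realType} {n : nat}.
Implicit Types (x y z : 'rV[R]_n) (c r t : R).
Local Notation mu := (lebesgueRn R n).

Definition unit_ball_vol : R := fine (mu (eball (0 : 'rV[R]_n) 1)).

Lemma box_measure (B : 'I_n -> set R) (b : R) :
  (forall i, measurable (B i)) -> (forall i, lebesgue_measure (B i) = b%:E) ->
  mu [set v : 'rV[R]_n | forall i, B i (v ord0 i)] = (b ^+ n)%:E.
Proof.
move=> mB Bb; rewrite lebesgueRn_box //.
rewrite (eq_bigr (fun=> b%:E)); last by move=> i _; exact: Bb.
by rewrite prodEFin prodr_const card_ord.
Qed.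

Lemma measurable_box (B : 'I_n -> set R) : (forall i, measurable (B i)) ->
  measurable [set v : 'rV[R]_n | forall i, B i (v ord0 i)].
Proof.
move=> mB; rewrite (_ : [set _ | _] = \bigcap_(i in [set: 'I_n])
    ((fun v : 'rV[R]_n => v ord0 i) @^-1` B i)).
  apply: fin_bigcap_measurable => // i _; rewrite -[X in measurable X]setTI.
  exact: (measurable_coord i).
by apply/seteqP; split => v /= Bv i; [move=> _|]; exact: Bv.
Qed.

Lemma mu_unit_ball_lty : (mu (eball (0 : 'rV[R]_n) 1) < +oo)%E.
Proof.
pose B (i : 'I_n) : set R := `[-1, 1]%classic.
have mB i : measurable (B i) by exact: measurable_itv.
apply: (@le_lt_trans _ _ (mu [set v : 'rV[R]_n | forall i, B i (v ord0 i)])).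
  apply: le_measure; rewrite ?inE; [exact: measurable_eball|exact: measurable_box|].
  move=> v; rewrite /eball /= subr0 => v1 i; rewrite /B /= in_itv /= -ler_norml.
  by apply: le_trans (normr_coord v i) (ltW v1).
rewrite (@box_measure _ 2) ?ltry // => i; rewrite /B lebesgue_measure_itv /= lte_fin.
by rewrite ifT -?EFinB; [congr (_%:E); ring|lra].
Qed.

Lemma unit_ball_volE : mu (eball (0 : 'rV[R]_n) 1) = unit_ball_vol%:E.
Proof. by rewrite fineK // ge0_fin_numE // mu_unit_ball_lty. Qed.

Lemma unit_ball_vol_gt0 : 0 < unit_ball_vol.
Proof.
rewrite -lte_fin -unit_ball_volE.
(* With half-side 1 / (n + 1) the l^1 norm on the cube is at most n / (n + 1) < 1; the shift by one
   keeps this strict and covers n = 0. *)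
pose e : R := n.+1%:R^-1.
pose B (i : 'I_n) : set R := `]- e, e[%classic.
have e0 : 0 < e by rewrite invr_gt0.
have mB i : measurable (B i) by exact: measurable_itv.
apply: (@lt_le_trans _ _ (mu [set v : 'rV[R]_n | forall i, B i (v ord0 i)])).
  rewrite (@box_measure _ (2 * e)) ?lte_fin ?exprn_gt0 ?mulr_gt0 // => i.
  rewrite /B lebesgue_measure_itv /= lte_fin ifT -?EFinB; last by lra.
  by congr (_%:E); ring.
apply: le_measure; rewrite ?inE; [exact: measurable_box|exact: measurable_eball|].
move=> v Bv; rewrite /eball /= subr0; apply: le_lt_trans (enorm_le_sum v) _.
apply: (@le_lt_trans _ _ (\sum_(i < n) e)).
  apply: ler_sum => i _; have := Bv i; rewrite /B /= in_itv /= -ltr_norml.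
  exact: ltW.
rewrite sumr_const card_ord -mulr_natr /e mulrC ltr_pdivrMr ?mul1r //.
by rewrite ltr_nat.
Qed.

Lemma mu_eball x r : 0 < r -> mu (eball x r) = (r ^+ n * unit_ball_vol)%:E.
Proof.
move=> r0; rewrite EFinM -unit_ball_volE.
have E A : measurable A -> mu A = (\int[mu]_v (\1_A v)%:E)%E.
  by move=> mA; rewrite integral_indic // setIT.
rewrite !E; [|exact: measurable_eball|exact: measurable_eball].
rewrite -(@integral_affine R n r x) ?gt_eqF //.
- rewrite gtr0_norm //; congr (_ * _)%E; apply: eq_integral => v _.
  congr (_%:E); rewrite !indicE; congr (_%:R); congr nat_of_bool.
  apply/idP/idP; rewrite !inE /eball /= subr0 addrK enormZ gtr0_norm //.
    by rewrite -[ltRHS]mulr1 ltr_pM2l.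
  by rewrite -[X in _ -> _ < X]mulr1 ltr_pM2l.
- by apply/measurable_EFinP; apply: measurable_indic; exact: measurable_eball.
Qed.

Definition gaussian_mass t : R := Num.sqrt (pi / t) ^+ n.

Lemma gaussian_mass_gt0 t : 0 < t -> 0 < gaussian_mass t.
Proof. by move=> t0; rewrite exprn_gt0 // sqrtr_gt0 divr_gt0 // pi_gt0. Qed.

Definition gaussian t x : R := expR (- (t * dot x x)).

Lemma gaussian_gt0 t x : 0 < gaussian t x.
Proof. exact: expR_gt0. Qed.

Lemma gaussian_ge0 t x : 0 <= gaussian t x.
Proof. exact: expR_ge0. Qed.

Lemma gaussian_le1 t x : 0 <= t -> gaussian t x <= 1.
Proof. by move=> t0; rewrite /gaussian expR_le1 oppr_le0 mulr_ge0 ?dot_ge0. Qed.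

Lemma measurable_gaussian t : measurable_fun [set: 'rV[R]_n] (gaussian t).
Proof.
apply: measurableT_comp => //; apply: measurableT_comp => //.
apply: measurable_funM; first exact: measurable_cst.
by apply: measurable_dot; exact: measurable_id.
Qed.

Lemma integral_gaussian t : 0 < t ->
  (\int[mu]_x (gaussian t x)%:E = (gaussian_mass t)%:E)%E.
Proof.
move=> t0.
transitivity (\int[mu]_x (\prod_(i < n) (fun s => expR (- (t * (s * s)))) (x ord0 i))%:E)%E.
  by apply: eq_integral => x _; rewrite -expR_sum /gaussian /dot mulr_sumr sumrN.
have mg : measurable_fun setT (fun s : R => expR (- (t * (s * s)))).
  apply: measurableT_comp => //; apply: measurableT_comp => //.
  apply: measurable_funM; first exact: measurable_cst.
  by apply: measurable_funM; exact: measurable_id.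
rewrite (integral_prod (w := fun _ s => expR (- (t * (s * s))))) //.
have -> : (\int[@lebesgue_measure R]_s (expR (- (t * (s * s))))%:E = (Num.sqrt (pi / t))%:E)%E.
  have st0 : Num.sqrt t != 0 by rewrite gt_eqF // sqrtr_gt0.
  have h : ((Num.sqrt t)%:E * \int[@lebesgue_measure R]_s (expR (- (t * (s * s))))%:E
      = (Num.sqrt pi)%:E)%E.
    have mgf : measurable_fun [set: R] (fun s : R => (gauss_fun s)%:E).
      by apply/measurable_EFinP; exact: measurable_gauss_fun.
    have gf0 (s : R) : (0 <= (gauss_fun s)%:E)%E by rewrite lee_fin gauss_fun_ge0.
    rewrite -integralT_gauss -(@integral_affine1 R _ 0 _ st0 mgf gf0).
    rewrite (ger0_norm (sqrtr_ge0 t)); congr (_ * _)%E; apply: eq_integral => s _.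
    by rewrite /gauss_fun addr0 exprMn sqr_sqrtr ?ltW // expr2.
  rewrite sqrtrM ?pi_ge0 // EFinM -h muleAC -EFinM sqrtrV ?ltW // mulfV ?mul1e //.
by rewrite prodEFin prodr_const card_ord.
Qed.

(** A product over the coordinates, so that its integral reduces to that of 1 / (1 + s^2). It serves
    as the universal integrable majorant of rapidly decreasing functions. *)
Definition weight x : R := \prod_(i < n) (1 + x ord0 i ^+ 2)^-1.

Lemma weight_gt0 x : 0 < weight x.
Proof. by apply: prodr_gt0 => i _; rewrite invr_gt0 ltr_pwDl ?sqr_ge0. Qed.

Lemma weight_ge0 x : 0 <= weight x.
Proof. exact/ltW/weight_gt0. Qed.

Lemma measurable_weight : measurable_fun [set: 'rV[R]_n] weight.
Proof.
apply: measurable_prod => i _.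
apply: (measurableT_comp (f := fun s : R => (1 + s ^+ 2)^-1)); last exact: measurable_coord.
apply: continuous_measurable_fun; exact: continuous_oneDsqrV.
Qed.

Lemma weightV_le x : (weight x)^-1 <= (1 + enorm x ^+ 2) ^+ n.
Proof.
rewrite /weight -prodfV -[X in _ <= _ ^+ X]card_ord -prodr_const.
apply: ler_prod => i _; rewrite invrK addr_ge0 ?sqr_ge0 //= lerD2l.
by rewrite -real_normK ?num_real // ler_pXn2r ?nnegrE ?enorm_ge0 // normr_coord.
Qed.

Lemma integral_weight_lty : (\int[mu]_x (weight x)%:E < +oo)%E.
Proof.
have mw : measurable_fun setT (fun s : R => (1 + s ^+ 2)^-1).
  by apply: continuous_measurable_fun; exact: continuous_oneDsqrV.
rewrite (integral_prod (w := fun _ s => (1 + s ^+ 2)^-1)) //; last first.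
  by move=> i s; rewrite invr_ge0 addr_ge0 ?sqr_ge0.
rewrite ge0_symfun_integralT.
- rewrite -set_itvcy integral0y_oneDsqr -EFinM.
  by rewrite prodEFin ltry.
- by move=> t; rewrite invr_ge0 addr_ge0 ?sqr_ge0.
- exact: continuous_oneDsqrV.
- by move=> t /=; rewrite sqrrN.
Qed.

End EuclidMeasure.

(** * The maximal theorem on L^2 *)

Section NNMeas.
Context {d} {T : measurableType d} {R : realType}.
Implicit Types F G : T -> \bar R.
Local Open Scope ereal_scope.

(** Exactly the hypotheses of Tonelli and of monotonicity; the maximal theorem is carried out with
    values in [0, +oo], so no integrability has to be tracked. *)
Definition nnmeas F := measurable_fun setT F /\ forall x, 0 <= F x.

Lemma nnmeasM F G : nnmeas F -> nnmeas G -> nnmeas (fun x => F x * G x).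
Proof.
move=> [mF F0] [mG G0]; split; first exact: emeasurable_funM.
by move=> x; exact: mule_ge0.
Qed.

Lemma nnmeasD F G : nnmeas F -> nnmeas G -> nnmeas (fun x => F x + G x).
Proof.
move=> [mF F0] [mG G0]; split; first exact: emeasurable_funD.
by move=> x; exact: adde_ge0.
Qed.

Lemma nnmeas_max F G : nnmeas F -> nnmeas G -> nnmeas (fun x => maxe (F x) (G x)).
Proof.
move=> [mF F0] [mG G0]; split; first exact: measurable_maxe.
by move=> x; rewrite le_max F0.
Qed.

Lemma nnmeas_cst (c : \bar R) : 0 <= c -> nnmeas (fun=> c).
Proof. by move=> c0; split => //; exact: measurable_cst. Qed.

Lemma nnmeas_EFin (f : T -> R) :
  measurable_fun setT f -> (forall x, 0 <= f x)%R -> nnmeas (fun x => (f x)%:E).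
Proof.
move=> mf f0; split; first exact/measurable_EFinP.
by move=> x; rewrite lee_fin.
Qed.

Lemma nnmeas_sum N (F_ : 'I_N -> T -> \bar R) : (forall k, nnmeas (F_ k)) ->
  nnmeas (fun x => \sum_(k < N) F_ k x).
Proof.
move=> nF; split; first by apply: emeasurable_sum => k; exact: (nF k).1.
by move=> x; apply: sume_ge0 => k _; exact: (nF k).2.
Qed.

Variable mu : {measure set T -> \bar R}.

Lemma nn_integralD F G : nnmeas F -> nnmeas G ->
  \int[mu]_x (F x + G x) = \int[mu]_x F x + \int[mu]_x G x.
Proof. by move=> [mF F0] [mG G0]; rewrite ge0_integralD. Qed.

Lemma nn_integralZl (c : R) F : nnmeas F -> (0 <= c)%R ->
  \int[mu]_x (c%:E * F x) = c%:E * \int[mu]_x F x.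
Proof. by move=> [mF F0] c0; rewrite ge0_integralZl // lee_fin. Qed.

Lemma nn_integral_sum N (F_ : 'I_N -> T -> \bar R) : (forall k, nnmeas (F_ k)) ->
  \int[mu]_x (\sum_(k < N) F_ k x) = \sum_(k < N) \int[mu]_x F_ k x.
Proof.
move=> nF; rewrite ge0_integral_sum // => k.
  exact: (nF k).1.
by move=> x _; exact: (nF k).2.
Qed.

Lemma nn_le_integral F G : nnmeas F -> nnmeas G -> (forall x, F x <= G x) ->
  \int[mu]_x F x <= \int[mu]_x G x.
Proof. by move=> [mF F0] [mG G0] FG; apply: ge0_le_integral. Qed.

End NNMeas.

Section NNTonelli.
Context {d1 d2} {T1 : measurableType d1} {T2 : measurableType d2} {R : realType}.
Variables (m1 : {sigma_finite_measure set T1 -> \bar R})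
          (m2 : {sigma_finite_measure set T2 -> \bar R}).
Local Open Scope ereal_scope.

Lemma nnmeas_integral (F : T1 -> T2 -> \bar R) :
  nnmeas (fun z : T1 * T2 => F z.1 z.2) -> nnmeas (fun x => \int[m2]_y F x y).
Proof.
move=> [mF F0]; split.
  exact: (measurable_fun_fubini_tonelli_F (m2 := m2) (fun z => F z.1 z.2)).
by move=> x; apply: integral_ge0 => y _; exact: (F0 (x, y)).
Qed.

Lemma nn_tonelli (F : T1 -> T2 -> \bar R) :
  nnmeas (fun z : T1 * T2 => F z.1 z.2) ->
  \int[m1]_x \int[m2]_y F x y = \int[m2]_y \int[m1]_x F x y.
Proof. by move=> [mF F0]; exact: (fubini_tonelli (fun z => F z.1 z.2)). Qed.

Lemma nnmeas_fst (F : T1 -> \bar R) : nnmeas F -> nnmeas (fun z : T1 * T2 => F z.1).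
Proof.
move=> [mF F0]; split => //; exact: (measurableT_comp mF measurable_fst).
Qed.

Lemma nnmeas_snd (F : T2 -> \bar R) : nnmeas F -> nnmeas (fun z : T1 * T2 => F z.2).
Proof.
move=> [mF F0]; split => //; exact: (measurableT_comp mF measurable_snd).
Qed.

End NNTonelli.

(** Stands in for Cauchy-Schwarz in the maximal theorem; the free parameter t distributes the
    constants between the two squares. *)
Lemma mule_le_amgm (R : realType) (t : R) (a b : \bar R) : 0 < t ->
  (0 <= a -> 0 <= b ->
   a * b <= (t / 2)%:E * (a * a) + (t^-1 / 2)%:E * (b * b))%E.
Proof.
move=> t0; have t2 : 0 < t / 2 by rewrite divr_gt0.
have tv2 : 0 < t^-1 / 2 by rewrite divr_gt0 // invr_gt0.
case: a => [a| |] //; case: b => [b| |] //= a0 b0.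
- rewrite -!EFinM -EFinD lee_fin -subr_ge0.
  have -> : t / 2 * (a * a) + t^-1 / 2 * (b * b) - a * b
     = (t * a - b) ^+ 2 * (t^-1 / 2) by field; exact: lt0r_neq0.
  by rewrite mulr_ge0 ?sqr_ge0 // ltW.
- by rewrite mulyy (gt0_muley (x := (t^-1 / 2)%:E)) // addey ?leey // -EFinM.
- by rewrite mulyy (gt0_muley (x := (t / 2)%:E)) // addye ?leey // -EFinM.
- by rewrite !mulyy !gt0_muley.
Qed.

(** * Averages over balls *)

Section Averages.
Context {R : realType} {n : nat}.
Local Notation mu := (lebesgueRn R n).
Local Notation V := 'rV[R]_n.
Implicit Types (x y z : V) (r s : R) (F G : V -> \bar R).

(** Writing the mean as an integral against a kernel on the whole space, symmetric in x and y, makes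
    the averaging operator self-adjoint by Tonelli. *)
Definition ball_kernel r x y : R :=
  (r ^+ n * @unit_ball_vol R n)^-1 * (enorm (y - x) < r)%R%:R.

Definition avg r F x : \bar R := (\int[mu]_y ((ball_kernel r x y)%:E * F y))%E.

Lemma ball_kernelC r x y : ball_kernel r x y = ball_kernel r y x.
Proof. by rewrite /ball_kernel enormB_sym. Qed.

Lemma ball_kernel_ge0 r x y : 0 < r -> 0 <= ball_kernel r x y.
Proof.
move=> r0; rewrite mulr_ge0 // invr_ge0 mulr_ge0 ?exprn_ge0 ?ltW //.
exact: unit_ball_vol_gt0.
Qed.

Lemma measurable_ball_kernel d (T : measurableType d) r (f g : T -> V) :
  measurable_fun setT f -> measurable_fun setT g ->
  measurable_fun setT (fun t => ball_kernel r (f t) (g t)).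
Proof.
move=> mf mg; apply: measurable_funM; first exact: measurable_cst.
apply: (measurableT_comp (f := fun b : bool => b%:R : R)); first by [].
apply: measurable_fun_ltr; last exact: measurable_cst.
by apply: measurable_enorm; exact: measurable_subrV.
Qed.

Lemma nnmeas_ball_kernel d (T : measurableType d) r (f g : T -> V) : 0 < r ->
  measurable_fun setT f -> measurable_fun setT g ->
  nnmeas (fun t => (ball_kernel r (f t) (g t))%:E).
Proof.
move=> r0 mf mg; apply: nnmeas_EFin; first exact: measurable_ball_kernel.
by move=> t; exact: ball_kernel_ge0.
Qed.

Lemma integral_ball_kernel r x : 0 < r ->
  (\int[mu]_y (ball_kernel r x y)%:E = 1)%E.
Proof.
move=> r0; have vr : 0 < r ^+ n * @unit_ball_vol R n.
  by rewrite mulr_gt0 ?exprn_gt0 // unit_ball_vol_gt0.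
have E y : (ball_kernel r x y)%:E =
   (((r ^+ n * @unit_ball_vol R n)^-1)%:E * (\1_(eball x r) y)%:E)%E.
  rewrite -EFinM indicE /ball_kernel; congr ((_ * _%:R)%:E).
  by congr nat_of_bool; apply/idP/idP; rewrite inE.
under eq_integral do rewrite E.
rewrite nn_integralZl ?invr_ge0 ?ltW //; last first.
  apply: nnmeas_EFin => //; apply: measurable_indic; exact: measurable_eball.
rewrite integral_indic //; last exact: measurable_eball.
rewrite setIT.
have := mu_eball x r0; rewrite /= => ->; by rewrite -EFinM mulVf // gt_eqF.
Qed.

Lemma avg_maximalE r F x : 0 < r -> nnmeas F ->
  ((mu (eball x r))^-1 * \int[mu]_(y in eball x r) F y)%E = avg r F x.
Proof.
move=> r0 [mF F0]; have vr : 0 < r ^+ n * @unit_ball_vol R n.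
  by rewrite mulr_gt0 ?exprn_gt0 // unit_ball_vol_gt0.
rewrite mu_eball // inver gt_eqF // integral_mkcond.
rewrite -nn_integralZl ?invr_ge0 ?ltW //; last first.
  split; first by apply/(measurable_restrictT _ _).1 => //; [exact: measurable_eball|
     exact: measurable_funTS].
  by move=> y; exact: erestrict_ge0.
apply: eq_integral => y _; rewrite /ball_kernel patchE EFinM -muleA; congr (_ * _)%E.
case: ifPn; rewrite ?inE ?notin_setE /eball /= => h; first by rewrite h mul1e.
by move/negP/negbTE : h => ->; rewrite mul0e.
Qed.

Lemma nnmeas_avg r F : 0 < r -> nnmeas F -> nnmeas (avg r F).
Proof.
move=> r0 nF; apply: nnmeas_integral; apply: nnmeasM; last exact: nnmeas_snd.
by apply: nnmeas_ball_kernel.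
Qed.

Lemma avg_ge0 r F x : 0 < r -> nnmeas F -> (0 <= avg r F x)%E.
Proof. by move=> r0 nF; exact: (nnmeas_avg r0 nF).2. Qed.

Lemma avg_adjoint r F G : 0 < r -> nnmeas F -> nnmeas G ->
  (\int[mu]_x (avg r F x * G x) = \int[mu]_x (F x * avg r G x))%E.
Proof.
move=> r0 nF nG.
have nk x : nnmeas (fun y => (ball_kernel r x y)%:E).
  by apply: nnmeas_ball_kernel.
transitivity (\int[mu]_x \int[mu]_y ((ball_kernel r x y)%:E * F y * G x))%E.
  apply: eq_integral => x _; rewrite ge0_integralZr //; last 2 first.
  - by move=> y _; exact: (nnmeasM (nk x) nF).2.
  - exact: nG.2.
  exact: (nnmeasM (nk x) nF).1.
rewrite nn_tonelli; last first.
  apply: nnmeasM; last exact: nnmeas_fst.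
  apply: nnmeasM; last exact: nnmeas_snd.
  by apply: nnmeas_ball_kernel.
apply: eq_integral => y _; rewrite -ge0_integralZl //.
- by apply: eq_integral => x _; rewrite ball_kernelC -muleA muleCA.
- exact: (nnmeasM (nk y) nG).1.
- by move=> x _; exact: (nnmeasM (nk y) nG).2.
- exact: nF.2.
Qed.

Lemma avg_le r F G : 0 < r -> nnmeas F -> nnmeas G -> (forall x, (F x <= G x)%E) ->
  forall x, (avg r F x <= avg r G x)%E.
Proof.
move=> r0 nF nG FG x.
have nk : nnmeas (fun y => (ball_kernel r x y)%:E).
  by apply: nnmeas_ball_kernel.
apply: nn_le_integral; [exact: nnmeasM|exact: nnmeasM|].
by move=> y; apply: lee_wpmul2l => //; exact: nk.2.
Qed.

(** The ball of radius s about a point within r <= s of x lies in the ball of radius 2s about x,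
    whose volume is 2^n times larger. This controls the cross terms in the TT* method. *)
Lemma avg_avg r s F x : 0 < r -> r <= s -> nnmeas F ->
  (avg r (avg s F) x <= (2 ^+ n)%:E * avg (2 * s) F x)%E.
Proof.
move=> r0 rs nF; have s0 : 0 < s by exact: lt_le_trans rs.
have s20 : 0 < 2 * s by rewrite mulr_gt0.
have nk u v : 0 < u -> nnmeas (fun y => (ball_kernel u v y)%:E).
  by move=> u0; apply: nnmeas_ball_kernel.
rewrite /avg.
rewrite [leLHS](_ : _ =
  \int[mu]_z \int[mu]_y ((ball_kernel r x z)%:E * ((ball_kernel s z y)%:E * F y)))%E; last first.
  apply: eq_integral => z _.
  by rewrite -nn_integralZl ?ball_kernel_ge0 //; exact: nnmeasM (nk s z s0) nF.
rewrite nn_tonelli; last first.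
  apply: nnmeasM.
    by apply: nnmeas_ball_kernel.
  apply: nnmeasM; last exact: nnmeas_snd.
  by apply: nnmeas_ball_kernel.
rewrite -nn_integralZl ?exprn_ge0 //; last exact: nnmeasM (nk _ x s20) nF.
apply: nn_le_integral.
- apply: nnmeas_integral; apply: nnmeasM.
    by apply: nnmeas_ball_kernel.
  apply: nnmeasM; last exact: nnmeas_fst.
  by apply: nnmeas_ball_kernel.
- by apply: nnmeasM; [apply: nnmeas_cst; rewrite lee_fin exprn_ge0|exact: nnmeasM (nk _ x s20) nF].
move=> y.
have -> : ((2 ^+ n)%:E * ((ball_kernel (2 * s) x y)%:E * F y) =
   \int[mu]_z ((ball_kernel r x z)%:E * ((2 ^+ n * ball_kernel (2 * s) x y)%:E * F y)))%E.
  rewrite ge0_integralZr //; last 3 first.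
  - exact: (nk r x r0).1.
  - by move=> z _; exact: (nk r x r0).2.
  - by rewrite mule_ge0 ?(nF.2) // lee_fin mulr_ge0 ?exprn_ge0 ?ball_kernel_ge0.
  by rewrite integral_ball_kernel // mul1e EFinM muleA.
apply: nn_le_integral.
- apply: nnmeasM; first exact: nk.
  apply: nnmeasM; last exact: nnmeas_cst (nF.2 y).
  by apply: nnmeas_ball_kernel.
- apply: nnmeasM; first exact: nk.
  by apply: nnmeas_cst; rewrite mule_ge0 ?(nF.2) // lee_fin mulr_ge0 ?exprn_ge0 ?ball_kernel_ge0.
move=> z; have [zr|zr] := boolP (enorm (z - x) < r); last first.
  by rewrite /ball_kernel (negbTE zr) !mulr0 !mul0e.
apply: lee_wpmul2l; first by rewrite lee_fin ball_kernel_ge0.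
apply: lee_wpmul2r; first exact: nF.2.
rewrite lee_fin /ball_kernel.
have [yz|yz] := boolP (enorm (y - z) < s); last first.
  by rewrite mulr0 !mulr_ge0 ?exprn_ge0 // invr_ge0 mulr_ge0 ?exprn_ge0 // ltW ?unit_ball_vol_gt0.
have -> : enorm (y - x) < 2 * s.
  rewrite (_ : y - x = (y - z) + (z - x)); last by rewrite addrA subrK.
  apply: le_lt_trans (enormD _ _) _; rewrite mulr_natl mulr2n ltrD //.
  exact: lt_le_trans rs.
rewrite !mulr1 exprMn -(mulrA (2 ^+ n)) [in leRHS]invfM [leRHS]mulrA.
by rewrite mulfV ?mul1r // gt_eqF // exprn_gt0.
Qed.

End Averages.

(** * The maximal theorem for finitely many dyadic radii *)

Section MaximalL2.
Context {R : realType} {n : nat}.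
Local Notation mu := (lebesgueRn R n).
Local Notation V := 'rV[R]_n.
Implicit Types (x y z : V) (r s : R) (F G : V -> \bar R).

Lemma avg_jensen r F x : 0 < r -> nnmeas F ->
  (avg r F x * avg r F x <= avg r (fun y => F y * F y) x)%E.
Proof.
move=> r0 nF.
have nk : nnmeas (fun y => (ball_kernel r x y)%:E) by apply: nnmeas_ball_kernel.
(* Integrate the pointwise inequality F A <= F^2 / 2 + A^2 / 2 for a constant A; choosing A equal to
   the average itself gives Jensen's inequality. If that average is infinite, A = 1 shows that the
   average of the squares is infinite too. *)
have half (A : \bar R) : (0 <= A)%E ->
    (avg r F x * A <= (1 / 2)%:E * avg r (fun y => F y * F y) x + (1 / 2)%:E * (A * A))%E.
  move=> A0.
  rewrite [leLHS](_ : _ = \int[mu]_y ((ball_kernel r x y)%:E * F y * A))%E; last first.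
    rewrite ge0_integralZr //; first exact: (nnmeasM nk nF).1.
    by move=> y _; exact: (nnmeasM nk nF).2.
  have nFF : nnmeas (fun y => (ball_kernel r x y)%:E * (F y * F y))%E.
    by apply: nnmeasM => //; exact: nnmeasM.
  have nkA : nnmeas (fun y => (ball_kernel r x y)%:E * (A * A))%E.
    by apply: nnmeasM => //; apply: nnmeas_cst; exact: mule_ge0.
  have half0 : (0 <= (1 / 2)%:E :> \bar R)%E by rewrite lee_fin.
  rewrite [leRHS](_ : _ = \int[mu]_y ((1 / 2)%:E * ((ball_kernel r x y)%:E * (F y * F y))
     + (1 / 2)%:E * ((ball_kernel r x y)%:E * (A * A))))%E; last first.
    rewrite nn_integralD ?nn_integralZl //; last 2 first.
    - by apply: nnmeasM => //; exact: nnmeas_cst.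
    - by apply: nnmeasM => //; exact: nnmeas_cst.
    congr (_ + _ * _)%E; rewrite ge0_integralZr ?mule_ge0 //; last first.
    - by move=> y _; exact: nk.2.
    - exact: nk.1.
    by rewrite integral_ball_kernel // mul1e.
  apply: nn_le_integral.
  - by apply: nnmeasM; [exact: nnmeasM|exact: nnmeas_cst].
  - by apply: nnmeasD; (apply: nnmeasM => //; exact: nnmeas_cst).
  move=> y; rewrite -muleA !(muleCA (1 / 2)%:E (ball_kernel r x y)%:E) -ge0_muleDr; last 2 first.
  - by rewrite mule_ge0 // mule_ge0 // nF.2.
  - by rewrite mule_ge0 // mule_ge0.
  apply: lee_wpmul2l; rewrite ?nk.2 //.
  by have := @mule_le_amgm _ 1 (F y) A ltr01 (nF.2 y) A0; rewrite invr1.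
have A0 := avg_ge0 x r0 nF; have S0 := avg_ge0 x r0 (nnmeasM nF nF).
case: (avg r F x) A0 half => [A| |] // A0 half.
  have := half A%:E A0; case: (avg r _ x) S0 => [B| |] // _; last by rewrite leey.
  by rewrite -!EFinM -EFinD !lee_fin => h; lra.
have := half 1%E lee01; case: (avg r _ x) S0 => [B| |] // _.
by rewrite mule1 -!EFinM -EFinD leye_eq.
Qed.

Lemma integral_avg_sq r F : 0 < r -> nnmeas F ->
  (\int[mu]_x (avg r F x * avg r F x) <= \int[mu]_x (F x * F x))%E.
Proof.
move=> r0 nF; have nFF := nnmeasM nF nF; have nA := nnmeas_avg r0 nF.
apply: (@le_trans _ _ (\int[mu]_x (avg r (fun y => F y * F y)%E x * 1)))%E.
  apply: nn_le_integral; first exact: nnmeasM.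
    by apply: nnmeasM; [exact: nnmeas_avg|exact: (nnmeas_cst lee01)].
  by move=> x; rewrite mule1; exact: avg_jensen.
rewrite (avg_adjoint (G := fun=> 1%E)) //.
rewrite le_eqVlt; apply/orP; left; apply/eqP; apply: eq_integral => x _.
rewrite [X in (_ * X)%E](_ : _ = 1%E) ?mule1 //.
by rewrite /avg; under eq_integral do rewrite mule1; exact: integral_ball_kernel.
Qed.

Variable r0 : R.
Hypothesis r0_gt0 : 0 < r0.

Let rad k := 2 ^+ k * r0.
Let rad_gt0 k : 0 < rad k. Proof. by rewrite mulr_gt0 // exprn_gt0. Qed.

(** Finitely many radii give an a priori bound on L^2, with constant N, so that quantities can later
    be absorbed. The smallest radius [r0] stays free and tends to 0 at the end. *)
Fixpoint dyadic_max N F x : \bar R :=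
  if N is k.+1 then maxe (dyadic_max k F x) (avg (2 ^+ k * r0) F x) else 0%E.

Lemma nnmeas_dyadic_max N F : nnmeas F -> nnmeas (dyadic_max N F).
Proof.
move=> nF; elim: N => [|N IH]; first exact: nnmeas_cst.
by apply: nnmeas_max => //; exact: (nnmeas_avg (rad_gt0 N) nF).
Qed.

Lemma avg_le_dyadic_max N k F x : (k < N)%N -> (avg (2 ^+ k * r0) F x <= dyadic_max N F x)%E.
Proof.
elim: N => // N IH; rewrite ltnS leq_eqVlt => /predU1P[->|/IH h] /=.
  by rewrite le_max lexx orbT.
by rewrite le_max h.
Qed.

(** The functions [phi k] are the indicators of the measurable sets where the k-th radius realizes
    the maximum. The strict inequality in [b] gives ties to the smaller radius. *)
Lemma dyadic_max_linearize N F : nnmeas F ->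
  exists phi : nat -> V -> \bar R,
   [/\ forall k, nnmeas (phi k),
       forall x, (\sum_(k < N.+1) phi k x = 1)%E &
       forall x, (dyadic_max N.+1 F x = \sum_(k < N.+1) (phi k x * avg (rad k) F x))%E].
Proof.
move=> nF; elim: N => [|N [phi [nphi phi1 phiE]]].
  exists (fun _ _ => 1%E); split => [k|x|x]; first exact: (nnmeas_cst lee01).
    by rewrite big_ord1.
  rewrite big_ord1 mul1e /=; apply/max_idPr; exact: (avg_ge0 x (rad_gt0 0) nF).
pose b x := (dyadic_max N.+1 F x < avg (rad N.+1) F x)%E.
have mb : measurable_fun setT b.
  apply: measurable_fun_lte.
    exact: (nnmeas_dyadic_max N.+1 nF).1.
  exact: (nnmeas_avg (rad_gt0 _) nF).1.
have nb (c : bool -> R) : (forall b, 0 <= c b) -> nnmeas (fun x => (c (b x))%:E).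
  by move=> c0; apply: nnmeas_EFin => //; exact: (measurableT_comp (f := c)).
exists (fun k => if k == N.+1 then fun x => (b x)%:R%:E else fun x => ((~~ b x)%:R%:E * phi k x)%E).
split => [k|x|x].
- case: ifP => _; first exact: (nb (fun b => b%:R)).
  by apply: nnmeasM => //; exact: (nb (fun b => (~~ b)%:R)).
- rewrite big_ord_recr /= eqxx.
  under eq_bigr => k _ do rewrite (ltn_eqF (ltn_ord k)).
  rewrite -ge0_sume_distrr; last by move=> k _; exact: (nphi k).2.
  by rewrite phi1; case: (b x); rewrite ?mul0e ?mule1 ?add0e ?adde0.
- have -> : dyadic_max N.+2 F x = maxe (dyadic_max N.+1 F x) (avg (rad N.+1) F x) by [].
  rewrite big_ord_recr eqxx.
  under eq_bigr => k _ do rewrite (ltn_eqF (ltn_ord k)) -muleA.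
  rewrite -ge0_sume_distrr; last first.
    by move=> k _; rewrite mule_ge0 ?(nphi k).2 // avg_ge0.
  rewrite -phiE /b; set M := dyadic_max _ _ _; case: ltP => h /=.
    by rewrite mul0e mul1e add0e.
  by rewrite mul0e mul1e adde0.
Qed.

Lemma maxe_sq (a b : \bar R) : (0 <= a -> 0 <= b ->
  maxe a b * maxe a b <= a * a + b * b)%E.
Proof.
move=> a0 b0; rewrite /Order.max; case: ifP => _.
  by rewrite leeDr // mule_ge0.
by rewrite leeDl // mule_ge0.
Qed.

Lemma dyadic_max_sqS N F (B : R) : nnmeas F ->
  (\int[mu]_x (dyadic_max N F x * dyadic_max N F x) <= B%:E * \int[mu]_x (F x * F x))%E ->
  (\int[mu]_x (dyadic_max N.+1 F x * dyadic_max N.+1 F x) <=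
     B%:E * \int[mu]_x (F x * F x) + \int[mu]_x (F x * F x))%E.
Proof.
move=> nF h; have nM := nnmeas_dyadic_max N nF; have nA := nnmeas_avg (rad_gt0 N) nF.
have nMS := nnmeas_dyadic_max N.+1 nF.
apply: le_trans (leeD h (integral_avg_sq (rad_gt0 N) nF)).
rewrite -nn_integralD; [|exact: nnmeasM|exact: nnmeasM].
apply: nn_le_integral; [exact: nnmeasM|by apply: nnmeasD; exact: nnmeasM|].
by move=> x; apply: maxe_sq; [exact: nM.2|exact: nA.2].
Qed.

Lemma dyadic_max_sq_crude N F : nnmeas F ->
  (\int[mu]_x (dyadic_max N F x * dyadic_max N F x) <= N%:R%:E * \int[mu]_x (F x * F x))%E.
Proof.
move=> nF; elim: N => [|N IH].
  by rewrite mul0e; under eq_integral do rewrite mul0e; rewrite integral0.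
apply: le_trans (dyadic_max_sqS nF IH) _.
rewrite -natr1 EFinD ge0_muleDl ?mul1e // lee_fin.
Qed.

(** With g the maximal function of F and X the square of its norm, linearization gives X = <F, S>,
    where S is the adjoint of the linearized operator applied to g. The square of the norm of S is a
    double sum of compositions of averages, dominated through [avg_avg] by the pairing of g with its
    own maximal function. There the bound B enters with a small coefficient. *)
Lemma dyadic_max_improve N (B : R) : 0 <= B ->
  (forall F, nnmeas F -> (\int[mu]_x (dyadic_max N.+1 F x * dyadic_max N.+1 F x) <=
     B%:E * \int[mu]_x (F x * F x))%E) ->
  forall F, nnmeas F -> (\int[mu]_x (dyadic_max N.+1 F x * dyadic_max N.+1 F x) <=
     (2 ^+ (n + n).+1 + (B + 1) / 2)%:E * \int[mu]_x (F x * F x))%E.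
Proof.
move=> B0 hB F nF.
have L0 : 0 < 2 ^+ (n + n).+1 + (B + 1) / 2.
  by rewrite ltr_pwDl ?exprn_gt0 // divr_ge0 // addr_ge0.
set L := 2 ^+ _ + _ in L0 *.
have nFF := nnmeasM nF nF.
have [Foo|Ffin] := eqVneq (\int[mu]_x (F x * F x))%E +oo%E.
  by rewrite Foo gt0_muley ?lte_fin // leey.
have F20 : (0 <= \int[mu]_x (F x * F x))%E.
  by apply: integral_ge0 => x _; exact: nFF.2.
pose g := dyadic_max N.+1 F.
have ng : nnmeas g by exact: nnmeas_dyadic_max.
have ngg := nnmeasM ng ng.
pose X := (\int[mu]_x (g x * g x))%E.
have X0 : (0 <= X)%E by apply: integral_ge0 => x _; exact: ngg.2.
have Xfin : X \is a fin_num.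
  rewrite ge0_fin_numE //; apply: le_lt_trans (hB F nF) _.
  by apply: lte_mul_pinfty; rewrite ?lee_fin ?lte_fin // ltey.
have [phi [nphi phi1 phiE]] := dyadic_max_linearize N nF.
pose gk k x := (phi k x * g x)%E.
have ngk k : nnmeas (gk k) by exact: nnmeasM.
have sgk x : (\sum_(k < N.+1) gk k x = g x)%E.
  rewrite -ge0_sume_distrl ?phi1 ?mul1e // => k _; exact: (nphi k).2.
pose Sk k := avg (rad k) (gk k).
have nSk k : nnmeas (Sk k) by exact: nnmeas_avg.
pose S x := (\sum_(k < N.+1) Sk k x)%E.
have nS : nnmeas S by exact: nnmeas_sum.
have XE : (X = \int[mu]_x (F x * S x))%E.
  rewrite /X (eq_integral (fun x => \sum_(k < N.+1) (avg (rad k) F x * gk k x))%E); last first.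
    move=> x _; rewrite {1}/g phiE ge0_sume_distrl; last first.
      by move=> k _; rewrite mule_ge0 ?(nphi k).2 // avg_ge0.
    by apply: eq_bigr => k _; rewrite /gk -muleA muleCA.
  rewrite nn_integral_sum; last by move=> k; apply: nnmeasM => //; exact: nnmeas_avg.
  under eq_bigr do rewrite avg_adjoint //.
  rewrite -nn_integral_sum; last by move=> k; exact: (nnmeasM nF (nSk k)).
  apply: eq_integral => x _; rewrite /S ge0_sume_distrr // => k _; exact: (nSk k).2.
(* Of the two averages composed in <S_j, S_k>, the one of larger radius survives, with its radius
   doubled. Symmetrizing in j and k covers both orders. *)
pose T j k := (\int[mu]_x (gk j x * avg (2 * rad k) (gk k) x))%E.
have rad2 k : 0 < 2 * rad k by rewrite mulr_gt0.
have nA2 k : nnmeas (avg (2 * rad k) (gk k)) by exact: nnmeas_avg.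
have T0 j k : (0 <= T j k)%E.
  by apply: integral_ge0 => x _; exact: (nnmeasM (ngk j) (nA2 k)).2.
have hjk j k : (j <= k)%N -> (\int[mu]_x (Sk j x * Sk k x) <= (2 ^+ n)%:E * T j k)%E.
  move=> jk; rewrite avg_adjoint // /T -nn_integralZl ?exprn_ge0 //; last exact: nnmeasM.
  apply: nn_le_integral.
  - by apply: nnmeasM => //; exact: nnmeas_avg.
  - by apply: nnmeasM; [apply: nnmeas_cst; rewrite lee_fin exprn_ge0|exact: nnmeasM].
  move=> x; rewrite muleCA; apply: lee_wpmul2l; first exact: (ngk j).2.
  by apply: avg_avg => //; rewrite /rad ler_wpM2r ?(ltW r0_gt0) // ler_weXn2l // ler1n.
have SS : (\int[mu]_x (S x * S x) <=
    (2 ^+ n)%:E * \sum_(j < N.+1) \sum_(k < N.+1) (T j k + T k j))%E.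
  rewrite (eq_integral (fun x => \sum_(j < N.+1) \sum_(k < N.+1) (Sk j x * Sk k x))%E); last first.
    move=> x _; rewrite {1}/S ge0_sume_distrl; last by move=> k _; exact: (nSk k).2.
    apply: eq_bigr => j _; rewrite ge0_sume_distrr // => k _; exact: (nSk k).2.
  rewrite nn_integral_sum; last by move=> j; apply: nnmeas_sum => k; exact: nnmeasM.
  rewrite ge0_sume_distrr; last first.
    by move=> j _; apply: sume_ge0 => k _; rewrite adde_ge0.
  apply: lee_sum => j _.
  rewrite nn_integral_sum; last by move=> k; exact: nnmeasM.
  rewrite ge0_sume_distrr; last by move=> k _; rewrite adde_ge0.
  apply: lee_sum => k _; rewrite ge0_muleDr //.
  have [jk|/ltnW kj] := leqP j k.
    by apply: le_trans (hjk _ _ jk) _; rewrite leeDl // mule_ge0 // lee_fin exprn_ge0.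
  under eq_integral do rewrite muleC.
  by apply: le_trans (hjk _ _ kj) _; rewrite leeDr // mule_ge0 // lee_fin exprn_ge0.
(* Doubling turns the k-th radius into the next one, so one more radius is needed. This costs an
   extra term, and B becomes B + 1. *)
pose Y := (\int[mu]_x (dyadic_max N.+2 g x * g x))%E.
have TY : (\sum_(j < N.+1) \sum_(k < N.+1) T j k <= Y)%E.
  rewrite exchange_big /=.
  rewrite (eq_bigr (fun k : 'I_N.+1 => \int[mu]_x (avg (2 * rad k) g x * gk k x))%E); last first.
    move=> k _; rewrite avg_adjoint // /T -nn_integral_sum; last by move=> j; exact: nnmeasM.
    apply: eq_integral => x _; rewrite -ge0_sume_distrl ?sgk // => j _; exact: (ngk j).2.
  rewrite -nn_integral_sum; last by move=> k; apply: nnmeasM => //; exact: nnmeas_avg.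
  have nM := nnmeas_dyadic_max N.+2 ng.
  apply: nn_le_integral.
  - by apply: nnmeas_sum => k; apply: nnmeasM => //; exact: nnmeas_avg.
  - exact: nnmeasM.
  move=> x; rewrite -(sgk x) ge0_sume_distrr; last by move=> k _; exact: (ngk k).2.
  apply: lee_sum => k _; apply: lee_wpmul2r; first exact: (ngk k).2.
  by rewrite /rad mulrA -exprS; apply: avg_le_dyadic_max; rewrite !ltnS; exact: (ltn_ord k).
have Yle : (Y <= (2 ^+ n)%:E * X + (((2 ^+ n.+1)^-1 / 2) * (B + 1))%:E * X)%E.
  have nM := nnmeas_dyadic_max N.+2 ng.
  (* The parameter t = 2^(n+1) leaves the coefficient 2^(-n-2) on the square of the maximal function
     of g. The factor 2 * 2^n in front of Y then brings it to exactly 1 / 2. *)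
  have s0 : 0 < 2 ^+ n.+1 :> R by rewrite exprn_gt0.
  have sv0 : 0 <= (2 ^+ n.+1)^-1 / 2 :> R by rewrite divr_ge0 // invr_ge0 ltW.
  apply: (@le_trans _ _ (\int[mu]_x ((2 ^+ n)%:E * (g x * g x) +
     ((2 ^+ n.+1)^-1 / 2)%:E * (dyadic_max N.+2 g x * dyadic_max N.+2 g x)))%E).
    apply: nn_le_integral; first exact: nnmeasM.
      apply: nnmeasD; apply: nnmeasM; try exact: nnmeasM.
      + by apply: nnmeas_cst; rewrite lee_fin exprn_ge0.
      + by apply: nnmeas_cst; rewrite lee_fin.
    move=> x; rewrite muleC.
    have := mule_le_amgm s0 (ng.2 x) (nM.2 x).
    by rewrite exprSr mulfK.
  rewrite nn_integralD; last 2 first.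
  - by apply: nnmeasM; [apply: nnmeas_cst; rewrite lee_fin exprn_ge0|].
  - by apply: nnmeasM; [apply: nnmeas_cst; rewrite lee_fin|exact: nnmeasM].
  rewrite !nn_integralZl ?exprn_ge0 //; last exact: nnmeasM.
  apply: leeD => //; rewrite [X in (_ <= X * _)%E]EFinM -[leRHS]muleA.
  apply: lee_wpmul2l; first by rewrite lee_fin.
  apply: le_trans (dyadic_max_sqS ng (hB g ng)) _.
  by rewrite EFinD ge0_muleDl ?lee_fin // mul1e.
have SS2 : (\int[mu]_x (S x * S x) <= L%:E * X)%E.
  apply: le_trans SS _.
  rewrite (_ : \sum_(j < N.+1) _ = \sum_(j < N.+1) \sum_(k < N.+1) T j k +
     \sum_(j < N.+1) \sum_(k < N.+1) T j k)%E; last first.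
    rewrite [X in (_ = _ + X)%E]exchange_big -big_split.
    by apply: eq_bigr => j _; rewrite -big_split.
  apply: (@le_trans _ _ ((2 ^+ n)%:E * (Y + Y))%E).
    by apply: lee_wpmul2l; [rewrite lee_fin exprn_ge0|exact: leeD].
  apply: (le_trans (lee_wpmul2l _ (leeD Yle Yle))); first by rewrite lee_fin exprn_ge0.
  rewrite -(fineK Xfin) -!EFinM lee_fin /L le_eqVlt.
  apply/orP; left; apply/eqP; rewrite !exprS exprD.
  by field; rewrite expf_neq0.
(* With t = L the term in S contributes (1 / (2L)) L X = X / 2, which is absorbed on the left
   because X is finite. *)
have main : (X <= (L / 2)%:E * \int[mu]_x (F x * F x) + (1 / 2)%:E * X)%E.
  rewrite {1}XE; have Lv0 : 0 <= L^-1 / 2 by rewrite divr_ge0 // invr_ge0 ltW.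
  have L20 : 0 <= L / 2 by rewrite divr_ge0 // ltW.
  apply: (@le_trans _ _ (\int[mu]_x ((L / 2)%:E * (F x * F x) +
     (L^-1 / 2)%:E * (S x * S x)))%E).
    apply: nn_le_integral; first exact: nnmeasM.
      apply: nnmeasD; apply: nnmeasM; try exact: nnmeasM; exact: nnmeas_cst.
    by move=> x; apply: mule_le_amgm => //; [exact: nF.2|exact: nS.2].
  rewrite nn_integralD; last 2 first.
  - by apply: nnmeasM => //; exact: nnmeas_cst.
  - by apply: nnmeasM; [exact: nnmeas_cst|exact: nnmeasM].
  rewrite !nn_integralZl //; last exact: nnmeasM.
  apply: leeD => //; apply: le_trans (lee_wpmul2l _ SS2) _; first by rewrite lee_fin.
  rewrite muleA -EFinM (_ : L^-1 / 2 * L = 1 / 2) //.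
  by field; rewrite gt_eqF.
rewrite -/X; move: main; rewrite -(fineK Xfin).
have Ffn : (\int[mu]_x (F x * F x))%E \is a fin_num by rewrite ge0_fin_numE // ltey.
rewrite -(fineK Ffn) -!EFinM -EFinD !lee_fin; lra.
Qed.

(** The improvement maps B to C0 + B / 2 with C0 = 2^(2n+1) + 1/2, whose fixed point is 2 C0. One
    more unit covers what is left after finitely many iterations. *)
Definition maximal_const : R := 2 ^+ (n + n).+2 + 2.

Lemma dyadic_max_sq N F : nnmeas F ->
  (\int[mu]_x (dyadic_max N F x * dyadic_max N F x) <=
     maximal_const%:E * \int[mu]_x (F x * F x))%E.
Proof.
move=> nF; have F20 G : nnmeas G -> (0 <= \int[mu]_x (G x * G x))%E.
  by move=> nG; apply: integral_ge0 => x _; exact: (nnmeasM nG nG).2.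
case: N => [|N].
  rewrite /=; under eq_integral do rewrite mul0e.
  by rewrite integral0 mule_ge0 ?F20 // lee_fin addr_ge0 // exprn_ge0.
pose C0 : R := 2 ^+ (n + n).+1 + 1 / 2.
have C00 : 0 <= C0 by rewrite addr_ge0 ?exprn_ge0.
(* Iterate from the crude constant N + 1, halving the excess over 2 C0 each time. After N + 1
   iterations it is at most 1, whatever N. *)
have H m : forall G, nnmeas G ->
   (\int[mu]_x (dyadic_max N.+1 G x * dyadic_max N.+1 G x) <=
     (2 * C0 + 2^-1 ^+ m * N.+1%:R)%:E * \int[mu]_x (G x * G x))%E.
  elim: m => [|m IH] G nG.
    apply: le_trans (dyadic_max_sq_crude N.+1 nG) _; apply: lee_wpmul2r; first exact: F20.
    by rewrite lee_fin expr0 mul1r lerDr mulr_ge0.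
  have := dyadic_max_improve _ IH nG; rewrite addr_ge0 ?mulr_ge0 ?exprn_ge0 ?invr_ge0 //.
  move=> /(_ isT); rewrite (_ : 2 ^+ _ + _ = 2 * C0 + 2^-1 ^+ m.+1 * N.+1%:R) //.
  by rewrite [2^-1 ^+ m.+1]exprS /C0; field.
apply: le_trans (H N.+1 F nF) _; apply: lee_wpmul2r; first exact: F20.
rewrite lee_fin (_ : maximal_const = 2 * C0 + 1); last first.
  by rewrite /maximal_const /C0 [2 ^+ (n + n).+2]exprS; field.
rewrite lerD2l exprVn mulrC ler_pdivrMr ?exprn_gt0 // mul1r -natrX ler_nat.
exact/ltnW/ltn_expl.
Qed.

End MaximalL2.

(** * Complex-valued integration *)

Notation nc := Normc.normc.

Section ComplexNorm.
Context {R : realType}.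
Implicit Types (z w : R[i]) (t : R).

Lemma complex_eq z w : complex.Re z = complex.Re w -> complex.Im z = complex.Im w -> z = w.
Proof. by case: z w => [a b] [c e] /= -> ->. Qed.

Lemma Re_mul z w : complex.Re (z * w) =
  complex.Re z * complex.Re w - complex.Im z * complex.Im w.
Proof. by case: z w => [a b] [c e]. Qed.

Lemma Im_mul z w : complex.Im (z * w) =
  complex.Re z * complex.Im w + complex.Im z * complex.Re w.
Proof. by case: z w => [a b] [c e]. Qed.

Lemma Re_add z w : complex.Re (z + w) = complex.Re z + complex.Re w.
Proof. by case: z w => [a b] [c e]. Qed.

Lemma Im_add z w : complex.Im (z + w) = complex.Im z + complex.Im w.
Proof. by case: z w => [a b] [c e]. Qed.

Lemma Re_opp z : complex.Re (- z) = - complex.Re z.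
Proof. by case: z. Qed.

Lemma Im_opp z : complex.Im (- z) = - complex.Im z.
Proof. by case: z. Qed.

Lemma normc_sqrtE z : nc z = Num.sqrt (complex.Re z ^+ 2 + complex.Im z ^+ 2).
Proof. by case: z. Qed.

Lemma normc_ge0 z : 0 <= nc z.
Proof. by rewrite normc_sqrtE sqrtr_ge0. Qed.

Lemma normc_sqr z : nc z ^+ 2 = complex.Re z ^+ 2 + complex.Im z ^+ 2.
Proof. by rewrite normc_sqrtE sqr_sqrtr // addr_ge0 ?sqr_ge0. Qed.

Lemma normcM z w : nc (z * w) = nc z * nc w.
Proof. exact: Normc.normcM. Qed.

Lemma normcD z w : nc (z + w) <= nc z + nc w.
Proof. exact: le_normcD. Qed.

Lemma normcN z : nc (- z) = nc z.
Proof. by rewrite !normc_sqrtE Re_opp Im_opp !sqrrN. Qed.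

Lemma normcB_sym z w : nc (z - w) = nc (w - z).
Proof. by rewrite -normcN opprB. Qed.

Lemma normc_dist z w y : nc (z - w) <= nc (z - y) + nc (y - w).
Proof. by rewrite (le_trans _ (normcD _ _)) // addrA subrK. Qed.

Lemma normc0 : nc (0 : R[i]) = 0.
Proof. by rewrite normc_sqrtE /= expr0n addr0 sqrtr0. Qed.

Lemma normc0_eq0 z : nc z = 0 -> z = 0.
Proof. exact: Normc.eq0_normc. Qed.

Lemma normcR t : nc (t%:C) = `|t|.
Proof. by rewrite normc_sqrtE /= expr0n addr0 sqrtr_sqr. Qed.

Lemma Re_le_normc z : `|complex.Re z| <= nc z.
Proof.
rewrite -(@ler_pXn2r _ 2) ?nnegrE ?normc_ge0 // normc_sqr real_normK ?num_real //.
by rewrite lerDl sqr_ge0.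
Qed.

Lemma Im_le_normc z : `|complex.Im z| <= nc z.
Proof.
rewrite -(@ler_pXn2r _ 2) ?nnegrE ?normc_ge0 // normc_sqr real_normK ?num_real //.
by rewrite lerDr sqr_ge0.
Qed.

Lemma normc_le z : nc z <= `|complex.Re z| + `|complex.Im z|.
Proof.
rewrite -(@ler_pXn2r _ 2) ?nnegrE ?normc_ge0 ?addr_ge0 // normc_sqr sqrrD.
rewrite !real_normK ?num_real // -addrA lerD2l lerDr mulrn_wge0 // mulr_ge0 //.
Qed.

Lemma normc_expi t : nc (expi t) = 1.
Proof. by rewrite normc_sqrtE /= cos2Dsin2 sqrtr1. Qed.

Lemma expi0 : expi 0 = 1 :> R[i].
Proof. by rewrite /expi cos0 sin0. Qed.

Lemma expiD s t : expi (s + t) = expi s * expi t :> R[i].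
Proof.
apply: complex_eq; rewrite ?Re_mul ?Im_mul /=; first by rewrite cosD.
by rewrite sinD; ring.
Qed.

Lemma unimodular_rotation z : exists2 w, nc w = 1 & complex.Re (w * z) = nc z.
Proof.
have [->|z0] := eqVneq z 0.
  by exists 1; rewrite ?mulr0 ?normc0 // -expi0 normc_expi.
have nz0 : nc z != 0 by apply: contra_neq z0; exact: normc0_eq0.
exists ((complex.Re z / nc z) +i* (- complex.Im z / nc z)).
  apply/eqP; rewrite -(@eqrXn2 _ 2) ?normc_ge0 // expr1n normc_sqr /=.
  by rewrite !expr_div_n sqrrN -mulrDl -normc_sqr mulfV // expf_neq0.
rewrite Re_mul /= !mulNr opprK ![_ / nc z * _]mulrAC -mulrDl -!expr2 -normc_sqr.
by rewrite expr2 mulfK.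
Qed.

End ComplexNorm.

Section Cmeas.
Context {d} {T : measurableType d} {R : realType}.
Implicit Types f g : T -> R[i].

Lemma Cmeas_cst (z : R[i]) : Cmeasurable (fun _ : T => z).
Proof. by split; exact: measurable_cst. Qed.

Lemma CmeasD f g : Cmeasurable f -> Cmeasurable g -> Cmeasurable (fun x => f x + g x).
Proof.
move=> [fr fi] [gr gi]; split.
  by under eq_fun do rewrite Re_add; exact: measurable_funD.
by under eq_fun do rewrite Im_add; exact: measurable_funD.
Qed.

Lemma CmeasN f : Cmeasurable f -> Cmeasurable (fun x => - f x).
Proof.
move=> [fr fi]; split.
  by under eq_fun do rewrite Re_opp; exact: measurableT_comp.
by under eq_fun do rewrite Im_opp; exact: measurableT_comp.
Qed.

Lemma CmeasB f g : Cmeasurable f -> Cmeasurable g -> Cmeasurable (fun x => f x - g x).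
Proof. by move=> mf mg; apply: CmeasD => //; exact: CmeasN. Qed.

Lemma CmeasM f g : Cmeasurable f -> Cmeasurable g -> Cmeasurable (fun x => f x * g x).
Proof.
move=> [fr fi] [gr gi]; split.
  by under eq_fun do rewrite Re_mul; apply: measurable_funB; exact: measurable_funM.
by under eq_fun do rewrite Im_mul; apply: measurable_funD; exact: measurable_funM.
Qed.

Lemma CmeasR (u : T -> R) : measurable_fun setT u -> Cmeasurable (fun x => (u x)%:C).
Proof. by move=> mu; split => //; exact: measurable_cst. Qed.

Lemma Cmeas_expi (u : T -> R) : measurable_fun setT u -> Cmeasurable (fun x => expi (u x)).
Proof.
move=> mu; split.
  by apply: (measurableT_comp (f := @cos R)) => //; apply: continuous_measurable_fun; exact: continuous_cos.
by apply: (measurableT_comp (f := @sin R)) => //; apply: continuous_measurable_fun; exact: continuous_sin.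
Qed.

Lemma Cmeas_comp d' (T' : measurableType d') f (h : T' -> T) :
  Cmeasurable f -> measurable_fun setT h -> Cmeasurable (fun x => f (h x)).
Proof.
by move=> [fr fi] mh; split; [exact: (measurableT_comp fr)|exact: (measurableT_comp fi)].
Qed.

Lemma measurable_normc f : Cmeasurable f -> measurable_fun setT (fun x => nc (f x)).
Proof.
move=> [fr fi]; under eq_fun do rewrite normc_sqrtE.
apply: (measurableT_comp (f := @Num.sqrt R)).
  by apply: continuous_measurable_fun; exact: sqrt_continuous.
by apply: measurable_funD; exact: measurable_funX.
Qed.

Lemma nnmeas_normc f : Cmeasurable f -> nnmeas (fun x => (nc (f x))%:E).
Proof.
by move=> mf; apply: nnmeas_EFin; [exact: measurable_normc|move=> x; exact: normc_ge0].
Qed.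

End Cmeas.

Section Cint.
Context {d} {T : measurableType d} {R : realType}.
Variable mu : {measure set T -> \bar R}.
Implicit Types f g : T -> R[i].

Lemma CintegrableP f : Cintegrable mu f <->
  Cmeasurable f /\ (\int[mu]_x (nc (f x))%:E < +oo)%E.
Proof.
split=> [[ir ii]|[mf foo]].
  have mf : Cmeasurable f.
    by split; apply/measurable_EFinP; [case/integrableP : ir|case/integrableP : ii].
  split => //; have [nr ni] := (integrable_abse ir, integrable_abse ii).
  apply: (@le_lt_trans _ _ (\int[mu]_x (`|(complex.Re (f x))%:E| + `|(complex.Im (f x))%:E|))%E).
    apply: ge0_le_integral => //.
    - by move=> x _; rewrite lee_fin normc_ge0.
    - exact: (nnmeas_normc mf).1.
    - by apply: emeasurable_funD; [case/integrableP : nr|case/integrableP : ni].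
    - by move=> x _; rewrite -EFinD lee_fin normc_le.
  have /integrableP[_] := integrableD measurableT nr ni.
  apply: le_lt_trans; rewrite le_eqVlt; apply/orP; left; apply/eqP.
  by apply: eq_integral => x _; rewrite [RHS]gee0_abs //; apply: adde_ge0; exact: abse_ge0.
have key (u : T -> R) : measurable_fun setT u -> (forall x, `|u x| <= nc (f x)) ->
    mu.-integrable setT (fun x => (u x)%:E).
  move=> mu' uf; apply/integrableP; split; first exact/measurable_EFinP.
  apply: le_lt_trans foo; apply: ge0_le_integral => //.
  - by apply: measurableT_comp => //; exact/measurable_EFinP.
  - exact: (nnmeas_normc mf).1.
  - by move=> x _; rewrite lee_fin.
have [mfr mfi] := mf; split; apply: key => // x; first exact: Re_le_normc.
exact: Im_le_normc.
Qed.

Lemma Cintegrable_meas f : Cintegrable mu f -> Cmeasurable f.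
Proof. by move/CintegrableP => []. Qed.

Lemma Cintegrable_lty f : Cintegrable mu f -> (\int[mu]_x (nc (f x))%:E < +oo)%E.
Proof. by move/CintegrableP => []. Qed.

Lemma Cintegrable_dom f (G : T -> \bar R) : Cmeasurable f -> nnmeas G ->
  (forall x, (nc (f x))%:E <= G x)%E -> (\int[mu]_x G x < +oo)%E -> Cintegrable mu f.
Proof.
move=> mf nG fG Goo; apply/CintegrableP; split => //; apply: le_lt_trans Goo.
by apply: nn_le_integral => //; exact: nnmeas_normc.
Qed.

Lemma CintegrableD f g : Cintegrable mu f -> Cintegrable mu g ->
  Cintegrable mu (fun x => f x + g x).
Proof.
move=> [fr fi] [gr gi]; split.
  by under eq_fun do rewrite Re_add EFinD; exact: integrableD.
by under eq_fun do rewrite Im_add EFinD; exact: integrableD.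
Qed.

Lemma CintegrableN f : Cintegrable mu f -> Cintegrable mu (fun x => - f x).
Proof.
move=> [fr fi]; split.
  by under eq_fun do rewrite Re_opp EFinN; exact: integrableN.
by under eq_fun do rewrite Im_opp EFinN; exact: integrableN.
Qed.

Lemma CintegrableB f g : Cintegrable mu f -> Cintegrable mu g ->
  Cintegrable mu (fun x => f x - g x).
Proof. by move=> mf mg; apply: CintegrableD => //; exact: CintegrableN. Qed.

Lemma CintegrableZ (z : R[i]) f : Cintegrable mu f -> Cintegrable mu (fun x => z * f x).
Proof.
move=> [fr fi]; split.
  under eq_fun do rewrite Re_mul EFinB !EFinM.
  by apply: integrableB => //; exact: integrableZl.
under eq_fun do rewrite Im_mul EFinD !EFinM.
by apply: integrableD => //; exact: integrableZl.
Qed.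

Lemma integrableZl_EFin (a : R) (u : T -> R) : mu.-integrable setT (fun x => (u x)%:E) ->
  mu.-integrable setT (fun x => (a * u x)%:E).
Proof. by move=> iu; under eq_fun do rewrite EFinM; exact: integrableZl. Qed.

Lemma CintegralD f g : Cintegrable mu f -> Cintegrable mu g ->
  Cintegral mu (fun x => f x + g x) = Cintegral mu f + Cintegral mu g.
Proof.
move=> [fr fi] [gr gi]; apply: complex_eq; rewrite ?Re_add ?Im_add /=.
  by under eq_Rintegral do rewrite Re_add; rewrite RintegralD.
by under eq_Rintegral do rewrite Im_add; rewrite RintegralD.
Qed.

Lemma CintegralZ (z : R[i]) f : Cintegrable mu f ->
  Cintegral mu (fun x => z * f x) = z * Cintegral mu f.
Proof.
move=> [fr fi]; apply: complex_eq; rewrite ?Re_mul ?Im_mul /=.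
  under eq_Rintegral do rewrite Re_mul.
  rewrite RintegralB //; last 2 first.
  - exact: integrableZl_EFin.
  - exact: integrableZl_EFin.
  by rewrite !RintegralZl.
under eq_Rintegral do rewrite Im_mul.
rewrite RintegralD //; last 2 first.
- exact: integrableZl_EFin.
- exact: integrableZl_EFin.
by rewrite !RintegralZl.
Qed.

Lemma CintegralN f : Cintegrable mu f -> Cintegral mu (fun x => - f x) = - Cintegral mu f.
Proof.
move=> intf; rewrite -mulN1r -CintegralZ //; congr Cintegral.
by apply/funext => x; rewrite mulN1r.
Qed.

Lemma CintegralB f g : Cintegrable mu f -> Cintegrable mu g ->
  Cintegral mu (fun x => f x - g x) = Cintegral mu f - Cintegral mu g.
Proof. by move=> fi gi; rewrite CintegralD ?CintegralN //; exact: CintegrableN. Qed.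

(* Rotate the integral onto the positive real axis. *)
Lemma normc_Cintegral_le f : Cintegrable mu f ->
  ((nc (Cintegral mu f))%:E <= \int[mu]_x (nc (f x))%:E)%E.
Proof.
move=> intf; have [w nw wI] := unimodular_rotation (Cintegral mu f).
have [wr _] := CintegrableZ w intf.
have [mwf _] := (CintegrableP _).1 (CintegrableZ w intf).
rewrite -wI -CintegralZ //= /Rintegral fineK; last exact: integrable_fin_num.
have [mf _] := (CintegrableP _).1 intf.
have -> : (\int[mu]_x (nc (f x))%:E = \int[mu]_x (nc (w * f x))%:E)%E.
  by apply: eq_integral => x _; rewrite normcM nw mul1r.
apply: (@le_trans _ _ (\int[mu]_x `|(complex.Re (w * f x))%:E|)%E).
  by apply: le_trans (lee_abs _) (le_abse_integral _ _ _) => //; case/integrableP : wr.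
apply: ge0_le_integral => //.
- by apply: measurableT_comp => //; case/integrableP : wr.
- exact: (nnmeas_normc mwf).1.
- by move=> x _; rewrite lee_fin Re_le_normc.
Qed.

Lemma eq_Cintegral f g : (forall x, f x = g x) -> Cintegral mu f = Cintegral mu g.
Proof. by move=> fg; congr Cintegral; apply/funext. Qed.

Lemma eq_Cintegrable f g : (forall x, f x = g x) -> Cintegrable mu f -> Cintegrable mu g.
Proof. by move=> /funext ->. Qed.

End Cint.

(** * From dyadic radii to all radii *)

Section HardyLittlewood.
Context {R : realType} {n : nat}.
Local Notation mu := (lebesgueRn R n).
Local Notation V := 'rV[R]_n.
Implicit Types (x y z : V) (r s : R) (F G : V -> \bar R).

Let dm F K : V -> \bar R := dyadic_max (2^-1 ^+ K) (K + K).+1 F.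
Let dr_gt0 K : 0 < 2^-1 ^+ K :> R. Proof. by rewrite exprn_gt0. Qed.

(** A measurable majorant of the maximal function: the radii run over 2^(-K), ..., 2^K with K
    tending to infinity, and 2^n pays for enlarging an arbitrary radius to the next dyadic one. *)
Definition hl_max F x : \bar R :=
  (2 ^+ n)%:E * limn (fun K => dyadic_max (2^-1 ^+ K) (K + K).+1 F x).

Let nn_dm F K : nnmeas F -> nnmeas (dm F K).
Proof. by move=> nF; exact: nnmeas_dyadic_max. Qed.

Lemma dyadic_max_le r0 N F x (M : \bar R) : (0 <= M)%E ->
  (forall k, (k < N)%N -> (avg (2 ^+ k * r0) F x <= M)%E) -> (dyadic_max r0 N F x <= M)%E.
Proof.
move=> M0; elim: N => //= N IH h; rewrite ge_max IH; last by move=> k kN; apply: h; exact: ltnW.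
by rewrite h.
Qed.

Let dm_nd F x : nnmeas F -> nondecreasing_seq (fun K => dm F K x).
Proof.
move=> nF; apply/nondecreasing_seqP => K; apply: dyadic_max_le.
  exact: (nn_dm K.+1 nF).2.
move=> k kK; have -> : 2 ^+ k * 2^-1 ^+ K = 2 ^+ k.+1 * 2^-1 ^+ K.+1 :> R.
  by rewrite [2 ^+ k.+1]exprS [2^-1 ^+ K.+1]exprS; field.
apply: avg_le_dyadic_max; rewrite addnS addSn ltnS; exact: (leq_trans kK).
Qed.

Let dm_cvg F x : nnmeas F -> (dm F ^~ x) K @[K --> \oo] --> limn (dm F ^~ x).
Proof. by move=> nF; apply: ereal_nondecreasing_is_cvgn; exact: dm_nd. Qed.

Lemma nnmeas_hl_max F : nnmeas F -> nnmeas (hl_max F).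
Proof.
move=> nF; apply: nnmeasM; first by apply: nnmeas_cst; rewrite lee_fin exprn_ge0.
split.
  apply: (emeasurable_fun_cvg (dm F)) => [K|x _]; first exact: (nn_dm K nF).1.
  exact: dm_cvg.
move=> x; apply: lime_ge; first exact: dm_cvg.
by apply: nearW => K; exact: (nn_dm K nF).2.
Qed.

Lemma integral_hl_max_sq F : nnmeas F ->
  (\int[mu]_x (hl_max F x * hl_max F x) <=
    (2 ^+ n * 2 ^+ n * @maximal_const R n)%:E * \int[mu]_x (F x * F x))%E.
Proof.
move=> nF; have nFF := nnmeasM nF nF.
have nL : nnmeas (fun x => limn (fun K => dm F K x)).
  split.
    apply: (emeasurable_fun_cvg (dm F)) => [K|x _]; first exact: (nn_dm K nF).1.
    exact: dm_cvg.
  move=> x; apply: lime_ge; first exact: dm_cvg.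
  by apply: nearW => K; exact: (nn_dm K nF).2.
pose L x := limn (fun K => dm F K x).
rewrite (eq_integral (fun x => (2 ^+ n * 2 ^+ n)%:E * (L x * L x))%E); last first.
  by move=> x _; rewrite /hl_max muleACA -EFinM.
rewrite nn_integralZl; [|exact: nnmeasM|by rewrite mulr_ge0 // exprn_ge0].
rewrite [X in (_ <= X * _)%E]EFinM -[leRHS]muleA.
apply: lee_wpmul2l; first by rewrite lee_fin mulr_ge0 // exprn_ge0.
have cv x : (dm F K x * dm F K x)%E @[K --> \oo] --> (L x * L x)%E.
  apply: cvgeM; [|exact: dm_cvg|exact: dm_cvg].
  by case: (L x) => [l| |]; [exact: mule_def_fin|exact: mule_def_infty_neq0|
    exact: mule_def_infty_neq0].
have nd2 x : nondecreasing_seq (fun K => dm F K x * dm F K x)%E.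
  by move=> K K' KK'; apply: lee_pmul; rewrite ?(nn_dm _ nF).2 //; exact: dm_nd.
rewrite (eq_integral (fun x => limn (fun K => (dm F K x * dm F K x)%E))); last first.
  by move=> x _; apply/esym/cvg_lim => //; exact: cv.
rewrite monotone_convergence //.
- apply: lime_le; last by apply: nearW => K; exact: dyadic_max_sq.
  apply: ereal_nondecreasing_is_cvgn => K K' KK'.
  apply: nn_le_integral => [||x]; last exact: nd2.
    exact: (nnmeasM (nn_dm K nF) (nn_dm K nF)).
  exact: (nnmeasM (nn_dm K' nF) (nn_dm K' nF)).
- by move=> K; exact: (nnmeasM (nn_dm K nF) (nn_dm K nF)).1.
- by move=> K x _; exact: (nnmeasM (nn_dm K nF) (nn_dm K nF)).2.
Qed.

Lemma avg_le_double r s F x : 0 < r -> r <= s -> s <= 2 * r -> nnmeas F ->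
  (avg r F x <= (2 ^+ n)%:E * avg s F x)%E.
Proof.
move=> r0 rs sr nF; have s0 : 0 < s by exact: lt_le_trans rs.
have nk u : 0 < u -> nnmeas (fun y => (ball_kernel u x y)%:E).
  by move=> u0; apply: nnmeas_ball_kernel.
have nsF : nnmeas (fun y => ((ball_kernel s x y)%:E * F y)%E).
  by apply: nnmeasM => //; exact: nk.
rewrite /avg -nn_integralZl ?exprn_ge0 //; apply: nn_le_integral.
- by apply: nnmeasM => //; exact: nk.
- by apply: nnmeasM => //; apply: nnmeas_cst; rewrite lee_fin exprn_ge0.
move=> y; rewrite muleA; apply: lee_wpmul2r; first exact: nF.2.
rewrite -EFinM lee_fin /ball_kernel mulrA.
have [yr|_] := ltP (enorm (y - x)) r; last first.
  by rewrite mulr0 !mulr_ge0 ?exprn_ge0 // invr_ge0 mulr_ge0 ?exprn_ge0 ?ltW // unit_ball_vol_gt0.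
rewrite (lt_le_trans yr rs) !mulr1.
have v0 := @unit_ball_vol_gt0 R n.
have -> : (r ^+ n * @unit_ball_vol R n)^-1 = 2 ^+ n * ((2 * r) ^+ n * @unit_ball_vol R n)^-1.
  by rewrite exprMn; field; rewrite !expf_neq0 ?gt_eqF.
apply: ler_wpM2l; first by rewrite exprn_ge0.
rewrite lef_pV2 ?posrE ?mulr_gt0 ?exprn_gt0 ?mulr_gt0 //.
by rewrite ler_wpM2r ?(ltW v0) // lerXn2r ?nnegrE ?mulr_ge0 ?(ltW r0) ?(ltW s0).
Qed.

Lemma avg_le_hl_max r F x : 0 < r -> nnmeas F -> (avg r F x <= hl_max F x)%E.
Proof.
move=> r0 nF.
have [K rK] : exists K, 2^-1 ^+ K <= r <= 2 ^+ K.
  exists (Num.bound r + Num.bound r^-1)%N.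
  have b1 (t : R) : 0 < t -> t <= 2 ^+ (Num.bound t).
    move=> t0; apply: (le_trans (ltW (archi_boundP (ltW t0)))).
    by rewrite -natrX ler_nat; exact/ltnW/ltn_expl.
  have ge1 m : 1 <= 2 ^+ m :> R by rewrite exprn_ege1 // ler1n.
  apply/andP; split; last first.
    by rewrite exprD (le_trans (b1 r r0)) // ler_peMr // exprn_ge0.
  rewrite exprVn -[leRHS]invrK lef_pV2 ?posrE ?exprn_gt0 ?invr_gt0 //.
  by rewrite exprD (le_trans (b1 r^-1 _)) ?invr_gt0 // ler_peMl // exprn_ge0.
(* The bound r <= 2^K gives existence. Minimality, or 2^(-K) <= r when j = 0, makes this dyadic
   radius at most 2r. *)
have [j jr jmin] : exists2 j, r <= 2 ^+ j * 2^-1 ^+ K &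
    forall i, r <= 2 ^+ i * 2^-1 ^+ K -> (j <= i)%N.
  have ex : exists j, r <= 2 ^+ j * 2^-1 ^+ K.
    exists (K + K)%N; rewrite exprD -mulrA -exprMn mulfV // expr1n mulr1.
    by case/andP : rK.
  by case: (ex_minnP ex) => j jr jmin; exists j.
have jK : (j < (K + K).+1)%N.
  rewrite ltnS; apply: jmin; rewrite exprD -mulrA -exprMn mulfV // expr1n mulr1.
  by case/andP : rK.
have j2 : 2 ^+ j * 2^-1 ^+ K <= 2 * r.
  case: j {jK} jr jmin => [|j] jr jmin.
    rewrite expr0 mul1r; case/andP : rK => h _; apply: le_trans h _.
    by rewrite ler_peMl ?(ltW r0) // ler1n.
  rewrite exprS -mulrA ler_wpM2l // leNgt; apply/negP => /ltW /jmin.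
  by rewrite ltnn.
apply: le_trans (avg_le_double x r0 jr j2 nF) _.
apply: lee_wpmul2l; first by rewrite lee_fin exprn_ge0.
apply: le_trans (avg_le_dyadic_max (2^-1 ^+ K) F x jK) _.
have -> : limn (fun K => dyadic_max (2^-1 ^+ K) (K + K).+1 F x) = ereal_sup (range (fun K => dm F K x)).
  by apply/cvg_lim => //; apply: ereal_nondecreasing_cvgn; exact: dm_nd.
by apply: ereal_sup_ubound; exists K.
Qed.

Lemma maximal_le_hl_max (f : V -> R[i]) x : Cmeasurable f ->
  (maximal f x <= hl_max (fun y => (Normc.normc (f y))%:E) x)%E.
Proof.
move=> mf; have nf := nnmeas_normc mf.
apply: ge_ereal_sup => _ [r r0 <-].
have {}r0 : 0 < r by move: r0; rewrite /= in_itv /= andbT.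
by rewrite avg_maximalE //; exact: avg_le_hl_max.
Qed.

End HardyLittlewood.

(** * Fubini, dominated convergence, Hoelder and affine changes of variables for complex
    integrals *)

Section CFubini.
Context {d1 d2} {T1 : measurableType d1} {T2 : measurableType d2} {R : realType}.
Variables (m1 : {sigma_finite_measure set T1 -> \bar R})
          (m2 : {sigma_finite_measure set T2 -> \bar R}).

Lemma measurable_Rintegral (f : T1 * T2 -> R) : measurable_fun setT f ->
  measurable_fun setT (fun x => \int[m2]_y f (x, y)).
Proof.
move=> mf; apply: (measurableT_comp (f := fine)); first exact: fine_measurable.
have mfE : measurable_fun setT (EFin \o f) by exact/measurable_EFinP.
under eq_fun do rewrite integralE.
have P0 x : (0 <= (EFin \o f)^\+ x)%E by exact: funepos_ge0.
have N0 x : (0 <= (EFin \o f)^\- x)%E by exact: funeneg_ge0.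
apply: emeasurable_funB.
  rewrite [X in measurable_fun _ X](_ : _ = fubini_F m2 (EFin \o f)^\+%E).
    exact: (measurable_fun_fubini_tonelli_F (m2 := m2) _ (measurable_funepos mfE) P0).
  by apply/funext => x; apply: eq_integral => y _; rewrite !funeposE.
rewrite [X in measurable_fun _ X](_ : _ = fubini_F m2 (EFin \o f)^\-%E).
  exact: (measurable_fun_fubini_tonelli_F (m2 := m2) _ (measurable_funeneg mfE) N0).
by apply/funext => x; apply: eq_integral => y _; rewrite !funenegE.
Qed.

Lemma Cmeas_Cintegral (F : T1 -> T2 -> R[i]) :
  Cmeasurable (fun z : T1 * T2 => F z.1 z.2) ->
  Cmeasurable (fun x => Cintegral m2 (F x)).
Proof.
move=> [mr mi]; split => /=.
  exact: (measurable_Rintegral mr).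
exact: (measurable_Rintegral mi).
Qed.

Lemma Rintegral_fubini (f : T1 * T2 -> R) :
  (m1 \x m2)%E.-integrable setT (EFin \o f) ->
  \int[m1]_x (\int[m2]_y f (x, y)) = \int[m2]_y (\int[m1]_x f (x, y)).
Proof.
move=> fi; have mf : measurable_fun setT f by case/integrableP : fi => /measurable_EFinP.
rewrite {1 3}/Rintegral; congr fine.
have mF := measurable_fubini_F fi; have mG := measurable_fubini_G fi.
transitivity (\int[m1]_x \int[m2]_y (f (x, y))%:E)%E; last first.
  rewrite [LHS](Fubini fi); apply: ae_eq_integral => //.
    by apply/measurable_EFinP; apply: (measurableT_comp (f := fine)); first exact: fine_measurable.
  have := ae_integrable2 fi; apply: filterS => y yf _.
  by rewrite /Rintegral fineK //; exact: integrable_fin_num yf.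
apply: ae_eq_integral => //; first by apply/measurable_EFinP; exact: measurable_Rintegral.
have := ae_integrable1 fi; apply: filterS => x xf _.
by rewrite /Rintegral fineK //; exact: integrable_fin_num xf.
Qed.

Lemma Cintegral_fubini (F : T1 -> T2 -> R[i]) :
  Cmeasurable (fun z : T1 * T2 => F z.1 z.2) ->
  (\int[m1]_x \int[m2]_y (nc (F x y))%:E < +oo)%E ->
  Cintegral m1 (fun x => Cintegral m2 (F x)) =
  Cintegral m2 (fun y => Cintegral m1 (F ^~ y)).
Proof.
move=> mF Foo.
have [ir ii] : Cintegrable (m1 \x m2)%E (fun z => F z.1 z.2).
  apply/CintegrableP; split => //; rewrite fubini_tonelli1 //.
    exact: (nnmeas_normc mF).1.
  exact: (nnmeas_normc mF).2.
apply: complex_eq => /=; first exact: (Rintegral_fubini ir).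
exact: (Rintegral_fubini ii).
Qed.

End CFubini.

Section Dominated.
Context {d} {T : measurableType d} {R : realType}.
Variable mu : {measure set T -> \bar R}.

Lemma nn_dominated0 (u : nat -> T -> R) (G : T -> R) :
  (forall k, measurable_fun setT (u k)) -> (forall k x, 0 <= u k x) ->
  (forall x, u ^~ x @ \oo --> 0) ->
  measurable_fun setT G -> (forall k x, u k x <= G x) ->
  (\int[mu]_x (G x)%:E < +oo)%E ->
  (fun k => \int[mu]_x (u k x)%:E)%E @ \oo --> 0%E.
Proof.
move=> mu' u0 uc mG uG Goo.
have G0 x : 0 <= G x by exact: le_trans (u0 0%N x) (uG 0%N x).
have [] := @dominated_convergence _ T R mu setT measurableT (fun k x => (u k x)%:E)
  (fun=> 0%E) (fun x => (G x)%:E).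
- by move=> k; exact/measurable_EFinP.
- exact: measurable_cst.
- by apply: aeW => x _; apply/fine_cvgP; split; [exact: nearW|exact: uc].
- apply/integrableP; split; first exact/measurable_EFinP.
  by under eq_integral do rewrite gee0_abs ?lee_fin //.
- by apply: aeW => x k _; rewrite gee0_abs ?lee_fin.
by move=> _ _; rewrite integral0.
Qed.

Lemma Cintegral_dominated (f_ : nat -> T -> R[i]) (f : T -> R[i]) (G : T -> R) :
  (forall k, Cmeasurable (f_ k)) -> Cmeasurable f ->
  (forall x, (fun k => nc (f_ k x - f x)) @ \oo --> 0) ->
  measurable_fun setT G -> (forall k x, nc (f_ k x) <= G x) ->
  (\int[mu]_x (G x)%:E < +oo)%E ->
  (fun k => nc (Cintegral mu (f_ k) - Cintegral mu f)) @ \oo --> 0.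
Proof.
move=> mf_ mf cf mG fG Goo.
have G0 x : 0 <= G x by exact: le_trans (normc_ge0 _) (fG 0%N x).
have nG : nnmeas (fun x => (G x)%:E) by exact: nnmeas_EFin.
have fGl x : nc (f x) <= G x.
  apply/ler_addgt0Pr => e e0.
  have /cvgrPdist_lt/(_ e e0)[k _ /(_ k (leqnn k))] := cf x.
  rewrite sub0r normrN ger0_norm ?normc_ge0 // => h.
  rewrite (_ : f x = f_ k x + - (f_ k x - f x)); last by rewrite opprB addrC subrK.
  by rewrite (le_trans (normcD _ _)) // lerD // normcN ltW.
have if_ k : Cintegrable mu (f_ k).
  by apply: (Cintegrable_dom (mf_ k) nG) => // x; rewrite lee_fin.
have iff : Cintegrable mu f.
  by apply: (Cintegrable_dom mf nG) => // x; rewrite lee_fin.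
have := @nn_dominated0 (fun k x => nc (f_ k x - f x)) (fun x => 2 * G x).
have h1 k : measurable_fun setT (fun x => nc (f_ k x - f x)).
  by apply: measurable_normc; exact: CmeasB.
have h2 : measurable_fun setT (fun x => 2 * G x).
  by apply: measurable_funM => //; exact: measurable_cst.
have h3 k x : nc (f_ k x - f x) <= 2 * G x.
  by rewrite (le_trans (normcD _ _)) // normcN mulr_natl mulr2n lerD.
have h4 : (\int[mu]_x (2 * G x)%:E < +oo)%E.
  under eq_integral do rewrite EFinM.
  by rewrite nn_integralZl // lte_mul_pinfty // ge0_fin_numE // integral_ge0.
move=> /(_ h1 (fun k x => normc_ge0 _) cf h2 h3 h4) /fine_cvgP[_].
apply: (@squeeze_cvgr _ _ _ _ (fun=> 0)); last exact: cvg_cst.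
apply: nearW => k; apply/andP; split; first exact: normc_ge0.
have iB := CintegrableB (if_ k) iff.
rewrite -CintegralB // -lee_fin; apply: le_trans (normc_Cintegral_le iB) _.
rewrite /comp fineK // ge0_fin_numE; first exact: Cintegrable_lty iB.
by apply: integral_ge0 => x _; rewrite lee_fin normc_ge0.
Qed.

End Dominated.

Section CLnormTheory.
Context {d} {T : measurableType d} {R : realType}.
Variable mu : {measure set T -> \bar R}.
Implicit Types f g : T -> R[i].

Lemma CLnormE (p : R) f :
  CLnorm mu p f = ((\int[mu]_x (nc (f x) `^ p)%:E) `^ p^-1)%E.
Proof.
rewrite /CLnorm unlock (eq_integral (fun x => (nc (f x) `^ p)%:E)) // => x _ /=.
by rewrite ger0_norm ?normc_ge0.
Qed.

Lemma CLnorm2E f : CLnorm mu 2 f = ((\int[mu]_x (nc (f x) ^+ 2)%:E) `^ 2^-1)%E.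
Proof.
rewrite CLnormE; congr (_ `^ _)%E; apply: eq_integral => x _.
by rewrite powR_mulrn ?normc_ge0.
Qed.

Lemma CLnorm_ge0 (p : R) f : (0 <= CLnorm mu p f)%E.
Proof. exact: Lnorm_ge0. Qed.

Lemma measurable_normc_powR (p : R) f : Cmeasurable f ->
  nnmeas (fun x => (nc (f x) `^ p)%:E).
Proof.
move=> mf; apply: nnmeas_EFin => [|x]; last exact: powR_ge0.
apply: (measurableT_comp (f := fun t : R => t `^ p)); first exact: measurable_powR.
exact: measurable_normc.
Qed.

Lemma normc_hoelder (p q : R) f g : Cmeasurable f -> Cmeasurable g ->
  0 < p -> 0 < q -> p^-1 + q^-1 = 1 ->
  (\int[mu]_x (nc (f x * g x))%:E <= CLnorm mu p f * CLnorm mu q g)%E.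
Proof.
move=> mf mg p0 q0 pq.
have := hoelder mu (measurable_normc mf) (measurable_normc mg) p0 q0 pq.
rewrite Lnorm1; apply: le_trans; rewrite le_eqVlt; apply/orP; left; apply/eqP.
by apply: eq_integral => x _; rewrite /= normcM ger0_norm // mulr_ge0 ?normc_ge0.
Qed.

End CLnormTheory.

Section CAffine.
Context {R : realType} {n : nat}.
Local Notation mu := (lebesgueRn R n).
Implicit Types (f : 'rV[R]_n -> R[i]) (x : 'rV[R]_n) (c : R).

Lemma Cmeas_affine c x f : Cmeasurable f -> Cmeasurable (fun v : 'rV[R]_n => f (c *: v + x)).
Proof. by move=> mf; apply: Cmeas_comp => //; exact: measurable_rV_affine. Qed.

Lemma Cintegrable_affine c x f : c != 0 -> Cintegrable mu f ->
  Cintegrable mu (fun v : 'rV[R]_n => f (c *: v + x)).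
Proof.
move=> c0 /CintegrableP[mf foo]; apply/CintegrableP; split; first exact: Cmeas_affine.
move: foo; rewrite -(integral_affine x c0 (nnmeas_normc mf).1 (nnmeas_normc mf).2).
have c0' : 0 < `|c| ^+ n by rewrite exprn_gt0 // normr_gt0.
case: (X in (_ * X)%E) => [r _| |_]; [by rewrite ltry| |by []].
by rewrite gt0_muley.
Qed.

Let Rintegral_affine c x (u : 'rV[R]_n -> R) : c != 0 ->
  mu.-integrable setT (fun v => (u v)%:E) ->
  `|c| ^+ n * \int[mu]_v u (c *: v + x) = \int[mu]_v u v.
Proof.
move=> c0 ui; have mu' : measurable_fun setT u by case/integrableP : ui => /measurable_EFinP.
have mue : measurable_fun setT (fun v => (u v)%:E) by exact/measurable_EFinP.
have cn0 : 0 < `|c| ^+ n by rewrite exprn_gt0 // normr_gt0.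
rewrite /Rintegral integralE [in RHS]integralE.
have P := integral_affine x c0 (measurable_funepos mue) (fun v => funepos_ge0 _ v).
have N := integral_affine x c0 (measurable_funeneg mue) (fun v => funeneg_ge0 _ v).
have fP : (\int[mu]_v (fun v => (u v)%:E)^\+ v)%E \is a fin_num.
  exact: (integrable_fin_num measurableT (integrable_funepos measurableT ui)).
have fN : (\int[mu]_v (fun v => (u v)%:E)^\- v)%E \is a fin_num.
  exact: (integrable_fin_num measurableT (integrable_funeneg measurableT ui)).
have key (a b : \bar R) : ((`|c| ^+ n)%:E * a = b)%E -> (0 <= a)%E -> b \is a fin_num ->
    a \is a fin_num.
  by case: a => [a| |] // <-; rewrite gt0_muley.
have fP' := key _ _ P (integral_ge0 _ (fun v _ => funepos_ge0 _ _)) fP.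
have fN' := key _ _ N (integral_ge0 _ (fun v _ => funeneg_ge0 _ _)) fN.
have -> : (\int[mu]_v (fun v => (u (c *: v + x)%R)%:E)^\+ v =
    \int[mu]_v (fun v => (u v)%:E)^\+ (c *: v + x)%R)%E.
  by apply: eq_integral => v _; rewrite !funeposE.
have -> : (\int[mu]_v (fun v => (u (c *: v + x)%R)%:E)^\- v =
    \int[mu]_v (fun v => (u v)%:E)^\- (c *: v + x)%R)%E.
  by apply: eq_integral => v _; rewrite !funenegE.
by rewrite -P -N -(fineK fP') -(fineK fN') -!EFinM -!EFinB /= mulrBr.
Qed.

Lemma Cintegral_affine c x f : c != 0 -> Cintegrable mu f ->
  (`|c| ^+ n)%:C * Cintegral mu (fun v : 'rV[R]_n => f (c *: v + x)) = Cintegral mu f.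
Proof.
move=> c0 [fr fi]; apply: complex_eq; rewrite ?Re_mul ?Im_mul /= mul0r ?subr0 ?addr0.
  exact: (Rintegral_affine x c0 fr).
exact: (Rintegral_affine x c0 fi).
Qed.

Lemma Cintegral_shift x f : Cintegrable mu f ->
  Cintegral mu (fun v : 'rV[R]_n => f (v + x)) = Cintegral mu f.
Proof.
move=> fi; rewrite -[RHS](Cintegral_affine x (oner_neq0 _) fi) normr1 expr1n mul1r.
by under [in RHS]eq_fun do rewrite scale1r.
Qed.

Lemma Cintegral_reflect f : Cintegrable mu f ->
  Cintegral mu (fun v : 'rV[R]_n => f (- v)) = Cintegral mu f.
Proof.
move=> fi; have m1 : -1 != 0 :> R by rewrite oppr_eq0 oner_neq0.
rewrite -[RHS](Cintegral_affine 0 m1 fi) normrN1 expr1n mul1r.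
by under [in RHS]eq_fun do rewrite scaleN1r addr0.
Qed.

End CAffine.

(** * Smooth functions with growth conditions *)

(** A quadratic remainder is o(|v|). This is how explicit functions, integrals depending on a
    parameter and the flat functions at the origin are all differentiated. *)
Lemma is_diff_le_sqr (K : realFieldType) (V W : normedModType K) (f : V -> W)
    (df : {linear V -> W}) (x : V) (C : K) : continuous df ->
  (forall v, `|f (v + x) - (f x + df v)| <= C * `|v| ^+ 2) -> is_diff x f df.
Proof.
move=> cdf hC.
have eqo : f \o shift x = cst (f x) + df +o_ 0 id.
  apply/eqaddoP => _/posnumP[e].
  pose L := `|C| + 1; have L0 : 0 < L by rewrite ltr_wpDl.
  near=> v; apply: (le_trans (hC v)); rewrite expr2 mulrA ler_wpM2r //.
  apply: (@le_trans _ _ (L * `|v|)).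
    by rewrite ler_wpM2r // (le_trans (ler_norm _)) // lerDl.
  rewrite mulrC -ler_pdivlMr //.
  near: v; apply/nbhs_ballP; exists (e%:num / L) => /=; first by rewrite divr_gt0.
  by move=> v; rewrite -ball_normE /= sub0r normrN => /ltW.
have dE : 'd f x = df :> (V -> W) by exact: diff_unique.
by apply: DiffDef => //; apply/diff_locallyP; rewrite dE.
Unshelve. all: by end_near. Qed.

Section Smooth.
Context {R : realType} {n : nat}.
Local Notation V := 'rV[R]_n.
Implicit Types (h f g : V -> R) (x y v xi : V) (D : (V -> R) -> Prop).

Local Notation "'d_ i" := (fun h : V -> R => 'D_(delta_mx 0 i) h : V -> R)
  (at level 0, i at level 0).

Lemma differentiable_dotl xi v : differentiable (fun v : V => dot v xi) v.
Proof.
rewrite (_ : (fun v => _) = \sum_(i < n) (fun v : V => v ord0 i * xi ord0 i)).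
  apply: differentiable_sum => i; apply: differentiableM => //.
  exact: differentiable_coord.
by apply/funext => w; rewrite fct_sumE.
Qed.

Lemma continuous_dotl xi : continuous (fun v : V => dot v xi).
Proof. by move=> v; exact/differentiable_continuous/differentiable_dotl. Qed.

(** Named so that the form can carry the linear structure that [is_diff_le_sqr] expects. *)
Definition dot_with xi v : R := dot v xi.

Lemma dot_with_is_linear xi : linear (dot_with xi).
Proof. by move=> c u v; rewrite /dot_with dotDl dotZl. Qed.

HB.instance Definition _ xi :=
  GRing.isLinear.Build R V R _ (dot_with xi) (dot_with_is_linear xi).

Lemma is_diff_quadratic h x xi (K : R) :
  (forall v, `|h (x + v) - h x - dot v xi| <= K * enorm v ^+ 2) ->
  is_diff x h (fun v => dot v xi).
Proof.
move=> hK; apply: (@is_diff_le_sqr _ _ _ h (dot_with xi) x (`|K| * n%:R ^+ 2)).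
  exact: continuous_dotl.
move=> v; rewrite [v + x]addrC opprD addrA; apply: (le_trans (hK v)).
rewrite -mulrA -exprMn; apply: (le_trans (ler_norm _)).
rewrite normrM normrX ler_wpM2l // lerXn2r ?nnegrE ?mulr_ge0 //.
by rewrite ger0_norm ?enorm_ge0 // enorm_le_mx.
Qed.

Lemma diff_derivE h x xi : is_diff x h (fun v => dot v xi) ->
  forall v, 'D_v h x = dot v xi.
Proof. by move=> dh v; rewrite deriveE ?diff_val. Qed.

Lemma diff_linE h x : differentiable h x -> exists xi, is_diff x h (fun v => dot v xi).
Proof.
move=> dh; exists (\row_i 'd h x (delta_mx 0 i)); apply: DiffDef => //.
apply/funext => v; rewrite {1}(row_sum_delta v) linear_sum /dot.
by apply: eq_bigr => i _; rewrite linearZ mxE.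
Qed.

Definition has_grad h x xi := is_diff x h (fun v => dot v xi).

Lemma has_grad_partial h x xi i : has_grad h x xi -> 'D_(delta_mx 0 i) h x = xi ord0 i.
Proof. by move=> /diff_derivE ->; rewrite dotC dot_delta. Qed.

Lemma has_grad_diff h x xi : has_grad h x xi -> differentiable h x.
Proof. by case. Qed.

Definition grad h x : V := \row_i 'D_(delta_mx 0 i) h x.

Lemma has_gradE h x : differentiable h x -> has_grad h x (grad h x).
Proof.
move=> dh; rewrite /grad; have [xi hxi] := diff_linE dh.
rewrite (_ : \row_i _ = xi) //; apply/rowP => i.
by rewrite mxE (has_grad_partial i hxi).
Qed.

Lemma has_gradD f g x a b : has_grad f x a -> has_grad g x b ->
  has_grad (fun y => f y + g y) x (a + b).
Proof.
move=> fa gb; have H := is_diffD fa gb.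
by apply: (is_diff_eq H); apply/funext => v; rewrite /= dotDr.
Qed.

Lemma has_gradM f g x a b : has_grad f x a -> has_grad g x b ->
  has_grad (fun y => f y * g y) x (f x *: b + g x *: a).
Proof.
move=> fa gb; have H := is_diffM fa gb.
by apply: (is_diff_eq H); apply/funext => v; rewrite /= dotDr !dotZr.
Qed.

Lemma has_grad_cst (c : R) x : has_grad (fun _ => c) x 0.
Proof.
have H := is_diff_cst c x.
by apply: (is_diff_eq H); apply/funext => v; rewrite dotC dot0l.
Qed.

Lemma has_grad_dot xi x : has_grad (fun v => dot v xi) x xi.
Proof.
have := @is_diff_quadratic (fun v => dot v xi) x xi 0; apply => v.
by rewrite dotDl (addrC (dot x xi)) addrK subrr normr0 mul0r.
Qed.

Lemma has_grad_sqr x : has_grad (fun v => dot v v) x (2 *: x).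
Proof.
have := @is_diff_quadratic (fun v => dot v v) x (2 *: x) 1; apply => v.
rewrite enorm_sqr !(dotDl, dotDr, dotZr) (dotC v x) mul1r.
rewrite (_ : _ - _ = dot v v); last by ring.
by rewrite ger0_norm // dot_ge0.
Qed.

Lemma has_grad_comp (H : R -> R) (l : R) h x a : has_grad h x a ->
  is_derive (h x) 1 H l -> has_grad (fun y => H (h y)) x (l *: a).
Proof.
move=> ha Hl; have dH : differentiable H (h x) by apply/derivable1_diffP; exact: ex_derive.
have iH : is_diff (h x) H (fun t => t * l).
  apply: DiffDef => //; rewrite diff1E // derive1E; apply/funext => t.
  by rewrite derive_val.
have cH := is_diff_comp ha iH.
by apply: (is_diff_eq cH); apply/funext => v; rewrite /= dotZr mulrC.
Qed.

Lemma has_grad_affine (c : R) v h x a : has_grad h (c *: x + v) a ->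
  has_grad (fun y => h (c *: y + v)) x (c *: a).
Proof.
move=> ha; have dA : is_diff x (fun y : V => c *: y + v) ( *:%R c).
  have H := is_diffD (is_diff_scaler c x) (is_diff_cst v x).
  by apply: (is_diff_eq H); rewrite addr0.
have H := is_diff_comp dA ha.
by apply: (is_diff_eq H); apply/funext => w; rewrite /= dotZl dotZr.
Qed.

(** D is a size condition, [decay] or [slow], imposed on all derivatives up to order k. Recursion on
    the order instead of on lists of directions lets the product and chain rules go by induction,
    without a Leibniz formula. *)
Fixpoint smooth_upto D k h : Prop :=
  [/\ forall x, differentiable h x, D h &
      if k is j.+1 then forall i, smooth_upto D j ('D_(delta_mx 0 i) h) else True].

Lemma smooth_upto_diff D k h : smooth_upto D k h -> forall x, differentiable h x.
Proof. by case: k => [|k] []. Qed.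

Lemma smooth_upto_size D k h : smooth_upto D k h -> D h.
Proof. by case: k => [|k] []. Qed.

Lemma smooth_uptoW D k h : smooth_upto D k.+1 h -> smooth_upto D k h.
Proof.
elim: k h => [|k IH] h [dh Dh hi]; split => // i; apply: IH; exact: hi.
Qed.

Lemma smooth_upto_grad D k h (G : V -> V) : (forall x, has_grad h x (G x)) -> D h ->
  (forall i, smooth_upto D k (fun x => G x ord0 i)) -> smooth_upto D k.+1 h.
Proof.
move=> hG Dh hk; split => // [x|i]; first exact: has_grad_diff (hG x).
rewrite (_ : 'D__ h = fun x => G x ord0 i) //; apply/funext => x.
exact: has_grad_partial.
Qed.

Lemma smooth_upto0_grad D h (G : V -> V) : (forall x, has_grad h x (G x)) -> D h ->
  smooth_upto D 0 h.
Proof. by move=> hG Dh; split => // x; exact: has_grad_diff (hG x). Qed.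

Definition decay h := forall m, exists C, forall x, enorm x ^+ m * `|h x| <= C.
Definition slow h := exists m C, forall x, `|h x| <= C * (1 + enorm x) ^+ m.

Lemma exprn_1D_le (t : R) m : 0 <= t -> (1 + t) ^+ m <= 2 ^+ m * (1 + t ^+ m).
Proof.
move=> t0; have [t1|/ltW t1] := leP t 1.
  apply: (@le_trans _ _ (2 ^+ m)).
    by rewrite lerXn2r ?nnegrE ?addr_ge0 // -[leRHS](natrD _ 1 1) lerD2l.
  by rewrite ler_peMr ?exprn_ge0 // lerDl exprn_ge0.
apply: (@le_trans _ _ ((2 * t) ^+ m)).
  by rewrite lerXn2r ?nnegrE ?addr_ge0 ?mulr_ge0 // mulr_natl mulr2n lerD2r.
by rewrite exprMn ler_wpM2l ?exprn_ge0 // lerDr.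
Qed.

Lemma decay_1D h m : decay h -> exists C, forall x, (1 + enorm x) ^+ m * `|h x| <= C.
Proof.
move=> dh; have [C0 hC0] := dh 0%N; have [C1 hC1] := dh m.
exists (2 ^+ m * (C0 + C1)) => x.
apply: (@le_trans _ _ (2 ^+ m * (1 + enorm x ^+ m) * `|h x|)).
  by rewrite ler_wpM2r // exprn_1D_le // enorm_ge0.
rewrite -mulrA ler_wpM2l ?exprn_ge0 // mulrDl lerD //.
by have := hC0 x; rewrite expr0.
Qed.

Lemma decayP h : (forall m, exists C, forall x, (1 + enorm x) ^+ m * `|h x| <= C) -> decay h.
Proof.
move=> dh m; have [C hC] := dh m; exists C => x; apply: le_trans (hC x).
by rewrite ler_wpM2r // lerXn2r ?nnegrE ?addr_ge0 ?enorm_ge0 // lerDr.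
Qed.

Lemma decayD f g : decay f -> decay g -> decay (fun x => f x + g x).
Proof.
move=> df dg m; have [A hA] := df m; have [B hB] := dg m; exists (A + B) => x.
apply: le_trans (lerD (hA x) (hB x)); rewrite -mulrDr ler_wpM2l ?exprn_ge0 ?enorm_ge0 //.
exact: ler_normD.
Qed.

Lemma decayM f g : decay f -> slow g -> decay (fun x => f x * g x).
Proof.
move=> df [p [B hB]]; apply: decayP => m; have [C hC] := decay_1D (m + p) df.
exists (C * `|B|) => x; rewrite normrM.
have p0 k : 0 <= (1 + enorm x) ^+ k by rewrite exprn_ge0 // addr_ge0 // enorm_ge0.
apply: (@le_trans _ _ ((1 + enorm x) ^+ m * (`|f x| * (`|B| * (1 + enorm x) ^+ p)))).
  apply: ler_wpM2l => //; apply: ler_wpM2l => //; apply: le_trans (hB x) _.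
  by rewrite ler_wpM2r // ler_norm.
rewrite (_ : _ * _ = (1 + enorm x) ^+ (m + p) * `|f x| * `|B|); last by rewrite exprD; ring.
by rewrite ler_wpM2r.
Qed.

Lemma slowP h : slow h -> exists m C, 0 <= C /\
  forall p x, (m <= p)%N -> `|h x| <= C * (1 + enorm x) ^+ p.
Proof.
move=> [m [C hC]]; exists m, `|C|; split => // p x mp.
apply: le_trans (hC x) _; apply: (@le_trans _ _ (`|C| * (1 + enorm x) ^+ m)).
  by rewrite ler_wpM2r ?ler_norm // exprn_ge0 // addr_ge0 // enorm_ge0.
by rewrite ler_wpM2l // ler_weXn2l // lerDl enorm_ge0.
Qed.

Lemma slowD f g : slow f -> slow g -> slow (fun x => f x + g x).
Proof.
move=> /slowP[m [A [A0 hA]]] /slowP[p [B [B0 hB]]]; exists (m + p)%N, (A + B) => x.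
apply: le_trans (ler_normD _ _) _; rewrite mulrDl lerD //.
  by rewrite hA // leq_addr.
by rewrite hB // leq_addl.
Qed.

Lemma slowM f g : slow f -> slow g -> slow (fun x => f x * g x).
Proof.
move=> /slowP[m [A [A0 hA]]] /slowP[p [B [B0 hB]]]; exists (m + p)%N, (A * B) => x.
by rewrite normrM exprD mulrACA ler_pM // ?hA ?hB.
Qed.

Lemma slow_cst (c : R) : slow (fun _ => c).
Proof. by exists 0%N, `|c| => x; rewrite expr0 mulr1. Qed.

Lemma slow_dot xi : slow (fun y => dot y xi).
Proof.
exists 1%N, (enorm xi) => x; rewrite expr1 (le_trans (normr_dot _ _)) // mulrC.
by rewrite ler_wpM2l ?enorm_ge0 // lerDr.
Qed.

Lemma slow_bounded h (C : R) : (forall x, `|h x| <= C) -> slow h.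
Proof. by move=> hC; exists 0%N, C => x; rewrite expr0 mulr1. Qed.

Lemma smooth_slow_cst (c : R) k : smooth_upto slow k (fun _ => c).
Proof.
elim: k c => [|k IH] c; first exact: (smooth_upto0_grad (has_grad_cst c) (slow_cst c)).
apply: (smooth_upto_grad (has_grad_cst c) (slow_cst c)) => i.
by under eq_fun do rewrite mxE; exact: IH.
Qed.

Lemma smooth_slow_dot xi k : smooth_upto slow k (fun y => dot y xi).
Proof.
case: k => [|k]; first exact: (smooth_upto0_grad (has_grad_dot xi) (slow_dot xi)).
by apply: (smooth_upto_grad (has_grad_dot xi) (slow_dot xi)) => i; exact: smooth_slow_cst.
Qed.

Lemma smooth_slow_coord i k : smooth_upto slow k (fun y => y ord0 i).
Proof.
by have := smooth_slow_dot (delta_mx 0 i) k; under eq_fun do rewrite dot_delta.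
Qed.

Section Closure.
Variable D : (V -> R) -> Prop.
Hypothesis DD : forall f g, D f -> D g -> D (fun x => f x + g x).
Hypothesis DM : forall f g, D f -> slow g -> D (fun x => f x * g x).

Lemma smooth_uptoD k f g : smooth_upto D k f -> smooth_upto D k g ->
  smooth_upto D k (fun x => f x + g x).
Proof.
elim: k f g => [|k IH] f g [df Df fk] [dg Dg gk].
  apply: (@smooth_upto0_grad _ _ (fun x => grad f x + grad g x)); last exact: DD.
  by move=> x; apply: has_gradD; exact: has_gradE.
apply: (@smooth_upto_grad _ _ _ (fun x => grad f x + grad g x)); last 2 first.
- exact: DD.
- move=> i; under eq_fun do rewrite !mxE; exact: IH (fk i) (gk i).
by move=> x; apply: has_gradD; exact: has_gradE.
Qed.

(** For D = [slow] this makes the functions of polynomial growth an algebra, for D = [decay] it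
    makes Schwartz functions a module over it. The hypotheses on D are what both cases share. *)
Lemma smooth_uptoM k f g : smooth_upto D k f -> smooth_upto slow k g ->
  smooth_upto D k (fun x => f x * g x).
Proof.
elim: k f g => [|k IH] f g fk gk; have [df Df dfk] := fk; have [dg Dg dgk] := gk.
  apply: (@smooth_upto0_grad _ _ (fun x => f x *: grad g x + g x *: grad f x)); last exact: DM.
  by move=> x; apply: has_gradM; exact: has_gradE.
apply: (@smooth_upto_grad _ _ _ (fun x => f x *: grad g x + g x *: grad f x)); last 2 first.
- exact: DM.
- move=> i; under eq_fun do rewrite !mxE [g _ * _]mulrC; apply: smooth_uptoD.
    by apply: IH; [exact: smooth_uptoW|exact: dgk].
  by apply: IH; [exact: dfk|exact: smooth_uptoW].
by move=> x; apply: has_gradM; exact: has_gradE.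
Qed.

(** [H j] is the j-th derivative of a function of one variable. Once the size of every [H j] along
    [rho] is known, the chain rule only multiplies by derivatives of [rho], which grow slowly. *)
Lemma smooth_upto_comp (H : nat -> R -> R) (rho : V -> R) :
  (forall j (s : R), is_derive s 1 (H j) (H j.+1 s)) ->
  (forall j, D (fun x => H j (rho x))) -> (forall k, smooth_upto slow k rho) ->
  forall k j, smooth_upto D k (fun x => H j (rho x)).
Proof.
move=> dH DH srho.
have gr j x : has_grad (fun x => H j (rho x)) x
    (H j.+1 (rho x) *: grad rho x).
  by apply: has_grad_comp => //; apply: has_gradE; exact: smooth_upto_diff (srho 0%N) x.
elim => [|k IH] j; first exact: smooth_upto0_grad (gr j) (DH j).
apply: smooth_upto_grad (gr j) (DH j) _ => i.
under eq_fun do rewrite !mxE; apply: smooth_uptoM => //.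
by have [_ _ /(_ i)] := srho k.+1.
Qed.

End Closure.

Definition smooth D h := forall k, smooth_upto D k h.

Lemma smooth_slow_sqr : smooth slow (fun y => dot y y).
Proof.
have sl : slow (fun y => dot y y).
  by exists 2%N, 1 => x; rewrite mul1r -enorm_sqr ger0_norm ?exprn_ge0 ?enorm_ge0 //
    lerXn2r ?nnegrE ?addr_ge0 ?enorm_ge0 // lerDr.
case=> [|k]; first exact: smooth_upto0_grad has_grad_sqr sl.
apply: smooth_upto_grad has_grad_sqr sl _ => i; under eq_fun do rewrite mxE.
by apply: (smooth_uptoM slowD slowM); [exact: smooth_slow_cst|exact: smooth_slow_coord].
Qed.

Lemma partials_rcons s i h : partials (rcons s i) h = partials s ('D_(delta_mx 0 i) h).
Proof. by rewrite /partials foldr_rcons. Qed.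

(** In [partials] the last direction of the list is differentiated first; the induction on lists
    therefore goes from the right, to match a recursion that differentiates before lowering the
    order. *)
Lemma real_schwartzP h : real_schwartz h <-> smooth decay h.
Proof.
split=> [hs k|hk s].
  elim: k h hs => [|k IH] h hs; first by split=> //; have [] := hs [::].
  split; [by have [] := hs [::]|by have [] := hs [::]|move=> i; apply: IH => s].
  by rewrite -partials_rcons; exact: hs.
have : smooth_upto decay (size s) h by exact: hk.
elim/last_ind: s h {hk} => [|s i IH] h; first by move=> [].
rewrite size_rcons partials_rcons => -[_ _ /(_ i)]; exact: IH.
Qed.

Lemma smooth_partial D h i : smooth D h -> smooth D ('D_(delta_mx 0 i) h).
Proof. by move=> hs k; have [_ _ /(_ i)] := hs k.+1. Qed.

Lemma smooth_decayM f g : smooth decay f -> smooth slow g -> smooth decay (fun x => f x * g x).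
Proof. by move=> fs gs k; exact: (smooth_uptoM decayD decayM (fs k) (gs k)). Qed.

Lemma smooth_decayD f g : smooth decay f -> smooth decay g -> smooth decay (fun x => f x + g x).
Proof. by move=> fs gs k; exact: (smooth_uptoD decayD (fs k) (gs k)). Qed.

Lemma smooth_slowM f g : smooth slow f -> smooth slow g -> smooth slow (fun x => f x * g x).
Proof. by move=> fs gs k; exact: (smooth_uptoM slowD slowM (fs k) (gs k)). Qed.

Lemma decay_affine (c : R) v h : c != 0 -> decay h -> decay (fun x => h (c *: x + v)).
Proof.
move=> c0 dh; apply: decayP => m; have [C hC] := decay_1D m dh.
(* Chosen so that 1 + |x| <= L (1 + |c x + v|), starting from |x| <= (|c x + v| + |v|) / |c|. *)
pose L := 1 + (1 + enorm v) / `|c|.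
have cn : 0 < `|c| by rewrite normr_gt0.
have L0 : 0 <= L by rewrite addr_ge0 // divr_ge0 // addr_ge0 // enorm_ge0.
exists (L ^+ m * C) => x.
have key : 1 + enorm x <= L * (1 + enorm (c *: x + v)).
  have h1 : enorm x <= (enorm (c *: x + v) + enorm v) / `|c|.
    rewrite ler_pdivlMr // mulrC -enormZ -[in leLHS](addrK v (c *: x)).
    by rewrite (le_trans (enormD _ _)) // enormN.
  rewrite /L; set e := enorm (_ + _) in h1 *; have e0 : 0 <= e by exact: enorm_ge0.
  apply: (@le_trans _ _ (1 + (e + enorm v) / `|c|)); first by rewrite lerD2l.
  rewrite [leRHS]mulrDl mul1r lerD ?lerDl // mulrAC ler_wpM2r ?invr_ge0 //.
  have v0 := enorm_ge0 v; have ve : 0 <= enorm v * e by rewrite mulr_ge0.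
  by rewrite (_ : (1 + enorm v) * (1 + e) = 1 + enorm v + e + enorm v * e); [lra|ring].
apply: le_trans (ler_wpM2l (exprn_ge0 m L0) (hC (c *: x + v))).
rewrite mulrA -exprMn ler_wpM2r //.
by apply: lerXn2r => //; rewrite nnegrE ?(mulr_ge0 L0) // addr_ge0 // enorm_ge0.
Qed.

Lemma smooth_decay_affine (c : R) v h : c != 0 -> smooth decay h ->
  smooth decay (fun x => h (c *: x + v)).
Proof.
move=> c0 hs k; elim: k h hs => [|k IH] h hs.
  apply: (@smooth_upto0_grad _ _ (fun x => c *: grad h (c *: x + v))).
    by move=> x; apply: has_grad_affine; apply: has_gradE; exact: smooth_upto_diff (hs 0%N) _.
  by apply: decay_affine => //; exact: smooth_upto_size (hs 0%N).
apply: (@smooth_upto_grad _ _ _ (fun x => c *: grad h (c *: x + v))).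
- by move=> x; apply: has_grad_affine; apply: has_gradE; exact: smooth_upto_diff (hs 0%N) _.
- by apply: decay_affine => //; exact: smooth_upto_size (hs 0%N).
move=> i; under eq_fun do rewrite !mxE mulrC.
apply: (smooth_uptoM decayD decayM); last exact: smooth_slow_cst.
exact: (IH _ (smooth_partial i hs)).
Qed.

(** Decay of order 2n suffices, because the inverse of the weight is at most (1 + |x|^2)^n <= (1 +
    |x|)^(2n). *)
Lemma decay_weight h : decay h -> exists2 C, 0 <= C & forall x, `|h x| <= C * weight x.
Proof.
move=> dh; have [C hC] := decay_1D (n + n) dh.
have C0 : 0 <= C by apply: le_trans (hC 0); rewrite mulr_ge0 // exprn_ge0 // addr_ge0 // enorm_ge0.
exists C => // x; rewrite -ler_pdivrMr ?weight_gt0 // mulrC; apply: le_trans (hC x).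
rewrite ler_wpM2r // (le_trans (weightV_le x)) // exprD -exprMn.
rewrite lerXn2r ?nnegrE ?addr_ge0 ?mulr_ge0 ?addr_ge0 ?exprn_ge0 ?enorm_ge0 //.
have := enorm_ge0 x; set e := enorm x => e0.
by rewrite (_ : (1 + e) * (1 + e) = 1 + e ^+ 2 + 2 * e); [rewrite lerDl mulr_ge0|ring].
Qed.

Lemma smooth_measurable D h : smooth D h -> measurable_fun setT h.
Proof.
move=> hs; apply: continuous_measurable_rV => x.
by apply: differentiable_continuous; exact: smooth_upto_diff (hs 0%N) x.
Qed.

Lemma decay_integral_lty h : measurable_fun setT h -> decay h ->
  (\int[lebesgueRn R n]_x (`|h x|)%:E < +oo)%E.
Proof.
move=> mh /decay_weight[C C0 hC].
apply: (@le_lt_trans _ _ (\int[lebesgueRn R n]_x (C%:E * (weight x)%:E))%E).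
  apply: nn_le_integral.
  - by apply: nnmeas_EFin => //; exact: measurableT_comp.
  - apply: nnmeasM; first exact: nnmeas_cst.
    apply: nnmeas_EFin; [exact: measurable_weight|move=> x; exact: weight_ge0].
  - by move=> x; rewrite -EFinM lee_fin.
have nw : nnmeas (fun x : V => (weight x)%:E).
  by apply: nnmeas_EFin; [exact: measurable_weight|move=> x; exact: weight_ge0].
rewrite nn_integralZl // lte_mul_pinfty ?lee_fin // ?integral_weight_lty //.
Qed.

End Smooth.

(** * Fourier transforms of Schwartz functions *)

Section TrigTaylor.
Context {R : realType}.
Implicit Types a b : R.

Lemma mvt_le (f df : R -> R) (K b : R) : (forall s : R, is_derive s 1 f (df s)) ->
  (forall s, `|s| <= `|b| -> `|df s| <= K) -> `|f b - f 0| <= K * `|b|.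
Proof.
move=> hf hK; have cf (A : set R) : {within A, continuous f}.
  apply: continuous_subspaceT => s; apply: differentiable_continuous.
  by apply/derivable1_diffP; exact: ex_derive.
have [b0|b0|->] := ltgtP b 0.
- have [s] := MVT b0 (fun s _ => hf s) (cf _).
  rewrite in_itv /= => /andP[bs s0] h.
  rewrite distrC h normrM sub0r normrN; apply: ler_wpM2r => //; apply: hK.
  by rewrite !ltr0_norm // lerN2 ltW.
- have [s] := MVT b0 (fun s _ => hf s) (cf _).
  rewrite in_itv /= => /andP[bs s0] h.
  rewrite h normrM subr0; apply: ler_wpM2r => //; apply: hK.
  by rewrite !gtr0_norm // ltW.
- by rewrite subrr !normr0 mulr0.
Qed.

Lemma sin_le_id b : `|sin b| <= `|b|.
Proof.
have := @mvt_le sin cos 1 b; rewrite sin0 subr0 mul1r; apply.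
move=> s _; exact: cos_max.
Qed.

Lemma cos_sub1_le b : `|cos b - 1| <= b ^+ 2.
Proof.
have := @mvt_le cos (fun s => - sin s) `|b| b.
rewrite cos0 -expr2 real_normK ?num_real //; apply.
by move=> s sb; rewrite normrN (le_trans (sin_le_id s)).
Qed.

Lemma sin_sub_id_le b : `|sin b - b| <= b ^+ 2.
Proof.
have := @mvt_le (fun s => sin s - s) (fun s => cos s - 1) `|b| b.
rewrite sin0 !subr0 -expr2 real_normK ?num_real //; apply => s sb.
have := @mvt_le cos (fun s => - sin s) 1 s; rewrite cos0 mul1r => h.
apply: le_trans (h _ _) sb => // z _; rewrite normrN; exact: sin_max.
Qed.

(** The remainder is uniform in a, which allows differentiation under the integral sign. *)
Lemma cos_taylor a b : `|cos (a + b) - cos a + b * sin a| <= 2 * b ^+ 2.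
Proof.
rewrite cosD (_ : _ + b * sin a = cos a * (cos b - 1) - sin a * (sin b - b)); last by ring.
rewrite mulr_natl mulr2n (le_trans (ler_normB _ _)) // !normrM lerD //.
  by rewrite -[leRHS]mul1r ler_pM // ?cos_max // cos_sub1_le.
by rewrite -[leRHS]mul1r ler_pM // ?sin_max // sin_sub_id_le.
Qed.

Lemma sin_taylor a b : `|sin (a + b) - sin a - b * cos a| <= 2 * b ^+ 2.
Proof.
rewrite sinD (_ : _ - b * cos a = sin a * (cos b - 1) + cos a * (sin b - b)); last by ring.
rewrite mulr_natl mulr2n (le_trans (ler_normD _ _)) // !normrM lerD //.
  by rewrite -[leRHS]mul1r ler_pM // ?sin_max // cos_sub1_le.
by rewrite -[leRHS]mul1r ler_pM // ?cos_max // sin_sub_id_le.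
Qed.

End TrigTaylor.

Section SchwartzFourier.
Context {R : realType} {n : nat}.
Local Notation V := 'rV[R]_n.
Local Notation mu := (lebesgueRn R n).
Implicit Types (u k h : V -> R) (x y v xi : V).

Lemma integrable_decay u : measurable_fun setT u -> decay u ->
  mu.-integrable setT (fun y => (u y)%:E).
Proof.
move=> mu' du; apply/integrableP; split; first exact/measurable_EFinP.
exact: decay_integral_lty.
Qed.

(** For |v| <= 1 one has 1 + |y| <= 2 (1 + |y + v|), so one integrable majorant serves all small
    translates. *)
Lemma decay_shift h : decay h -> exists2 C, 0 <= C &
  forall y v, enorm v <= 1 -> `|h (y + v)| <= C * weight y.
Proof.
move=> dh; have [C hC] := decay_1D (n + n) dh.
have C0 : 0 <= C by apply: le_trans (hC 0); rewrite mulr_ge0 // exprn_ge0 // addr_ge0 // enorm_ge0.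
exists (2 ^+ (n + n) * C); first by rewrite mulr_ge0 // exprn_ge0.
move=> y v v1; rewrite -ler_pdivrMr ?weight_gt0 // mulrC.
apply: le_trans (ler_wpM2l _ (hC (y + v))); last by rewrite exprn_ge0.
rewrite mulrA ler_wpM2r // (le_trans (weightV_le y)) //.
have e0 := enorm_ge0 y; have e1 := enorm_ge0 (y + v).
have h1 : enorm y <= enorm (y + v) + 1.
  rewrite -[in leLHS](addrK v y); apply: le_trans (enormD _ _) _.
  by rewrite enormN lerD2l.
rewrite -exprMn exprD -exprMn; apply: lerXn2r; rewrite ?nnegrE ?addr_ge0 ?exprn_ge0 //.
  by rewrite mulr_ge0 // mulr_ge0 // addr_ge0.
have : (1 + enorm y) * (1 + enorm y) <= 2 * (1 + enorm (y + v)) * (2 * (1 + enorm (y + v))).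
  by apply: ler_pM; lra.
by apply: le_trans; rewrite (_ : _ * _ = 1 + enorm y ^+ 2 + 2 * enorm y); [lra|ring].
Qed.

Lemma mvt_line h y i (t : R) : 0 < t -> (forall x, differentiable h x) ->
  exists2 s, 0 < s < t & h (y + t *: delta_mx 0 i) - h y =
    t * 'D_(delta_mx 0 i) h (y + s *: delta_mx 0 i).
Proof.
move=> t0 dh; pose e : V := delta_mx 0 i.
pose f (s : R) := h (y + s *: e); pose df (s : R) := 'D_e h (y + s *: e).
have hf (s : R) : is_derive s 1 f (df s).
  have dl : is_diff s (fun s : R => y + s *: e) (fun s : R => s *: e).
    have H := is_diffD (is_diff_cst y s) (is_diff_scalel s e).
    by apply: (is_diff_eq H); rewrite add0r.
  have dhl : is_diff (y + s *: e) h ('d h (y + s *: e)) by apply: DiffDef.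
  have dc := is_diff_comp dl dhl.
  have df' : differentiable f s by case: dc.
  split; first exact/derivable1_diffP.
  rewrite deriveE // /df deriveE //; case: dc => _ -> /=.
  by rewrite scale1r.
have cf (A : set R) : {within A, continuous f}.
  apply: continuous_subspaceT => s; apply: differentiable_continuous.
  by apply/derivable1_diffP; exact: ex_derive.
have [s] := MVT t0 (fun s _ => hf s) (cf _).
rewrite in_itv /= subr0 /f scale0r addr0 => st H.
by exists s => //; rewrite H mulrC.
Qed.

(** By translation invariance k(y + te) - k(y) has integral 0, so t times the integral of the
    derivative equals minus that of the remainder. Two applications of the mean value theorem bound
    the remainder by C t^2 times the weight; divide by t and let t tend to 0. *)
Lemma integral_partial0 k i : smooth decay k -> \int[mu]_y ('D_(delta_mx 0 i) k y) = 0.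
Proof.
move=> sk; pose e : V := delta_mx 0 i.
have e1 : enorm e = 1.
  by rewrite /enorm dot_delta mxE !eqxx sqrtr1.
pose k1 := 'D_e k : V -> R; pose k2 := 'D_e k1 : V -> R.
have sk1 : smooth decay k1 := smooth_partial i sk.
have sk2 : smooth decay k2 := smooth_partial i sk1.
have ik : mu.-integrable setT (fun y => (k y)%:E).
  by apply: integrable_decay; [exact: smooth_measurable sk|exact: smooth_upto_size (sk 0%N)].
have ik1 : mu.-integrable setT (fun y => (k1 y)%:E).
  by apply: integrable_decay; [exact: smooth_measurable sk1|exact: smooth_upto_size (sk1 0%N)].
have [C C0 hC] := decay_shift (smooth_upto_size (sk2 0%N)).
have nw : nnmeas (fun x : V => (weight x)%:E).
  by apply: nnmeas_EFin; [exact: measurable_weight|move=> x; exact: weight_ge0].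
have iw : mu.-integrable setT (fun y : V => (weight y)%:E).
  apply/integrableP; split; first exact: nw.1.
  under eq_integral do rewrite gee0_abs ?(nw.2) //; exact: integral_weight_lty.
pose W := \int[mu]_y (weight (y : V)).
have W0 : 0 <= W by apply: Rintegral_ge0 => y _; exact: weight_ge0.
have key (t : R) : 0 < t <= 1 -> `|\int[mu]_y k1 y| <= t * (C * W).
  move=> /andP[t0 t1].
  have sks : smooth decay (fun y => k (1 *: y + t *: e)) by apply: smooth_decay_affine.
  have iks : mu.-integrable setT (fun y => (k (y + t *: e))%:E).
    under eq_fun do rewrite -[X in X + _]scale1r.
    by apply: integrable_decay; [exact: smooth_measurable sks|exact: smooth_upto_size (sks 0%N)].
  have E0 : \int[mu]_y (k (y + t *: e)) = \int[mu]_y k y.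
    have ikC : Cintegrable mu (fun y => (k y)%:C).
      split => //=; exact: integrable0.
    have := congr1 (@complex.Re R) (Cintegral_shift (t *: e) ikC).
    by [].
  have itk1 : mu.-integrable setT (fun y => (t * k1 y)%:E).
    by under eq_fun do rewrite EFinM; exact: integrableZl.
  have iB : mu.-integrable setT (fun y => (k (y + t *: e) - k y)%:E).
    by under eq_fun do rewrite EFinB; exact: integrableB.
  have E1 : t * \int[mu]_y k1 y = - \int[mu]_y (k (y + t *: e) - k y - t * k1 y).
    rewrite RintegralB // RintegralB // E0 subrr sub0r opprK RintegralZl //.
  have bound y : `|k (y + t *: e) - k y - t * k1 y| <= t * (t * (C * weight y)).
    have [s /andP[s0 st] ->] := @mvt_line k y i t t0 (smooth_upto_diff (sk 0%N)).
    rewrite -/e -/k1 -mulrBr normrM gtr0_norm // ler_wpM2l ?(ltW t0) //.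
    have [r /andP[r0 rs] ->] := @mvt_line k1 y i s s0 (smooth_upto_diff (sk1 0%N)).
    rewrite -/e -/k2 normrM gtr0_norm //.
    apply: ler_pM => //; first exact: ltW.
      exact: ltW.
    apply: hC.
    by rewrite enormZ e1 mulr1 gtr0_norm // ltW // (lt_le_trans rs) // ltW // (lt_le_trans st).
  rewrite -(@ler_pM2l _ t) // -{1}(gtr0_norm t0) -normrM E1 normrN.
  have iBB : mu.-integrable setT (fun y => (k (y + t *: e) - k y - t * k1 y)%:E).
    by under eq_fun do rewrite EFinB; exact: integrableB.
  apply: le_trans (le_normr_Rintegral measurableT iBB) _.
  have iw1 := integrableZl_EFin C iw; have iw2 := integrableZl_EFin t iw1.
  have iw3 := integrableZl_EFin t iw2.
  rewrite /W -(RintegralZl C measurableT iw) -(RintegralZl t measurableT iw1).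
  rewrite -(RintegralZl t measurableT iw2).
  apply: le_Rintegral => //.
  - exact: (integrable_norm iBB).
apply/eqP; rewrite -normr_le0; apply/ler_addgt0Pr => eps eps0; rewrite add0r.
pose t := Num.min 1 (eps / (C * W + 1)).
have CW1 : 0 < C * W + 1 by rewrite ltr_wpDl // mulr_ge0.
have t0 : 0 < t by rewrite lt_min ltr01 divr_gt0.
have t1 : t <= 1 by rewrite ge_min lexx.
apply: (le_trans (key t _)); first by rewrite t0.
apply: (@le_trans _ _ (t * (C * W + 1))); first by rewrite ler_wpM2l ?lerDl // ltW.
by rewrite -ler_pdivlMr // ge_min lexx orbT.
Qed.

(** Differentiability is developed for real-valued functions, so the Fourier transform is studied
    through its cosine and sine parts. *)
Definition cos_transform u xi : R := \int[mu]_y (cos (dot y xi) * u y).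
Definition sin_transform u xi : R := \int[mu]_y (sin (dot y xi) * u y).

Lemma smooth_slow_cos xi : smooth slow (fun y => cos (dot y xi)).
Proof.
(* The successive derivatives of the cosine, of period 4 in j. *)
pose H j : R -> R := fun s => nth (fun=> 0) [:: cos; -%R \o sin; -%R \o cos; sin] (j %% 4)%N s.
have bH j y : `|H j (dot y xi)| <= 1.
  rewrite /H; have : (j %% 4 < 4)%N by rewrite ltn_mod.
  case: (j %% 4)%N => [|[|[|[|//]]]] _ /=; rewrite ?normrN ?cos_max ?sin_max //.
move=> k; refine (smooth_upto_comp slowD slowM (H := H) (rho := fun y => dot y xi) _ _ _ k 0%N).
- move=> j s; rewrite /H -(addn1 j) -modnDml; have : (j %% 4 < 4)%N by rewrite ltn_mod.
  case: (j %% 4)%N => [|[|[|[|//]]]] _ /=.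
  + exact: is_derive_cos.
  + apply: is_deriveN; exact: is_derive_sin.
  + rewrite -[sin s]opprK; apply: is_deriveN; exact: is_derive_cos.
  + exact: is_derive_sin.
- by move=> j; exact: slow_bounded (bH j).
- by move=> j; exact: smooth_slow_dot.
Qed.

Lemma smooth_slow_sin xi : smooth slow (fun y => sin (dot y xi)).
Proof.
pose H j : R -> R := fun s => nth (fun=> 0) [:: sin; cos; -%R \o sin; -%R \o cos] (j %% 4)%N s.
have bH j y : `|H j (dot y xi)| <= 1.
  rewrite /H; have : (j %% 4 < 4)%N by rewrite ltn_mod.
  case: (j %% 4)%N => [|[|[|[|//]]]] _ /=; rewrite ?normrN ?cos_max ?sin_max //.
move=> k; refine (smooth_upto_comp slowD slowM (H := H) (rho := fun y => dot y xi) _ _ _ k 0%N).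
- move=> j s; rewrite /H -(addn1 j) -modnDml; have : (j %% 4 < 4)%N by rewrite ltn_mod.
  case: (j %% 4)%N => [|[|[|[|//]]]] _ /=.
  + exact: is_derive_sin.
  + exact: is_derive_cos.
  + apply: is_deriveN; exact: is_derive_sin.
  + rewrite -[sin s]opprK; apply: is_deriveN; exact: is_derive_cos.
- by move=> j; exact: slow_bounded (bH j).
- by move=> j; exact: smooth_slow_dot.
Qed.

Lemma has_grad_cos xi x : has_grad (fun y => cos (dot y xi)) x (- sin (dot x xi) *: xi).
Proof. by apply: has_grad_comp; exact: has_grad_dot. Qed.

Lemma has_grad_sin xi x : has_grad (fun y => sin (dot y xi)) x (cos (dot x xi) *: xi).
Proof. by apply: has_grad_comp; exact: has_grad_dot. Qed.

Lemma smooth_decay_integrable u : smooth decay u -> mu.-integrable setT (fun y => (u y)%:E).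
Proof.
move=> su; apply: integrable_decay; first exact: smooth_measurable su.
exact: smooth_upto_size (su 0%N).
Qed.

Lemma smooth_decay_cosM u xi : smooth decay u -> smooth decay (fun y => cos (dot y xi) * u y).
Proof.
move=> su; under eq_fun do rewrite mulrC.
exact: smooth_decayM (smooth_slow_cos xi).
Qed.

Lemma smooth_decay_sinM u xi : smooth decay u -> smooth decay (fun y => sin (dot y xi) * u y).
Proof.
move=> su; under eq_fun do rewrite mulrC.
exact: smooth_decayM (smooth_slow_sin xi).
Qed.

Lemma smooth_decay_coordM u i : smooth decay u -> smooth decay (fun y => y ord0 i * u y).
Proof.
move=> su; under eq_fun do rewrite mulrC.
by apply: smooth_decayM => // k; exact: smooth_slow_coord.
Qed.

(** The partial derivative of sin(y.xi) u(y) in y has integral zero. *)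
Lemma coord_mul_cos_transform u i xi : smooth decay u ->
  xi ord0 i * cos_transform u xi = - sin_transform ('D_(delta_mx 0 i) u) xi.
Proof.
move=> su; have sd := smooth_partial i su.
have := integral_partial0 i (smooth_decay_sinM xi su).
rewrite (@eq_Rintegral _ _ _ mu setT (fun y => xi ord0 i * (cos (dot y xi) * u y) +
   sin (dot y xi) * 'D_(delta_mx 0 i) u y)); last first.
  move=> y _; have gu := has_gradE (smooth_upto_diff (su 0%N) y).
  rewrite (has_grad_partial i (has_gradM (has_grad_sin xi y) gu)) !mxE; ring.
have ic := smooth_decay_integrable (smooth_decay_cosM xi su).
have is' := smooth_decay_integrable (smooth_decay_sinM xi sd).
rewrite RintegralD //; last exact: integrableZl_EFin ic.
by rewrite RintegralZl // => /eqP; rewrite addr_eq0 => /eqP.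
Qed.

Lemma coord_mul_sin_transform u i xi : smooth decay u ->
  xi ord0 i * sin_transform u xi = cos_transform ('D_(delta_mx 0 i) u) xi.
Proof.
move=> su; have sd := smooth_partial i su.
have := integral_partial0 i (smooth_decay_cosM xi su).
rewrite (@eq_Rintegral _ _ _ mu setT (fun y => - xi ord0 i * (sin (dot y xi) * u y) +
   cos (dot y xi) * 'D_(delta_mx 0 i) u y)); last first.
  move=> y _; have gu := has_gradE (smooth_upto_diff (su 0%N) y).
  rewrite (has_grad_partial i (has_gradM (has_grad_cos xi y) gu)) !mxE; ring.
have ic := smooth_decay_integrable (smooth_decay_cosM xi sd).
have is' := smooth_decay_integrable (smooth_decay_sinM xi su).
rewrite RintegralD //; last exact: integrableZl_EFin is'.
by rewrite RintegralZl // mulNr => /eqP; rewrite addrC subr_eq0 => /eqP.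
Qed.

Lemma dot_row_integral (G : 'I_n -> V -> R) v :
  (forall i, mu.-integrable setT (fun y => (G i y)%:E)) ->
  dot v (\row_i \int[mu]_y G i y) = \int[mu]_y (\sum_i v ord0 i * G i y).
Proof.
move=> iG; rewrite /dot.
have key (s : seq 'I_n) : mu.-integrable setT (fun y => (\sum_(i <- s) v ord0 i * G i y)%:E) /\
    \sum_(i <- s) v ord0 i * \int[mu]_y G i y = \int[mu]_y (\sum_(i <- s) v ord0 i * G i y).
  elim: s => [|i s [is' IH]].
    split; first by under eq_fun do rewrite big_nil; exact: integrable0.
    rewrite big_nil; under eq_Rintegral do rewrite big_nil.
    by rewrite Rintegral_cst // mul0r.
  have iz := integrableZl_EFin (v ord0 i) (iG i); split.
    by under eq_fun do rewrite big_cons EFinD; exact: integrableD.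
  under eq_Rintegral do rewrite big_cons; rewrite RintegralD // big_cons IH RintegralZl //.
  exact: iG.
by rewrite -(key _).2; apply: eq_bigr => i _; rewrite mxE.
Qed.

(** The second-order remainder under the integral is at most 2 (y.v)^2 |u(y)| <= 2 |v|^2 |y|^2
    |u(y)|, and |y|^2 u is integrable: hence the constant [K]. *)
Lemma has_grad_transform (c dc : R -> R) u xi : smooth decay u ->
  (forall eta, smooth decay (fun y => c (dot y eta) * u y)) ->
  (forall eta h, smooth decay h -> smooth decay (fun y => dc (dot y eta) * h y)) ->
  (forall a b, `|c (a + b) - c a - b * dc a| <= 2 * b ^+ 2) ->
  has_grad (fun eta => \int[mu]_y (c (dot y eta) * u y)) xi
    (\row_i \int[mu]_y (dc (dot y xi) * (y ord0 i * u y))).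
Proof.
move=> su sc sdc hc.
have s2 : smooth decay (fun y => dot y y * u y).
  under eq_fun do rewrite mulrC; exact: smooth_decayM smooth_slow_sqr.
have i2 := integrable_norm (smooth_decay_integrable s2).
pose K := 2 * \int[mu]_y `|dot y y * u y|.
apply: (@is_diff_quadratic _ _ _ _ _ K) => v.
have iG i := smooth_decay_integrable (sdc xi _ (smooth_decay_coordM i su)).
rewrite dot_row_integral //.
have ic eta := smooth_decay_integrable (sc eta).
have E y : \sum_i v ord0 i * (dc (dot y xi) * (y ord0 i * u y)) = dot y v * dc (dot y xi) * u y.
  rewrite /dot !mulr_suml; apply: eq_bigr => i _; ring.
have iv : mu.-integrable setT (fun y => (dot y v * dc (dot y xi) * u y)%:E).
  have sv : smooth decay (fun y => dot y v * u y).
    under eq_fun do rewrite mulrC.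
    by apply: smooth_decayM => // k; exact: smooth_slow_dot.
  have := smooth_decay_integrable (sdc xi _ sv).
  by under eq_fun do rewrite mulrA [dc _ * _]mulrC.
under [X in _ - X]eq_Rintegral do rewrite E.
have iB : mu.-integrable setT (fun y => (c (dot y (xi + v)) * u y - c (dot y xi) * u y)%:E).
  by under eq_fun do rewrite EFinB; exact: integrableB.
rewrite -RintegralB //; [|exact: ic|exact: ic]. rewrite -RintegralB //.
have iBB : mu.-integrable setT (fun y => (c (dot y (xi + v)) * u y - c (dot y xi) * u y -
    dot y v * dc (dot y xi) * u y)%:E).
  by under eq_fun do rewrite EFinB; exact: integrableB.
apply: le_trans (le_normr_Rintegral measurableT iBB) _.
rewrite /K mulrAC -RintegralZl //; apply: le_Rintegral => //.
- exact: (integrable_norm iBB).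
- exact: integrableZl_EFin i2.
move=> y _; rewrite -!mulrBl normrM dotDr normrM (ger0_norm (dot_ge0 y)) mulrA ler_wpM2r //.
apply: (le_trans (hc _ _)); rewrite -mulrA ler_wpM2l // enorm_sqr [leRHS]mulrC.
exact: dot_cs_sqr.
Qed.

Lemma has_grad_cos_transform u xi : smooth decay u ->
  has_grad (cos_transform u) xi (\row_i - sin_transform (fun y => y ord0 i * u y) xi).
Proof.
move=> su.
have H := @has_grad_transform cos (fun s => - sin s) u xi su.
have E : (\row_i - sin_transform (fun y => y ord0 i * u y) xi) =
    \row_i \int[mu]_y (- sin (dot y xi) * (y ord0 i * u y)) :> V.
  apply/rowP => i; rewrite !mxE /sin_transform -mulN1r -RintegralZl //.
    by apply: eq_Rintegral => y _; rewrite mulN1r mulNr.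
  exact: (smooth_decay_integrable (smooth_decay_sinM xi (smooth_decay_coordM i su))).
rewrite E; apply: H.
- by move=> eta; exact: smooth_decay_cosM.
- move=> eta h sh; have := smooth_decayM (smooth_decay_sinM eta sh) (smooth_slow_cst (-1)).
  by under eq_fun do rewrite mulrN1 -mulNr.
- by move=> a b; rewrite mulrN opprK; exact: cos_taylor.
Qed.

Lemma has_grad_sin_transform u xi : smooth decay u ->
  has_grad (sin_transform u) xi (\row_i cos_transform (fun y => y ord0 i * u y) xi).
Proof.
move=> su; apply: (@has_grad_transform sin cos u xi su).
- by move=> eta; exact: smooth_decay_sinM.
- by move=> eta h; exact: smooth_decay_cosM.
- exact: sin_taylor.
Qed.

Lemma normr_transform_le (c : R -> R) u xi : (forall s, `|c s| <= 1) ->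
  smooth decay u -> smooth decay (fun y => c (dot y xi) * u y) ->
  `|\int[mu]_y (c (dot y xi) * u y)| <= \int[mu]_y `|u y|.
Proof.
move=> c1 su sc; have isc := smooth_decay_integrable sc.
apply: le_trans (le_normr_Rintegral measurableT isc) _; apply: le_Rintegral => //.
- exact: (integrable_norm isc).
- exact: (integrable_norm (smooth_decay_integrable su)).
by move=> y _; rewrite normrM -[leRHS]mul1r ler_wpM2r.
Qed.

(** Each factor |xi| <= sum |xi_i| is traded for one derivative of u, which exchanges the cosine and
    sine transforms; this is why their sum is estimated. *)
Lemma decay_transforms m u : smooth decay u -> exists C, forall xi,
  enorm xi ^+ m * (`|cos_transform u xi| + `|sin_transform u xi|) <= C.
Proof.
elim: m u => [|m IH] u su.
  exists (\int[mu]_y `|u y| + \int[mu]_y `|u y|) => xi; rewrite expr0 mul1r lerD //.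
    by apply: normr_transform_le => //; [exact: cos_max|exact: smooth_decay_cosM].
  by apply: normr_transform_le => //; [exact: sin_max|exact: smooth_decay_sinM].
have /choice[C hC] : forall i : 'I_n, exists C, forall xi, enorm xi ^+ m *
    (`|cos_transform ('D_(delta_mx 0 i) u) xi| + `|sin_transform ('D_(delta_mx 0 i) u) xi|) <= C.
  by move=> i; apply: IH; exact: smooth_partial.
exists (\sum_i C i) => xi; rewrite exprS.
set A := `|_| + `|_|.
apply: (@le_trans _ _ ((\sum_i `|xi ord0 i|) * (enorm xi ^+ m * A))).
  rewrite -mulrA ler_wpM2r ?enorm_le_sum // mulr_ge0 ?exprn_ge0 ?enorm_ge0 //.
  by rewrite addr_ge0.
rewrite mulr_suml; apply: ler_sum => i _; apply: le_trans (hC i xi).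
rewrite mulrCA ler_wpM2l ?exprn_ge0 ?enorm_ge0 // mulrDr -!normrM.
by rewrite coord_mul_cos_transform // coord_mul_sin_transform // normrN addrC.
Qed.

Lemma smooth_transforms u : smooth decay u ->
  smooth decay (cos_transform u) /\ smooth decay (sin_transform u).
Proof.
have dc u' : smooth decay u' -> decay (cos_transform u') /\ decay (sin_transform u').
  move=> su; split=> m; have [C hC] := decay_transforms m su; exists C => xi;
    apply: le_trans (hC xi); rewrite ler_wpM2l ?exprn_ge0 ?enorm_ge0 //.
    by rewrite lerDl.
  by rewrite lerDr.
move=> su; suff : forall (m : nat) u', smooth decay u' ->
    smooth_upto decay m (cos_transform u') /\ smooth_upto decay m (sin_transform u').
  by move=> h; split=> k; have [] := h k u su.
elim=> [|k IH] v sv; have [dcv dsv] := dc v sv.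
  split; first exact: smooth_upto0_grad (fun x => has_grad_cos_transform x sv) dcv.
  exact: smooth_upto0_grad (fun x => has_grad_sin_transform x sv) dsv.
split.
  apply: smooth_upto_grad (fun x => has_grad_cos_transform x sv) dcv _ => i.
  under eq_fun do rewrite mxE -mulrN1.
  apply: (smooth_uptoM decayD decayM); last exact: smooth_slow_cst.
  by have [] := IH _ (smooth_decay_coordM i sv).
apply: smooth_upto_grad (fun x => has_grad_sin_transform x sv) dsv _ => i.
under eq_fun do rewrite mxE.
by have [] := IH _ (smooth_decay_coordM i sv).
Qed.

End SchwartzFourier.

Section SchwartzComplex.
Context {R : realType} {n : nat}.
Local Notation V := 'rV[R]_n.
Local Notation mu := (lebesgueRn R n).
Implicit Types (u h : V -> R) (f psi : V -> R[i]) (x y v xi : V).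

Lemma schwartzP f : schwartz f <->
  smooth decay (fun x => complex.Re (f x)) /\ smooth decay (fun x => complex.Im (f x)).
Proof. by split=> -[/real_schwartzP ? /real_schwartzP ?]; split. Qed.

Lemma schwartz_meas f : schwartz f -> Cmeasurable f.
Proof. by move=> /schwartzP[hr hi]; split; exact: smooth_measurable. Qed.

Lemma schwartz_Cintegrable f : schwartz f -> Cintegrable mu f.
Proof. by move=> /schwartzP[hr hi]; split; exact: smooth_decay_integrable. Qed.

Lemma schwartz_weight f : schwartz f -> exists2 C, 0 <= C & forall x, nc (f x) <= C * weight x.
Proof.
move=> /schwartzP[hr hi].
have [C C0 hC] := decay_weight (smooth_upto_size (hr 0%N)).
have [C' C'0 hC'] := decay_weight (smooth_upto_size (hi 0%N)).
exists (C + C'); first exact: addr_ge0.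
by move=> x; apply: le_trans (normc_le _) _; rewrite mulrDl lerD.
Qed.

Lemma schwartzM f h : schwartz f -> smooth slow h -> schwartz (fun x => (h x)%:C * f x).
Proof.
move=> /schwartzP[hr hi] sh; apply/schwartzP; split.
  by under eq_fun do rewrite Re_mul /= mul0r subr0 mulrC; exact: smooth_decayM.
by under eq_fun do rewrite Im_mul /= mul0r addr0 mulrC; exact: smooth_decayM.
Qed.

Lemma schwartz_affine c v f : c != 0 -> schwartz f -> schwartz (fun x => f (c *: x + v)).
Proof.
move=> c0 /schwartzP[hr hi]; apply/schwartzP; split.
  exact: (smooth_decay_affine v c0 hr).
exact: (smooth_decay_affine v c0 hi).
Qed.

Lemma schwartz_cpxP h : smooth decay h -> schwartz (fun x => (h x)%:C).
Proof.
move=> sh; apply/schwartzP; split => //=.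
have := smooth_decayM sh (smooth_slow_cst 0).
by under eq_fun do rewrite mulr0.
Qed.

Lemma fourierE f xi : schwartz f -> fourier f xi =
  (cos_transform (fun x => complex.Re (f x)) xi + sin_transform (fun x => complex.Im (f x)) xi) +i*
  (cos_transform (fun x => complex.Im (f x)) xi - sin_transform (fun x => complex.Re (f x)) xi).
Proof.
move=> /schwartzP[hr hi]; rewrite /fourier /Cintegral /cos_transform /sin_transform.
have icr := smooth_decay_integrable (smooth_decay_cosM xi hr).
have ici := smooth_decay_integrable (smooth_decay_cosM xi hi).
have isr := smooth_decay_integrable (smooth_decay_sinM xi hr).
have isi := smooth_decay_integrable (smooth_decay_sinM xi hi).
apply: complex_eq => /=.
  rewrite -RintegralD //; apply: eq_Rintegral => x _.
  by rewrite Re_mul /= cosN sinN mulNr opprK.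
rewrite -RintegralB //; apply: eq_Rintegral => x _.
by rewrite Im_mul /= cosN sinN mulNr.
Qed.

Lemma schwartz_fourier f : schwartz f -> schwartz (fourier f).
Proof.
move=> sf; have /schwartzP[hr hi] := sf; apply/schwartzP.
have [cr sr] := smooth_transforms hr; have [ci si] := smooth_transforms hi.
split; under eq_fun do rewrite fourierE //=; first exact: smooth_decayD.
apply: smooth_decayD => //.
have := smooth_decayM sr (smooth_slow_cst (-1)).
by under eq_fun do rewrite mulrN1.
Qed.

Lemma weight_le1 x : weight x <= 1.
Proof.
rewrite /weight; apply: prodr_ile1 => i _; rewrite invr_ge0 addr_ge0 ?sqr_ge0 //=.
by rewrite invf_le1 ?lerDl ?sqr_ge0 // ltr_pwDl ?sqr_ge0.
Qed.

(** The weight is at most 1, so its p-th power is at most the weight itself. *)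
Lemma schwartz_Lp_lty (p : R) f : 1 <= p -> schwartz f ->
  (\int[mu]_x (nc (f x) `^ p)%:E < +oo)%E.
Proof.
move=> p1 sf; have [C C0 hC] := schwartz_weight sf.
have p0 : 0 < p by apply: lt_le_trans p1.
have mf := schwartz_meas sf.
have nw : nnmeas (fun x : V => (weight x)%:E).
  by apply: nnmeas_EFin; [exact: measurable_weight|move=> x; exact: weight_ge0].
apply: (@le_lt_trans _ _ (\int[mu]_x ((C `^ p)%:E * (weight x)%:E)))%E.
  apply: nn_le_integral.
  - exact: measurable_normc_powR.
  - by apply: nnmeasM => //; apply: nnmeas_cst; rewrite lee_fin powR_ge0.
  move=> x; rewrite -EFinM lee_fin.
  apply: (@le_trans _ _ ((C * weight x) `^ p)).
    by rewrite ge0_ler_powR ?nnegrE ?normc_ge0 ?(ltW p0) // mulr_ge0 // weight_ge0.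
  rewrite powRM ?weight_ge0 // ler_wpM2l ?powR_ge0 //.
  by rewrite ge1r_powR // weight_gt0 weight_le1.
rewrite nn_integralZl ?lee_fin ?powR_ge0 //.
by rewrite lte_mul_pinfty ?lee_fin ?powR_ge0 // integral_weight_lty.
Qed.

End SchwartzComplex.

(** * The Fourier transform of a Gaussian *)

Section GaussianFourier.
Context {R : realType} {n : nat}.
Local Notation V := 'rV[R]_n.
Local Notation mu := (lebesgueRn R n).
Implicit Types (u h : V -> R) (f psi : V -> R[i]) (x y v xi : V) (t : R).

Lemma expr_expRN_le (s : R) m : 0 <= s -> s ^+ m * expR (- s) <= m`!%:R.
Proof.
move=> s0; rewrite expRN ler_pdivrMr ?expR_gt0 //.
case: m => [|m]; first by rewrite expr0 mul1r -expR0 ler_expR.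
rewrite -ler_pdivrMl ?ltr0n ?fact_gt0 // mulrC.
by apply: le_trans (expR_ge1Dxn m s0); rewrite lerDr.
Qed.

Lemma smooth_decay_gaussian t : 0 < t -> smooth decay (gaussian t : V -> R).
Proof.
move=> t0; pose H (j : nat) (s : R) := (- t) ^+ j * expR (- (t * s)).
have hH j (s : R) : is_derive s 1 (H j) (H j.+1 s).
  have -> : H j.+1 s = (- t) ^+ j *: (expR (- (t * s)) *: (- (t *: (1 : R)))).
    by rewrite /H exprS /GRing.scale /=; ring.
  by apply: is_deriveZ; apply: is_derive1_comp.
suff dH j : decay (fun y : V => H j (dot y y)).
  move=> k; have := smooth_upto_comp decayD decayM hH dH smooth_slow_sqr k 0%N.
  by rewrite /H; under eq_fun do rewrite expr0 mul1r.
move=> m; exists (t ^+ j * (1 + m`!%:R / t ^+ m)) => x.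
rewrite /H normrM normrX normrN (gtr0_norm t0) (ger0_norm (expR_ge0 _)) mulrCA.
rewrite ler_wpM2l ?exprn_ge0 ?(ltW t0) //.
have d0 := dot_ge0 x.
apply: (@le_trans _ _ ((1 + dot x x ^+ m) * expR (- (t * dot x x)))).
  rewrite ler_wpM2r ?expR_ge0 // -enorm_sqr -exprM mulnC exprM.
  (* This square yields q <= 1 + q^2, which replaces |x|^m by 1 + (x.x)^m, so that only powers of
     the radial variable remain. *)
  have : 0 <= (enorm x ^+ m - 2^-1) ^+ 2 by rewrite sqr_ge0.
  have : 0 <= enorm x ^+ m by rewrite exprn_ge0 // enorm_ge0.
  set q := enorm x ^+ m; nra.
rewrite mulrDl mul1r lerD //.
  by rewrite -expR0 ler_expR oppr_le0 mulr_ge0 // ltW.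
rewrite ler_pdivlMr ?exprn_gt0 // mulrAC -exprMn mulrC (mulrC (dot x x)) mulrC.
by apply: expr_expRN_le; rewrite mulr_ge0 // ltW.
Qed.

Lemma has_grad_gaussian t x : has_grad (gaussian t) x ((- (2 * t) * gaussian t x) *: x).
Proof.
have dH : is_derive (dot x x) 1 (fun s : R => expR (- (t * s))) (- t * gaussian t x).
  rewrite /gaussian.
  have -> : - t * expR (- (t * dot x x)) = expR (- (t * dot x x)) *: (- (t *: (1 : R))).
    by rewrite /GRing.scale /=; ring.
  by apply: is_derive1_comp.
have := has_grad_comp (has_grad_sqr x) dH.
by rewrite scalerA [_ * 2]mulrC mulrA mulrN.
Qed.

Lemma grad0_cst (F : V -> R) x : (forall y, has_grad F y 0) -> F x = F 0.
Proof.
move=> gF; pose f (s : R) := F (s *: x).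
have hf (s : R) : is_derive s 1 f 0.
  have dl : is_diff s (fun s : R => s *: x) (fun s : R => s *: x) by exact: is_diff_scalel.
  have dc := is_diff_comp dl (gF (s *: x)).
  have df' : differentiable f s by case: dc.
  split; first exact/derivable1_diffP.
  by rewrite deriveE //; case: dc => _ -> /=; rewrite scale1r dotC dot0l.
have := @mvt_le _ f (fun=> 0) 0 1 hf; rewrite mul0r /f scale1r scale0r => h.
apply/eqP; rewrite -subr_eq0 -normr_le0; apply: h => s _; by rewrite normr0.
Qed.

(** The gradient of the Gaussian is - 2t y times itself. Multiplication by y and differentiation are
    exchanged by the transforms, so both transforms F satisfy grad F = - xi F / (2t), and their
    values at 0 determine them. *)
Lemma gaussian_transforms t xi : 0 < t ->
  cos_transform (gaussian t) xi = @gaussian_mass R n t * gaussian (4 * t)^-1 xi /\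
  sin_transform (gaussian t) xi = 0.
Proof.
move=> t0; have sg := smooth_decay_gaussian t0.
have tn0 : t != 0 by rewrite gt_eqF.
have pg i : 'D_(delta_mx 0 i) (gaussian t) = (fun y : V => y ord0 i * gaussian t y * (- (2 * t))).
  by apply/funext => y; rewrite (has_grad_partial i (has_grad_gaussian t y)) !mxE; ring.
have ec i eta : cos_transform (fun y => y ord0 i * gaussian t y) eta =
    - (2 * t)^-1 * (eta ord0 i * sin_transform (gaussian t) eta).
  rewrite (coord_mul_sin_transform i eta sg) pg /cos_transform.
  have i1 := smooth_decay_integrable (smooth_decay_cosM eta (smooth_decay_coordM i sg)).
  have -> : \int[mu]_y (cos (dot y eta) * (y ord0 i * gaussian t y * (- (2 * t)))) =
    \int[mu]_y (- (2 * t) * (cos (dot y eta) * (y ord0 i * gaussian t y))).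
    by apply: eq_Rintegral => y _; ring.
  by rewrite RintegralZl //; field.
have es i eta : sin_transform (fun y => y ord0 i * gaussian t y) eta =
    (2 * t)^-1 * (eta ord0 i * cos_transform (gaussian t) eta).
  rewrite (coord_mul_cos_transform i eta sg) pg /sin_transform.
  have i1 := smooth_decay_integrable (smooth_decay_sinM eta (smooth_decay_coordM i sg)).
  have -> : \int[mu]_y (sin (dot y eta) * (y ord0 i * gaussian t y * (- (2 * t)))) =
    \int[mu]_y (- (2 * t) * (sin (dot y eta) * (y ord0 i * gaussian t y))).
    by apply: eq_Rintegral => y _; ring.
  by rewrite RintegralZl //; field.
(* The negative parameter makes this exp(|xi|^2 / (4t)), the integrating factor: its product with
   either transform has zero gradient. *)
pose E : V -> R := gaussian (- (4 * t)^-1).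
have gE eta := has_grad_gaussian (- (4 * t)^-1) eta.
have EK eta : E eta * gaussian (4 * t)^-1 eta = 1.
  by rewrite /E /gaussian -expRD mulNr opprK subrr expR0.
have c0 : cos_transform (gaussian t) (0 : V) = @gaussian_mass R n t.
  rewrite /cos_transform; rewrite (@eq_Rintegral _ _ _ mu setT (gaussian t)) => [|y _]; last by rewrite dotC dot0l cos0 mul1r.
  by rewrite /Rintegral integral_gaussian.
have s0 : sin_transform (gaussian t) (0 : V) = 0.
  rewrite /sin_transform; rewrite (@eq_Rintegral _ _ _ mu setT (fun=> 0)) => [|y _]; last by rewrite dotC dot0l sin0 mul0r.
  by rewrite Rintegral_cst // mul0r.
have E0 : E 0 = 1 by rewrite /E /gaussian dot0l mulr0 oppr0 expR0.
split.
  have := @grad0_cst (fun eta => cos_transform (gaussian t) eta * E eta) xi.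
  rewrite c0 E0 mulr1 => <-; first by rewrite -mulrA EK mulr1.
  move=> y; have := has_gradM (has_grad_cos_transform y sg) (gE y).
  rewrite (_ : _ + _ = 0) //; apply/rowP => i; rewrite !mxE es; field.
  exact: tn0.
have := @grad0_cst (fun eta => sin_transform (gaussian t) eta * E eta) xi.
rewrite s0 mul0r => H; apply: (mulIf (x := E xi)).
  by rewrite gt_eqF // /E gaussian_gt0.
rewrite mul0r; apply: H.
move=> y; have := has_gradM (has_grad_sin_transform y sg) (gE y).
rewrite (_ : _ + _ = 0) //; apply/rowP => i; rewrite !mxE ec; field.
exact: tn0.
Qed.

Lemma fourier_gaussian t xi : 0 < t ->
  fourier (fun x => (gaussian t x)%:C) xi = (@gaussian_mass R n t * gaussian (4 * t)^-1 xi)%:C.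
Proof.
move=> t0; have sg := smooth_decay_gaussian t0.
rewrite fourierE; last exact: schwartz_cpxP.
have [-> ->] := gaussian_transforms xi t0 => /=.
have z (c : R -> R) : \int[mu]_y (c (dot y xi) * 0) = 0.
  rewrite (@eq_Rintegral _ _ _ mu setT (fun=> 0)) => [|y _]; last by rewrite mulr0.
  by rewrite Rintegral_cst // mul0r.
by rewrite /cos_transform /sin_transform !z addr0 subrr.
Qed.

End GaussianFourier.

(** * Fourier inversion and Plancherel *)

Section FourierL1.
Context {R : realType} {n : nat}.
Local Notation V := 'rV[R]_n.
Local Notation mu := (lebesgueRn R n).
Implicit Types (f h psi phi : V -> R[i]) (x y v xi eta : V) (t : R).

Lemma Cmeas_fourier_kernel f : Cmeasurable f ->
  Cmeasurable (fun z : V * V => expi (- dot z.2 z.1) * f z.2).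
Proof.
move=> mf; apply: CmeasM; last exact: Cmeas_comp.
by apply: Cmeas_expi; apply: measurableT_comp => //; apply: measurable_dot.
Qed.

Lemma Cmeas_fourier f : Cmeasurable f -> Cmeasurable (fourier f).
Proof.
move=> mf; exact: (@Cmeas_Cintegral _ _ V V R mu (fun xi x => expi (- dot x xi) * f x) (Cmeas_fourier_kernel mf)).
Qed.

Lemma Cintegrable_unimod (u : V -> R) f : measurable_fun setT u -> Cintegrable mu f ->
  Cintegrable mu (fun x => expi (u x) * f x).
Proof.
move=> mu' cf; have mf := Cintegrable_meas cf.
apply: (Cintegrable_dom (G := fun x => (nc (f x))%:E)).
- by apply: CmeasM => //; apply: Cmeas_expi.
- exact: nnmeas_normc.
- by move=> x; rewrite normcM normc_expi mul1r.
- exact: Cintegrable_lty.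
Qed.

Lemma Cintegrable_fourier f xi : Cintegrable mu f ->
  Cintegrable mu (fun x => expi (- dot x xi) * f x).
Proof.
move=> cf; apply: Cintegrable_unimod => //.
by apply: measurableT_comp => //; apply: measurable_dot.
Qed.

Lemma fourier_le f xi : Cintegrable mu f ->
  ((nc (fourier f xi))%:E <= \int[mu]_x (nc (f x))%:E)%E.
Proof.
move=> cf; apply: le_trans (normc_Cintegral_le (Cintegrable_fourier xi cf)) _.
by under eq_integral do rewrite normcM normc_expi mul1r.
Qed.

Lemma fourier_bound f : Cintegrable mu f -> exists2 C, 0 <= C & forall xi, nc (fourier f xi) <= C.
Proof.
move=> cf; have := Cintegrable_lty cf; have := fun xi => fourier_le xi cf.
have : (0 <= \int[mu]_x (nc (f x))%:E)%E by apply: integral_ge0 => x _; rewrite lee_fin normc_ge0.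
case: (\int[mu]_x _)%E => [r| |] //; by rewrite lee_fin => r0 h _; exists r.
Qed.

Lemma Cintegrable_bounded f h C : Cmeasurable h -> (forall x, nc (h x) <= C) ->
  Cintegrable mu f -> Cintegrable mu (fun x => f x * h x).
Proof.
move=> mh hC cf; have mf := Cintegrable_meas cf.
have C0 : 0 <= C by apply: le_trans (hC 0); exact: normc_ge0.
have nf := nnmeas_normc mf.
apply: (Cintegrable_dom (G := fun x => (C%:E * (nc (f x))%:E)%E)).
- exact: CmeasM.
- by apply: nnmeasM => //; exact: nnmeas_cst.
- by move=> x; rewrite normcM -EFinM lee_fin mulrC ler_wpM2r // normc_ge0.
- by rewrite nn_integralZl // lte_mul_pinfty // Cintegrable_lty.
Qed.

(** The multiplication formula, valid on L^1 by Fubini. Inversion, Plancherel and the convolution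
    formula are all derived from it. *)
Lemma fourier_exchange phi h : Cintegrable mu phi -> Cintegrable mu h ->
  Cintegral mu (fun xi => phi xi * fourier h xi) = Cintegral mu (fun x => fourier phi x * h x).
Proof.
move=> cp ch; have mp := Cintegrable_meas cp; have mh := Cintegrable_meas ch.
pose F xi x := phi xi * (expi (- dot x xi) * h x).
have E1 : Cintegral mu (fun xi => phi xi * fourier h xi) =
    Cintegral mu (fun xi => Cintegral mu (F xi)).
  by apply: eq_Cintegral => xi; rewrite /F CintegralZ //; exact: Cintegrable_fourier.
have E2 : Cintegral mu (fun x => fourier phi x * h x) =
    Cintegral mu (fun x => Cintegral mu (F ^~ x)).
  apply: eq_Cintegral => x; rewrite mulrC -CintegralZ; last exact: Cintegrable_fourier.
  by apply: eq_Cintegral => xi; rewrite /F dotC; ring.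
rewrite E1 E2; apply: Cintegral_fubini.
  apply: CmeasM; first exact: Cmeas_comp.
  exact: Cmeas_fourier_kernel.
have np := nnmeas_normc mp; have nh := nnmeas_normc mh.
rewrite (eq_integral (fun xi => ((\int[mu]_x (nc (h x))%:E) * (nc (phi xi))%:E)%E)); last first.
  move=> xi _; rewrite muleC -nn_integralZl ?lee_fin ?normc_ge0 //.
  by apply: eq_integral => x _; rewrite /F !normcM normc_expi mul1r EFinM.
have h0 : (0 <= \int[mu]_x (nc (h x))%:E)%E by apply: integral_ge0 => x _; exact: nh.2.
have : (\int[mu]_x (nc (h x))%:E < +oo)%E by exact: Cintegrable_lty.
move: h0; case: (\int[mu]_x _)%E => [r| |] // r0 _.
by rewrite nn_integralZl // lte_mul_pinfty // Cintegrable_lty.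
Qed.

Lemma gaussian_Cintegrable t : 0 < t -> Cintegrable mu (fun x => (gaussian t x)%:C).
Proof. by move=> t0; apply: schwartz_Cintegrable; apply: schwartz_cpxP; exact: smooth_decay_gaussian. Qed.

Lemma fourier_modulate phi x y : fourier (fun xi => expi (dot y xi) * phi xi) x = fourier phi (x - y).
Proof.
apply: eq_Cintegral => xi; rewrite mulrA -expiD; congr (expi _ * _).
by rewrite dotDr dotNr [dot xi y]dotC; ring.
Qed.

Lemma fourier_translate phi x xi : Cintegrable mu phi ->
  fourier (fun y => phi (y - x)) xi = expi (- dot x xi) * fourier phi xi.
Proof.
move=> cp; rewrite -CintegralZ; last exact: Cintegrable_fourier.
pose g y := expi (- dot (y + x) xi) * phi y.
have cg : Cintegrable mu g.
  apply: Cintegrable_unimod => //; apply: measurableT_comp => //.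
  by apply: measurable_dot => //; exact: measurable_addrV.
rewrite [RHS](_ : _ = Cintegral mu g); last first.
  by apply: eq_Cintegral => y; rewrite /g mulrA -expiD dotDl opprD [- dot x xi + _]addrC.
rewrite -(Cintegral_shift (- x) cg); apply: eq_Cintegral => y.
by rewrite /g subrK.
Qed.

(** The multiplication formula applied to a modulated Gaussian: damping the transform of h by a
    Gaussian averages h against the dual Gaussian. *)
Lemma gaussian_regularize t h y : 0 < t -> Cintegrable mu h ->
  Cintegral mu (fun xi => (gaussian t xi)%:C * (expi (dot y xi) * fourier h xi)) =
  (@gaussian_mass R n t)%:C * Cintegral mu (fun x => (gaussian (4 * t)^-1 (x - y))%:C * h x).
Proof.
move=> t0 ch; have cg := gaussian_Cintegrable t0.
have cp : Cintegrable mu (fun xi => expi (dot y xi) * (gaussian t xi)%:C).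
  by apply: Cintegrable_unimod => //; exact: measurable_dot.
rewrite (_ : Cintegral _ _ = Cintegral mu (fun xi => expi (dot y xi) * (gaussian t xi)%:C * fourier h xi)).
  rewrite fourier_exchange // -CintegralZ.
    apply: eq_Cintegral => x; rewrite fourier_modulate fourier_gaussian //.
    by rewrite rmorphM /= mulrA.
  have t4 : 0 < (4 * t)^-1 by rewrite invr_gt0 mulr_gt0.
  have cs : Cintegrable mu (fun x => (gaussian (4 * t)^-1 (x - y))%:C).
    have := Cintegrable_affine (- y) (oner_neq0 R) (gaussian_Cintegrable t4).
    by apply: eq_Cintegrable => x; rewrite scale1r.
  apply: (eq_Cintegrable (f := fun x => h x * (gaussian (4 * t)^-1 (x - y))%:C)).
    by move=> x; rewrite mulrC.
  apply: (@Cintegrable_bounded _ _ 1) => // [|x]; first exact: Cintegrable_meas cs.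
  by rewrite normcR ger0_norm ?gaussian_ge0 // gaussian_le1 // ltW.
by apply: eq_Cintegral => xi; ring.
Qed.

Lemma gaussianZ t (c : R) x : gaussian t (c *: x) = gaussian (t * c ^+ 2) x.
Proof. by rewrite /gaussian dotZl dotZr; congr expR; ring. Qed.

Lemma gaussian_mass_sqr (e : R) : 0 < e -> @gaussian_mass R n (e ^+ 2) * `|2 * e| ^+ n = (2 * Num.sqrt pi) ^+ n.
Proof.
move=> e0; rewrite /gaussian_mass sqrtrM ?pi_ge0 // sqrtrV ?sqr_ge0 // sqrtr_sqr.
rewrite -exprMn gtr0_norm // gtr0_norm ?mulr_gt0 //; congr (_ ^+ _); field.
by rewrite gt_eqF.
Qed.

Lemma gaussian_mass1 : (2 * Num.sqrt pi) ^+ n * @gaussian_mass R n 1 = (2 * pi) ^+ n.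
Proof.
by rewrite /gaussian_mass divr1 -exprMn -mulrA -expr2 sqr_sqrtr // pi_ge0.
Qed.

Lemma cvg0D (u w : nat -> R) : u @ \oo --> 0 -> w @ \oo --> 0 ->
  (fun k => u k + w k) @ \oo --> 0.
Proof. by move=> u0 w0; rewrite -(addr0 (0 : R)); apply: cvgD. Qed.

Lemma cvg0Z (c : R) (u : nat -> R) : u @ \oo --> 0 -> (fun k => c * u k) @ \oo --> 0.
Proof. by move=> u0; rewrite -(mulr0 c); exact: cvgMl_tmp. Qed.

Lemma cvg0_le (u w : nat -> R) : (forall k, 0 <= u k <= w k) -> w @ \oo --> 0 -> u @ \oo --> 0.
Proof.
by move=> h w0; apply: (squeeze_cvgr _ (cvg_cst _) w0); exact: nearW.
Qed.

Lemma cvg0B (u : nat -> R) a : u @ \oo --> a -> (fun k => `|u k - a|) @ \oo --> 0.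
Proof.
move=> ua; rewrite -(@normr0 _ R) -(subrr a); apply: cvg_norm; apply: cvgB => //.
exact: cvg_cst.
Qed.

(** Convergence in [R[i]] is always expressed by the real sequence of distances to the limit. *)
Lemma nc_cvg_unique (u : nat -> R[i]) (a b : R[i]) :
  (fun k => nc (u k - a)) @ \oo --> 0 -> (fun k => nc (u k - b)) @ \oo --> 0 -> a = b.
Proof.
move=> ua ub; apply/eqP; rewrite -subr_eq0; apply/eqP/normc0_eq0.
apply/eqP; rewrite eq_le normc_ge0 andbT; apply: (cvgr_to_ge (cvg0D ua ub)).
by apply: nearW => k /=; rewrite [X in _ <= X + _]normcB_sym; exact: normc_dist.
Qed.

Lemma schwartz_cvg f (w : nat -> V) y : schwartz f -> w @ \oo --> y ->
  (fun k => nc (f (w k) - f y)) @ \oo --> 0.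
Proof.
move=> /schwartzP[hr hi] wy.
have c1 (u : V -> R) : smooth decay u -> (fun k => `|u (w k) - u y|) @ \oo --> 0.
  move=> su; have cu := differentiable_continuous (smooth_upto_diff (su 0%N) y).
  exact: cvg0B (cvg_comp _ _ wy cu).
apply: cvg0_le (cvg0D (c1 _ hr) (c1 _ hi)) => k; rewrite normc_ge0 /=.
by apply: le_trans (normc_le _) _; rewrite Re_add Im_add Re_opp Im_opp.
Qed.

Lemma gaussian_cvg1 x : (fun k => gaussian (@harmonic R k ^+ 2) x) @ \oo --> (1 : R).
Proof.
rewrite -(@expR0 R); apply: continuous_cvg; first exact: continuous_expR.
rewrite -(@oppr0 R); apply: cvgN.
under eq_fun do rewrite mulrC expr2; apply: cvg0Z.
rewrite -(mulr0 (0 : R)); apply: cvgM; exact: cvg_harmonic.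
Qed.

Lemma normc_cvgZ (z : R[i]) (u : nat -> R[i]) (a : R[i]) :
  (fun k => nc (u k - a)) @ \oo --> 0 -> (fun k => nc (z * u k - z * a)) @ \oo --> 0.
Proof. by move=> ua; under eq_fun do rewrite -mulrBr normcM; exact: cvg0Z. Qed.

(** Damp the integral by Gaussians of parameter e^2, with e tending to 0. Dominated convergence
    gives the left-hand side, and [gaussian_regularize] turns the damped integrals into averages of
    f concentrating at y. *)
Lemma fourier_inversion f y : schwartz f ->
  Cintegral mu (fun xi => expi (dot y xi) * fourier f xi) = ((2 * pi) ^+ n)%:C * f y.
Proof.
move=> sf; have cf := schwartz_Cintegrable sf; have mf := schwartz_meas sf.
have chat := schwartz_Cintegrable (schwartz_fourier sf).
pose I k := Cintegral mu (fun xi => (gaussian (@harmonic R k ^+ 2) xi)%:C * (expi (dot y xi) * fourier f xi)).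
have h0 k : 0 < @harmonic R k by rewrite invr_gt0 ltr0n.
have nh xi : nc (expi (dot y xi) * fourier f xi) = nc (fourier f xi).
  by rewrite normcM normc_expi mul1r.
have mh : Cmeasurable (fun xi => expi (dot y xi) * fourier f xi).
  apply: CmeasM; last exact: Cmeas_fourier.
  by apply: Cmeas_expi; exact: measurable_dot.
apply: (@nc_cvg_unique I).
  apply: (Cintegral_dominated (G := fun xi => nc (fourier f xi))) => //.
  - by move=> k; apply: CmeasM => //; apply: CmeasR; exact: measurable_gaussian.
  - move=> xi; apply: cvg0_le (cvg0Z (nc (fourier f xi)) (cvg0B (gaussian_cvg1 xi))) => k.
    rewrite normc_ge0 -[X in _ - X]mul1r -mulrBl normcM nh mulrC.
    by rewrite -(rmorph1 (real_complex R)) -rmorphB normcR lexx.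
  - exact: measurable_normc (Cmeas_fourier mf).
  - move=> k xi; rewrite normcM nh normcR ger0_norm ?gaussian_ge0 // ler_piMl ?normc_ge0 //.
    by rewrite gaussian_le1 // sqr_ge0.
  - exact: Cintegrable_lty.
pose K : R[i] := ((2 * Num.sqrt pi) ^+ n)%:C.
(* The substitution x = 2 e z + y fixes the Gaussian and moves the parameter into f; the Jacobian
   together with the mass of the Gaussian gives the constant [K]. *)
pose J k := Cintegral mu (fun z => (gaussian 1 z)%:C * f ((2 * @harmonic R k) *: z + y)).
have cg := gaussian_Cintegrable (@ltr01 R).
have -> : ((2 * pi) ^+ n)%:C * f y = K * Cintegral mu (fun z => (gaussian 1 z)%:C * f y).
  rewrite (@eq_Cintegral _ _ _ _ _ (fun z => f y * (gaussian 1 z)%:C)) => [|z]; last by rewrite mulrC.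
  rewrite CintegralZ // -gaussian_mass1 rmorphM /= -/K -mulrA; congr (_ * _).
  rewrite mulrC; congr (_ * _); apply: complex_eq => /=.
    by rewrite /Rintegral integral_gaussian.
  by rewrite Rintegral_cst // mul0r.
have IJ k : I k = K * J k.
  rewrite /I /J; move: (@harmonic R k) (h0 k) => e he.
  have e2 : 0 < e ^+ 2 by rewrite exprn_gt0.
  apply: (etrans (gaussian_regularize y e2 cf)).
  have e0 : 2 * e != 0 by rewrite gt_eqF // mulr_gt0.
  have cG : Cintegrable mu (fun x => (gaussian (4 * e ^+ 2)^-1 (x - y))%:C * f x).
    apply: (eq_Cintegrable (f := fun x => f x * (gaussian (4 * e ^+ 2)^-1 (x - y))%:C)).
      by move=> x; rewrite mulrC.
    apply: (@Cintegrable_bounded _ _ 1) => // [|x].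
      apply: CmeasR; apply: (measurableT_comp (measurable_gaussian _)).
      exact: measurable_subrV.
    rewrite normcR ger0_norm ?gaussian_ge0 // gaussian_le1 // invr_ge0 mulr_ge0 //.
    by rewrite sqr_ge0.
  have -> : K = (@gaussian_mass R n (e ^+ 2))%:C * (`|2 * e| ^+ n)%:C.
    by rewrite /K -(gaussian_mass_sqr he) rmorphM.
  rewrite -mulrA; congr (_ * _).
  have H := Cintegral_affine y e0 cG.
  have E1 : (4 * e ^+ 2)^-1 * (2 * e) ^+ 2 = 1 by field; rewrite gt_eqF.
  have E2 (z : V) : (gaussian (4 * e ^+ 2)^-1 (2 * e *: z + y - y))%:C * f (2 * e *: z + y) =
      (gaussian 1 z)%:C * f (2 * e *: z + y) by rewrite addrK gaussianZ E1.
  by rewrite -{}H (eq_Cintegral _ E2).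
under eq_fun do rewrite IJ; apply: normc_cvgZ.
have [C C0 hC] := schwartz_weight sf.
apply: (Cintegral_dominated (G := fun z => C * gaussian 1 z)).
- move=> k; apply: CmeasM; first exact: Cintegrable_meas cg.
  exact: Cmeas_affine.
- by apply: CmeasM; [exact: Cintegrable_meas cg|exact: Cmeas_cst].
- move=> z.
  have cw : (fun k => (2 * @harmonic R k) *: z + y) @ \oo --> y.
    rewrite -[in X in _ --> X](add0r y); apply: cvgD; last exact: cvg_cst.
    rewrite -[in X in _ --> X](scale0r z); apply: cvgZr_tmp; exact: cvg0Z (@cvg_harmonic R).
  apply: cvg0_le (cvg0Z (gaussian 1 z) (schwartz_cvg sf cw)) => k.
  by rewrite normc_ge0 -mulrBr normcM normcR ger0_norm ?lexx // gaussian_ge0.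
- by apply: measurable_funM => //; exact: measurable_gaussian.
- move=> k z; rewrite normcM normcR ger0_norm ?gaussian_ge0 // mulrC ler_wpM2r ?gaussian_ge0 //.
  by apply: le_trans (hC _) _; rewrite ler_piMr // weight_le1.
under eq_integral do rewrite EFinM.
rewrite nn_integralZl ?lee_fin // ?integral_gaussian // ?ltry //.
by apply: nnmeas_EFin; [exact: measurable_gaussian|move=> x; exact: gaussian_ge0].
Qed.

End FourierL1.

(** * Plancherel's inequality for integrable functions *)

Section Plancherel.
Context {R : realType} {n : nat}.
Local Notation V := 'rV[R]_n.
Local Notation mu := (lebesgueRn R n).
Implicit Types (f h psi phi : V -> R[i]) (x y v xi eta : V) (t : R).

Definition cconj (z : R[i]) : R[i] := complex.Re z +i* (- complex.Im z).

Lemma cconjM z w : cconj (z * w) = cconj z * cconj w.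
Proof.
by apply: complex_eq; rewrite ?Re_mul ?Im_mul /= ?Re_mul ?Im_mul; ring.
Qed.

Lemma normc_cconj z : nc (cconj z) = nc z.
Proof. by case: z => a b; rewrite /cconj /= sqrrN. Qed.

Lemma cconj_expi (a : R) : cconj (expi a) = expi (- a).
Proof. by rewrite /cconj /expi /= cosN sinN. Qed.

Lemma cconjR (a : R) : cconj a%:C = a%:C.
Proof. by rewrite /cconj /= oppr0. Qed.

Lemma Cmeas_cconj f : Cmeasurable f -> Cmeasurable (fun x => cconj (f x)).
Proof. by move=> [mr mi]; split => //=; exact: measurableT_comp. Qed.

Lemma Cintegral_cconj f : Cintegrable mu f ->
  Cintegral mu (fun x => cconj (f x)) = cconj (Cintegral mu f).
Proof.
move=> [cr ci]; rewrite /Cintegral /cconj /=; congr (_ +i* _).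
rewrite -mulN1r -RintegralZl //; apply: eq_Rintegral => x _.
by rewrite mulN1r.
Qed.

Lemma mulc_cconj z : z * cconj z = (nc z ^+ 2)%:C.
Proof. by rewrite normc_sqr; apply: complex_eq; rewrite ?Re_mul ?Im_mul /=; ring. Qed.

Lemma gaussian_mass_dual t : 0 < t ->
  @gaussian_mass R n t * @gaussian_mass R n (4 * t)^-1 = (2 * pi) ^+ n.
Proof.
move=> t0; rewrite /gaussian_mass -exprMn -sqrtrM ?divr_ge0 ?pi_ge0 ?(ltW t0) //.
congr (_ ^+ _); rewrite invrK (_ : pi / t * _ = (2 * pi) ^+ 2); last by field; rewrite gt_eqF.
by rewrite sqrtr_sqr ger0_norm // mulr_ge0 // pi_ge0.
Qed.

Lemma nnmeas_gaussianB d (T : measurableType d) s (f g : T -> V) :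
  measurable_fun setT f -> measurable_fun setT g ->
  nnmeas (fun z => (gaussian s (f z - g z))%:E).
Proof.
move=> mf mg; apply: nnmeas_EFin; last by move=> z; exact: gaussian_ge0.
by apply: (measurableT_comp (measurable_gaussian _)); exact: measurable_subrV.
Qed.

Lemma integral_gaussianB s x : 0 < s ->
  (\int[mu]_y (gaussian s (y - x))%:E = (@gaussian_mass R n s)%:E)%E.
Proof.
move=> s0; rewrite -(integral_gaussian s0).
rewrite (@integral_shift R n (- x) (fun y => (gaussian s y)%:E)) //.
  by apply/measurable_EFinP; exact: measurable_gaussian.
by move=> y; rewrite lee_fin gaussian_ge0.
Qed.

(** By the multiplication formula the damped square of the transform equals the pairing of h with a
    Gaussian average of its conjugate, which Schur's test bounds by the L^2 norm. The right-hand
    side may be infinite: h is only assumed integrable. *)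
Lemma plancherel_gaussian t h : 0 < t -> Cintegrable mu h ->
  (\int[mu]_xi (gaussian t xi * nc (fourier h xi) ^+ 2)%:E <=
   ((2 * pi) ^+ n)%:E * \int[mu]_x (nc (h x) ^+ 2)%:E)%E.
Proof.
move=> t0 ch; have mh := Cintegrable_meas ch.
have mF := Cmeas_fourier mh; have [C C0 hC] := fourier_bound ch.
have cg := gaussian_Cintegrable t0.
pose phi xi := (gaussian t xi)%:C * cconj (fourier h xi).
have cphi : Cintegrable mu phi.
  apply: (@Cintegrable_bounded _ _ _ _ C) => //; first exact: Cmeas_cconj.
  by move=> x; rewrite normc_cconj.
have cpF : Cintegrable mu (fun xi => phi xi * fourier h xi).
  exact: (@Cintegrable_bounded _ _ _ _ C).
have E1 xi : phi xi * fourier h xi = (gaussian t xi * nc (fourier h xi) ^+ 2)%:C.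
  by rewrite /phi -mulrA [cconj _ * _]mulrC mulc_cconj -rmorphM.
have E2 : (\int[mu]_xi (gaussian t xi * nc (fourier h xi) ^+ 2)%:E =
    (complex.Re (Cintegral mu (fun x => fourier phi x * h x)))%:E)%E.
  rewrite -fourier_exchange // (_ : complex.Re (Cintegral mu _) =
    \int[mu]_xi complex.Re (phi xi * fourier h xi)) // /Rintegral fineK.
    by apply: eq_integral => xi _; rewrite E1.
  exact: integrable_fin_num cpF.1.
set s := (4 * t)^-1; have s0 : 0 < s by rewrite invr_gt0 mulr_gt0.
(* Conjugation turns the kernel of the transform of [phi] into the modulation to which
   [gaussian_regularize] applies. *)
have E3 x : fourier phi x = (@gaussian_mass R n t)%:C *
    cconj (Cintegral mu (fun z => (gaussian s (z - x))%:C * h z)).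
  rewrite -[(@gaussian_mass R n t)%:C]cconjR -cconjM -gaussian_regularize // -Cintegral_cconj.
    by apply: eq_Cintegral => xi; rewrite !cconjM cconj_expi cconjR [dot x xi]dotC mulrCA.
  apply: (@Cintegrable_bounded _ _ _ _ C) => //.
    by apply: CmeasM => //; apply: Cmeas_expi; exact: measurable_dot.
  by move=> xi; rewrite normcM normc_expi mul1r.
have nh : nnmeas (fun x => (nc (h x))%:E) := nnmeas_normc mh.
have nh2 : nnmeas (fun x => (2^-1%:E * (nc (h x) ^+ 2)%:E)%E).
  apply: nnmeasM; first exact: nnmeas_cst.
  apply: nnmeas_EFin; last by move=> x; rewrite sqr_ge0.
  by apply: measurable_funX; exact: measurable_normc.
have nG x : nnmeas (fun z : V => (gaussian s (z - x))%:E) by apply: nnmeas_gaussianB.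
have nG2 : nnmeas (fun z : V * V => (gaussian s (z.2 - z.1))%:E) by apply: nnmeas_gaussianB.
have E4 x : ((nc (fourier phi x))%:E <= (@gaussian_mass R n t)%:E *
    \int[mu]_z ((gaussian s (z - x))%:E * (nc (h z))%:E))%E.
  have m0 := ltW (@gaussian_mass_gt0 R n t t0).
  rewrite E3 normcM normcR normc_cconj ger0_norm // EFinM lee_wpmul2l ?lee_fin //.
  apply: le_trans (normc_Cintegral_le _) _.
    apply: (eq_Cintegrable (f := fun z => h z * (gaussian s (z - x))%:C)).
      by move=> z; rewrite mulrC.
    apply: (@Cintegrable_bounded _ _ _ _ 1) => // [|z].
      by apply: CmeasR; apply: (measurableT_comp (measurable_gaussian _)); exact: measurable_subrV.
    by rewrite normcR ger0_norm ?gaussian_ge0 // gaussian_le1 // ltW.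
  rewrite le_eqVlt; apply/orP; left; apply/eqP; apply: eq_integral => z _.
  by rewrite normcM normcR ger0_norm ?gaussian_ge0 // EFinM.
have cph : Cintegrable mu (fun x => fourier phi x * h x).
  have [C' _ hC'] := fourier_bound cphi.
  apply: (eq_Cintegrable (f := fun x => h x * fourier phi x)) => [x|]; first by rewrite mulrC.
  by apply: (@Cintegrable_bounded _ _ _ _ C') => //; apply: Cmeas_fourier; exact: (Cintegrable_meas cphi).
rewrite E2; apply: (@le_trans _ _ ((nc (Cintegral mu (fun x => fourier phi x * h x)))%:E)).
  by rewrite lee_fin (le_trans (ler_norm _)) // Re_le_normc.
apply: le_trans (normc_Cintegral_le cph) _.
(* [A] and [B] are the two halves of |h(x)||h(z)| <= (|h(x)|^2 + |h(z)|^2) / 2 weighted by the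
   Gaussian. As the Gaussian is even, Tonelli gives them the same double integral. *)
pose A x z := ((gaussian s (z - x))%:E * (2^-1%:E * (nc (h x) ^+ 2)%:E))%E.
pose B x z := ((gaussian s (z - x))%:E * (2^-1%:E * (nc (h z) ^+ 2)%:E))%E.
have nA : nnmeas (fun z : V * V => A z.1 z.2).
  by apply: nnmeasM => //; exact: (nnmeas_fst nh2).
have nB : nnmeas (fun z : V * V => B z.1 z.2).
  by apply: nnmeasM => //; exact: (nnmeas_snd nh2).
have nA' x : nnmeas (A x) by apply: nnmeasM => //; apply: nnmeas_cst; exact: nh2.2.
have nB' x : nnmeas (B x) by apply: nnmeasM.
have gm0 := ltW (@gaussian_mass_gt0 R n t t0).
apply: (@le_trans _ _ (\int[mu]_x ((@gaussian_mass R n t)%:E *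
    (\int[mu]_z A x z + \int[mu]_z B x z))))%E.
  have nphi : Cmeasurable (fourier phi) by apply: Cmeas_fourier; exact: (Cintegrable_meas cphi).
  apply: nn_le_integral.
  - exact: nnmeas_normc (CmeasM nphi mh).
  - apply: nnmeasM; first by apply: nnmeas_cst; rewrite lee_fin.
    by apply: nnmeasD; exact: nnmeas_integral.
  move=> x; rewrite normcM EFinM.
  apply: (@le_trans _ _ ((@gaussian_mass R n t)%:E *
    \int[mu]_z ((gaussian s (z - x))%:E * (nc (h z))%:E) * (nc (h x))%:E))%E.
    by rewrite lee_wpmul2r // lee_fin normc_ge0.
  rewrite -muleA lee_wpmul2l ?lee_fin // muleC -nn_integralZl ?normc_ge0 //; last exact: nnmeasM.
  rewrite -nn_integralD //; apply: nn_le_integral.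
  - by apply: nnmeasM; [apply: nnmeas_cst; exact: nh.2|exact: nnmeasM].
  - exact: nnmeasD.
  move=> z; rewrite /A /B -!EFinM -EFinD lee_fin -mulrDr mulrCA ler_wpM2l ?gaussian_ge0 //.
  have := sqr_ge0 (nc (h x) - nc (h z)); nra.
have IA : (\int[mu]_x \int[mu]_z A x z = (@gaussian_mass R n s)%:E *
    \int[mu]_x (2^-1%:E * (nc (h x) ^+ 2)%:E))%E.
  rewrite -nn_integralZl // ?ltW ?gaussian_mass_gt0 //; apply: eq_integral => x _.
  rewrite /A; under eq_integral do rewrite muleC -(EFinM 2^-1).
  by rewrite nn_integralZl ?integral_gaussianB // 1?muleC // mulr_ge0 // sqr_ge0.
have IB : (\int[mu]_x \int[mu]_z B x z = (@gaussian_mass R n s)%:E *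
    \int[mu]_x (2^-1%:E * (nc (h x) ^+ 2)%:E))%E.
  rewrite -IA; apply: (etrans (nn_tonelli mu mu nB)).
  apply: eq_integral => z _; apply: eq_integral => x _.
  by rewrite /A /B /gaussian -[z - x]opprB dotNl dotNr opprK.
rewrite nn_integralZl //; last by apply: nnmeasD; exact: nnmeas_integral.
rewrite nn_integralD; try exact: nnmeas_integral.
have nh2' : nnmeas (fun x => (nc (h x) ^+ 2)%:E).
  apply: nnmeas_EFin; last by move=> x; rewrite sqr_ge0.
  by apply: measurable_funX; exact: measurable_normc.
rewrite IA IB nn_integralZl // -(gaussian_mass_dual t0) -/s.
have : (0 <= \int[mu]_x (nc (h x) ^+ 2)%:E)%E by apply: integral_ge0 => x _; exact: nh2'.2.
have ms0 := @gaussian_mass_gt0 R n s s0.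
case: (\int[mu]_x (nc (h x) ^+ 2)%:E)%E => [r| |] // r0.
  by rewrite -!EFinM lee_fin; rewrite le_eqVlt; apply/orP; left; apply/eqP; field.
rewrite [X in (_ <= X)%E]gt0_muley ?leey // lte_fin mulr_gt0 //.
exact: gaussian_mass_gt0.
Qed.

Lemma gaussian_cvg_mono xi : nondecreasing_seq (fun k => gaussian (@harmonic R k ^+ 2) xi).
Proof.
move=> j k jk; rewrite /gaussian ler_expR lerN2 ler_wpM2r ?dot_ge0 //.
have h0 m : 0 < @harmonic R m by rewrite invr_gt0 ltr0n.
rewrite lerXn2r ?nnegrE ?(ltW (h0 _)) // lef_pV2 ?posrE ?ltr0n //.
by rewrite ler_nat.
Qed.

(** The damping Gaussians increase to 1, so monotone convergence applies before the transform is
    known to be square integrable. *)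
Lemma plancherel_le h : Cintegrable mu h ->
  (\int[mu]_xi (nc (fourier h xi) ^+ 2)%:E <=
   ((2 * pi) ^+ n)%:E * \int[mu]_x (nc (h x) ^+ 2)%:E)%E.
Proof.
move=> ch; have mF := Cmeas_fourier (Cintegrable_meas ch).
pose u k xi := (gaussian (@harmonic R k ^+ 2) xi * nc (fourier h xi) ^+ 2)%:E.
have h0 m : 0 < @harmonic R m by rewrite invr_gt0 ltr0n.
have mu2 k : measurable_fun setT (u k).
  apply/measurable_EFinP; apply: measurable_funM; first exact: measurable_gaussian.
  by apply: measurable_funX; exact: measurable_normc.
have u0 k x : setT x -> (0 <= u k x)%E.
  by move=> _; rewrite lee_fin mulr_ge0 ?gaussian_ge0 // sqr_ge0.
have ndu x : setT x -> nondecreasing_seq (u ^~ x).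
  by move=> _ j k jk; rewrite lee_fin ler_wpM2r ?sqr_ge0 // gaussian_cvg_mono.
have cu := @cvg_monotone_convergence _ _ _ mu setT measurableT u mu2 u0 ndu.
have E : (\int[mu]_xi (nc (fourier h xi) ^+ 2)%:E =
    \int[mu]_xi limn (u ^~ xi))%E.
  apply: eq_integral => xi _; apply/esym/cvg_lim => //.
  apply: cvg_EFin; first exact: nearW.
  rewrite -[X in _ --> X]mul1r; apply: cvgMr_tmp; exact: gaussian_cvg1.
rewrite E; apply: (cvge_to_le cu); apply: nearW => k.
by apply: plancherel_gaussian => //; rewrite exprn_gt0.
Qed.

End Plancherel.

(** * Hedberg's argument *)

Section GaussianAverage.
Context {R : realType} {n : nat}.
Local Notation V := 'rV[R]_n.
Local Notation mu := (lebesgueRn R n).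
Local Notation lam := (@lebesgue_measure R).
Implicit Types (x y : V) (F : V -> \bar R).

(** The derivative of - exp(- s r^2) in r. Integrated over r > |y| it returns exp(- s |y|^2), so a
    Gaussian is a mixture of indicators of balls. *)
Definition shell_density (s r : R) : R := 2 * s * r * expR (- (s * r ^+ 2)).

Lemma shell_density_ge0 s r : 0 <= s -> 0 <= r -> 0 <= shell_density s r.
Proof. by move=> s0 r0; rewrite !mulr_ge0 ?expR_ge0. Qed.

Lemma is_derive_shell (s r : R) :
  is_derive r 1 (fun r : R => - expR (- (s * r ^+ 2))) (shell_density s r).
Proof.
have h1 : is_derive r 1 (fun r : R => r ^+ 2) (2 * r).
  have -> : (fun r : R => r ^+ 2) = id ^+ 2 by apply/funext => y; rewrite /= !expr2.
  apply: (is_derive_eq (is_deriveX 2 (is_derive_id r 1))).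
  by rewrite /GRing.scale /= expr1 mulr1.
have h2 : is_derive r 1 (fun r : R => - (s * r ^+ 2)) (- (s * (2 * r))).
  by apply: is_deriveN; apply: (is_deriveZ s h1).
have -> : shell_density s r = - (expR (- (s * r ^+ 2)) * (- (s * (2 * r)))).
  by rewrite /shell_density; ring.
by apply: is_deriveN; apply: is_derive1_comp.
Qed.

Lemma measurable_shell s : measurable_fun setT (shell_density s).
Proof.
apply: measurable_funM; first exact: measurable_funM.
by apply: measurableT_comp => //; apply: measurableT_comp => //; apply: measurable_funM => //; exact: measurable_funX.
Qed.

Lemma layer_cake (s d : R) : 0 < s -> 0 <= d ->
  (\int[lam]_r (shell_density s r * (d < r)%R%:R)%:E = (expR (- (s * d ^+ 2)))%:E)%E.
Proof.
move=> s0 d0; pose F (r : R) := - expR (- (s * r ^+ 2)).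
have cF r : {for r, continuous F}.
  by apply: differentiable_continuous; apply/derivable1_diffP; have [] := is_derive_shell s r.
have -> : (\int[lam]_r (shell_density s r * (d < r)%R%:R)%:E =
    \int[lam]_(r in `]d, +oo[) (shell_density s r)%:E)%E.
  rewrite [RHS]integral_mkcond; apply: eq_integral => r _; rewrite /patch.
  by rewrite mem_setE in_itv /= andbT; case: ifP => _; rewrite ?mulr1 ?mulr0.
rewrite integral_itv_obnd_cbnd; last first.
  by apply/measurable_EFinP; apply: measurable_funTS; exact: measurable_shell.
rewrite (@ge0_continuous_FTC2y _ (shell_density s) F d 0) //.
- by rewrite sub0e /F -EFinN opprK.
- by move=> r dr; rewrite shell_density_ge0 ?(ltW s0) // (le_trans d0).
- apply: continuous_subspaceT => r.
  have E : shell_density s = (fun r => 2 * s * r * expR (- (s * r ^+ 2))) by [].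
  rewrite E; apply: cvgM; first by apply: cvgM; [exact: cvg_cst|exact: cvg_id].
  apply: (cvg_comp (fun r : R => - (s * r ^+ 2)) expR); last exact: continuous_expR.
  apply: cvgN; apply: cvgM; first exact: cvg_cst.
  exact: exprn_continuous.
- rewrite -(@oppr0 R); apply: cvgN.
  apply/cvgrPdist_le => e e0; near=> r.
  have r1 : 1 <= r by near: r; exact/nbhs_pinfty_ge/num_real.
  have re : (s * e)^-1 <= r by near: r; exact/nbhs_pinfty_ge/num_real.
  have r0 : 0 < r by apply: lt_le_trans r1.
  rewrite sub0r normrN ger0_norm ?expR_ge0 // expRN invf_ple ?posrE ?expR_gt0 //.
  apply: le_trans (_ : s * r ^+ 2 <= _).
    apply: (@le_trans _ _ (s * r)).
      by rewrite -(ler_pdivrMl _ _ s0) -invfM.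
    by rewrite ler_pM2l // ler_eXnr.
  by apply: le_trans (expR_ge1Dx _); rewrite lerDr.
- exact: cvg_at_right_filter (cF d).
- by move=> r _; rewrite derive1E; have [_ ->] := is_derive_shell s r.
Unshelve. all: by end_near.
Qed.

(** A Gaussian mean is a superposition of means over balls, so it is bounded by their supremum times
    the total mass. *)
Lemma gaussian_average_le s F x (M : \bar R) : 0 < s -> nnmeas F -> (0 <= M)%E ->
  (forall r, 0 < r -> (avg r F x <= M)%E) ->
  (\int[mu]_y ((gaussian s (y - x))%:E * F y) <= (@gaussian_mass R n s)%:E * M)%E.
Proof.
move=> s0 nF M0 hM; have m0 := @gaussian_mass_gt0 R n s s0.
move: M0 hM; case: M => [M| |] // M0 hM; last by rewrite gt0_muley ?leey ?lte_fin.
pose phi (r : R) (y : V) := (shell_density s r * (enorm (y - x) < r)%R%:R)%:E.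
have phi0 r y : (0 <= phi r y)%E.
  rewrite lee_fin; case: ltP => [h|_]; last by rewrite mulr0.
  by rewrite mulr1 shell_density_ge0 ?(ltW s0) // (le_trans _ (ltW h)) // enorm_ge0.
have nphi : nnmeas (fun z : measurableTypeR R * V => phi z.1 z.2).
  split; last by move=> z; exact: phi0.
  apply/measurable_EFinP; apply: measurable_funM.
    exact: (measurableT_comp (measurable_shell s)).
  apply: (measurableT_comp (f := fun b : bool => b%:R : R)) => //.
  apply: measurable_fun_ltr => //.
  by apply: measurable_enorm; exact: measurable_subrV.
have nphi1 r : nnmeas (phi r).
  split; last exact: phi0.
  apply/measurable_EFinP; apply: measurable_funM => //.
  apply: (measurableT_comp (f := fun b : bool => b%:R : R)) => //.
  apply: measurable_fun_ltr => //.
  by apply: measurable_enorm; exact: measurable_subrV.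
(* The coefficient c is the same for all G: comparing F with the constant 1 shows that the
   coefficients add up to the mass of the Gaussian, without computing that sum. For r <= 0 the ball
   is empty and c = 0. *)
have phi_avg r : exists2 c : R, 0 <= c & forall G, nnmeas G ->
    (\int[mu]_y (phi r y * G y) = c%:E * (if (0 < r)%R then avg r G x else 0))%E.
  have [r0|r0] := ltP 0 r; last first.
    exists 0 => // G nG; rewrite mule0; apply: integral0_eq => y _.
    rewrite /phi; case: ltP => [h|_]; last by rewrite mulr0 mul0e.
    by have := lt_le_trans h r0; rewrite ltNge enorm_ge0.
  have v0 := @unit_ball_vol_gt0 R n.
  have c0 : 0 <= shell_density s r * (r ^+ n * @unit_ball_vol R n).
    by rewrite mulr_ge0 ?shell_density_ge0 ?(ltW s0) ?(ltW r0) // mulr_ge0 ?exprn_ge0 ?(ltW r0) ?(ltW v0).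
  exists (shell_density s r * (r ^+ n * @unit_ball_vol R n)) => // G nG.
  have nbk : nnmeas (fun y : V => (ball_kernel r x y)%:E) by exact: nnmeas_ball_kernel.
  rewrite -nn_integralZl //; last exact: nnmeasM.
  apply: eq_integral => y _; rewrite muleA -EFinM /ball_kernel /phi; congr (_%:E * _)%E.
  rewrite -[RHS]mulrA mulVKf //.
  by rewrite mulf_neq0 ?expf_neq0 ?gt_eqF.
have n1 : nnmeas (fun _ : V => 1%E : \bar R) by exact: nnmeas_cst.
have avg1 r : 0 < r -> avg r (fun=> 1%E) x = 1%E.
  by move=> r0; rewrite /avg; under eq_integral do rewrite mule1; exact: integral_ball_kernel.
have L (G : V -> \bar R) : nnmeas G -> (\int[mu]_y ((gaussian s (y - x))%:E * G y) =
    \int[lam]_r \int[mu]_y (phi r y * G y))%E.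
  move=> nG.
  have nz : nnmeas (fun z : V * measurableTypeR R => (phi z.2 z.1 * G z.1)%E).
    apply: nnmeasM; last exact: (nnmeas_fst nG).
    by split=> [|z]; [exact: (measurableT_comp nphi.1 (measurable_fun_pair _ _))|exact: phi0].
  apply: (etrans _ (nn_tonelli mu lam nz)); apply: eq_integral => y _.
  have np : nnmeas (fun r : measurableTypeR R => phi r y).
    split => [|r]; last exact: phi0.
    exact: (measurableT_comp nphi.1 (measurable_fun_pair _ _)).
  have -> : (gaussian s (y - x))%:E = (\int[lam]_r phi r y)%E.
    by rewrite layer_cake ?enorm_ge0 // enorm_sqr.
  rewrite muleC -ge0_integralZl //; [|exact: np.1|exact: nG.2].
  by apply: eq_integral => r _; rewrite muleC.
have nI (G : V -> \bar R) : nnmeas G -> nnmeas (fun r : measurableTypeR R => \int[mu]_y (phi r y * G y))%E.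
  by move=> nG; apply: nnmeas_integral; apply: nnmeasM => //; exact: (nnmeas_snd nG).
rewrite L //; apply: (@le_trans _ _ (\int[lam]_r (M%:E * \int[mu]_y (phi r y * 1))))%E.
  apply: nn_le_integral; first exact: nI.
    by apply: nnmeasM; [exact: nnmeas_cst|exact: nI].
  move=> r; have [c c0 hc] := phi_avg r; rewrite !hc //; case: ifP => [r0|_]; last by rewrite !mule0.
  by rewrite avg1 // mule1 muleC lee_wpmul2r ?lee_fin // hM.
rewrite nn_integralZl //; last exact: nI.
rewrite -L // muleC; under eq_integral do rewrite mule1.
by rewrite integral_gaussianB.
Qed.

End GaussianAverage.

(** * Integrals over the group of dilations *)

Section Dilations.
Context {R : realType}.
Local Notation lam := (@lebesgue_measure R).
Variables (alpha nu : R).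
Hypotheses (alpha0 : 0 < alpha) (alpha_nu : alpha < nu).
Implicit Types (tau A N d : R).

Let theta := alpha / nu.

(** With s = e^tau the measure s^(alpha/2) ds / s becomes [dil tau] d tau. Dilations of space become
    translations of tau, and translation invariance produces all the exponents below. *)
Definition dil tau : R := expR (alpha / 2 * tau).
(** The smaller of two bounds on the damped transform at scale e^tau, one from the averages of h and
    one from the maximal function of its transform; [nu] stands for the dimension. *)
Definition cutoff A N tau : R := Num.min (A * expR (- (nu / 2 * tau))) N.

Let nu0 : 0 < nu. Proof. exact: lt_trans alpha_nu. Qed.

Lemma measurable_expR_lin (c : R) : measurable_fun setT (fun tau : R => expR (c * tau)).
Proof. by apply: measurableT_comp => //; exact: measurable_funM. Qed.

Lemma measurable_cutoff A N : measurable_fun setT (cutoff A N).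
Proof.
apply: measurable_minr => //; apply: measurable_funM => //.
by under eq_fun do rewrite -mulNr; exact: measurable_expR_lin.
Qed.

Lemma nnmeas_cutoff A N : 0 <= A -> 0 <= N -> nnmeas (fun tau : measurableTypeR R => (dil tau * cutoff A N tau)%:E).
Proof.
move=> A0 N0; apply: nnmeas_EFin.
  by apply: measurable_funM; [exact: measurable_expR_lin|exact: measurable_cutoff].
by move=> tau; rewrite mulr_ge0 ?expR_ge0 // le_min N0 andbT mulr_ge0 ?expR_ge0.
Qed.

Lemma dil_cutoff_lty : (\int[lam]_tau (dil tau * cutoff 1 1 tau)%:E < +oo)%E.
Proof.
(* With 4b <= alpha and 4b <= nu - alpha the integrand is at most exp(- 2b |tau|), at -oo by the
   first inequality and at +oo by the second. This is dominated by 1 / (1 + (b tau)^2), whose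
   integral is known. *)
pose b := Num.min alpha (nu - alpha) / 4.
have b0 : 0 < b by rewrite divr_gt0 // lt_min alpha0 subr_gt0.
have mf : measurable_fun setT (fun t : R => ((1 + t ^+ 2)^-1)%:E : \bar R).
  by apply/measurable_EFinP; apply: continuous_measurable_fun; exact: continuous_oneDsqrV.
have nf : nnmeas (fun t : measurableTypeR R => ((1 + t ^+ 2)^-1)%:E : \bar R).
  by split => // t; rewrite lee_fin invr_ge0 addr_ge0 // sqr_ge0.
have If : (\int[lam]_t ((1 + t ^+ 2)^-1)%:E < +oo)%E.
  rewrite ge0_symfun_integralT.
  - by rewrite -set_itvcy integral0y_oneDsqr -EFinM ltry.
  - by move=> t; rewrite invr_ge0 addr_ge0 ?sqr_ge0.
  - exact: continuous_oneDsqrV.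
  - by move=> t /=; rewrite sqrrN.
have key := integral_affine1 0 (lt0r_neq0 b0) mf (fun t => nf.2 t).
have h : (\int[lam]_tau ((1 + (b * tau + 0) ^+ 2)^-1)%:E < +oo)%E.
  move: key If; rewrite gtr0_norm //.
  have : (0 <= \int[lam]_tau ((1 + (b * tau + 0) ^+ 2)^-1)%:E)%E.
    by apply: integral_ge0 => t _; rewrite lee_fin invr_ge0 addr_ge0 // sqr_ge0.
  case: (\int[lam]_tau _)%E => [r| |] // _; rewrite ?ltry //.
  by rewrite gt0_muley ?lte_fin // => <-.
apply: le_lt_trans h; apply: nn_le_integral.
- exact: nnmeas_cutoff.
- apply: nnmeas_EFin; last by move=> t; rewrite invr_ge0 addr_ge0 // sqr_ge0.
  have := continuous_measurable_fun (@continuous_oneDsqrV R).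
  move=> /(measurableT_comp) mm; apply: mm.
  by apply: measurable_funD => //; exact: measurable_funM.
move=> tau; rewrite lee_fin addr0.
have b1 : 4 * b <= alpha by rewrite /b mulrC divfK // ge_min lexx.
have b2 : 4 * b <= nu - alpha by rewrite /b mulrC divfK // ge_min lexx orbT.
apply: (@le_trans _ _ (expR (- (2 * (b * `|tau|))))).
  have [t0|t0] := leP 0 tau.
    apply: (@le_trans _ _ (dil tau * (1 * expR (- (nu / 2 * tau))))).
      by rewrite ler_wpM2l ?expR_ge0 // ge_min lexx.
    rewrite mul1r -expRD ler_expR ger0_norm //.
    have := ler_wpM2r t0 b2; lra.
  apply: (@le_trans _ _ (dil tau * 1)).
    by rewrite ler_wpM2l ?expR_ge0 // ge_min lexx orbT.
  rewrite mulr1 ler_expR ltr0_norm //.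
  have t0' : 0 <= - tau by rewrite oppr_ge0 ltW.
  have := ler_wpM2r t0' b1; lra.
rewrite expRN lef_pV2 ?posrE ?expR_gt0 ?ltr_wpDr ?sqr_ge0 //.
have u0 : 0 <= 2 * (b * `|tau|) by rewrite mulr_ge0 // mulr_ge0 // ltW.
apply: le_trans (expR_ge1Dxn 1 u0); rewrite lerD2l exprMn [in leRHS]exprMn [in leRHS]exprMn.
rewrite real_normK ?num_real // (_ : 2`!%:R = 2) //.
have := mulr_ge0 (sqr_ge0 b) (sqr_ge0 tau); lra.
Qed.

Definition cutoff_const : R := \int[lam]_tau (dil tau * cutoff 1 1 tau).

Lemma cutoff_constE : (\int[lam]_tau (dil tau * cutoff 1 1 tau)%:E = cutoff_const%:E)%E.
Proof.
rewrite /cutoff_const /Rintegral fineK // ge0_fin_numE ?dil_cutoff_lty //.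
by apply: integral_ge0 => t _; exact: (nnmeas_cutoff ler01 ler01).2.
Qed.

Lemma cutoff_const_ge0 : 0 <= cutoff_const.
Proof. by apply: Rintegral_ge0 => t _; exact: (nnmeas_cutoff ler01 ler01).2. Qed.

Lemma integral_translate1 (b : R) (f : R -> \bar R) : nnmeas (f : measurableTypeR R -> \bar R) ->
  (\int[lam]_t f (t + b)%R = \int[lam]_t f t)%E.
Proof.
move=> [mf f0]; have := integral_affine1 b (oner_neq0 R) mf f0.
by rewrite normr1 mul1e; under eq_integral do rewrite mul1r.
Qed.

Lemma integral_dil_cutoff A N : 0 <= A -> 0 <= N ->
  (\int[lam]_tau (dil tau * cutoff A N tau)%:E =
    (cutoff_const * (A `^ theta * N `^ (1 - theta)))%:E)%E.
Proof.
move=> A0 N0.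
have th0 : theta != 0 by rewrite mulf_neq0 ?invr_eq0 ?gt_eqF.
have th1 : 1 - theta != 0 by rewrite subr_eq0 eq_sym lt_eqF // ltr_pdivrMr // mul1r.
have z : (\int[lam]_tau (0 : R)%:E = 0)%E by exact: integral0.
move: A0 N0; rewrite le_eqVlt => /predU1P[<- N0|A0].
  rewrite powR0 // mul0r mulr0; apply: (etrans _ z); apply: eq_integral => t _.
  by rewrite /cutoff mul0r min_l // mulr0.
rewrite le_eqVlt => /predU1P[<-|N0].
  rewrite (powR0 th1) mulr0 mulr0; apply: (etrans _ z); apply: eq_integral => t _.
  by rewrite /cutoff min_r ?mulr0 // mulr_ge0 ?expR_ge0 // ltW.
(* The point where the two bounds cross, A exp(- nu t0 / 2) = N. Translating by it reduces to A = N
   = 1. *)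
pose t0 := 2 / nu * (ln A - ln N).
rewrite -(integral_translate1 t0 (nnmeas_cutoff (ltW A0) (ltW N0))).
have E tau : dil (tau + t0) * cutoff A N (tau + t0) =
    (A `^ theta * N `^ (1 - theta)) * (dil tau * cutoff 1 1 tau).
  have -> : dil (tau + t0) = (A `^ theta / N `^ theta) * dil tau.
    rewrite /dil mulrDr expRD mulrC; congr (_ * _).
    rewrite /powR !gt_eqF // -expRN -expRD; congr expR; rewrite /t0 /theta; field.
    by rewrite gt_eqF.
  have -> : cutoff A N (tau + t0) = N * cutoff 1 1 tau.
    rewrite /cutoff mul1r minr_pMr ?(ltW N0) // mulr1; congr (Num.min _ _).
    rewrite -{1}(lnK A0) -{1}(lnK N0) -!expRD; congr expR; rewrite /t0; field.
    by rewrite gt_eqF.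
  have -> : N `^ (1 - theta) = N / N `^ theta.
    by rewrite powRB ?powRr1 ?(ltW N0) // (gt_eqF N0) implybT.
  by ring.
under eq_integral do rewrite E EFinM.
rewrite nn_integralZl; first by rewrite cutoff_constE -EFinM mulrC.
  exact: nnmeas_cutoff.
by rewrite mulr_ge0 ?powR_ge0.
Qed.

(** This is Gamma(alpha / 2), with its integral written in the variable tau. *)
Definition dil_const : R := \int[lam]_tau (dil tau * expR (- expR tau)).

Lemma nnmeas_dil_gauss d : nnmeas (fun tau : measurableTypeR R => (dil tau * expR (- (expR tau * d)))%:E).
Proof.
apply: nnmeas_EFin; last by move=> t; rewrite mulr_ge0 ?expR_ge0.
apply: measurable_funM; first exact: measurable_expR_lin.
apply: measurableT_comp => //; apply: measurableT_comp => //.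
exact: measurable_funM.
Qed.

(** Reduces the convergence of the Gamma integral to that of [dil_cutoff_lty]; an integer m above nu
    / 2 gives enough decay through s^m e^(-s) <= m!. *)
Lemma expRN_expR_le : exists2 C, 0 <= C & forall tau : R, expR (- expR tau) <= C * cutoff 1 1 tau.
Proof.
pose m := Num.bound (nu / 2).
have hm : nu / 2 < m%:R by apply: archi_boundP; rewrite divr_ge0 // ltW.
exists m`!%:R => // tau; rewrite /cutoff mul1r.
case: (leP (expR (- (nu / 2 * tau))) 1) => h; last first.
  rewrite mulr1 (@le_trans _ _ 1) ?ler1n ?fact_gt0 // expR_le1 oppr_le0 expR_ge0 //.
have t0 : 0 <= tau.
  by move: h; rewrite expR_le1 oppr_le0 pmulr_rge0 // divr_gt0.
have h1 := expr_expRN_le m (expR_ge0 tau).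
rewrite [X in _ <= _ * X]expRN ler_pdivlMr ?expR_gt0 //; apply: le_trans h1.
rewrite mulrC ler_wpM2r ?expR_ge0 // -expRM_natl ler_expR ler_wpM2r //.
exact: ltW.
Qed.

Lemma dil_constE : (\int[lam]_tau (dil tau * expR (- expR tau))%:E = dil_const%:E)%E.
Proof.
have nd := nnmeas_dil_gauss 1.
have E tau : dil tau * expR (- expR tau) = dil tau * expR (- (expR tau * 1)) by rewrite mulr1.
rewrite /dil_const /Rintegral fineK // ge0_fin_numE; last first.
  by apply: integral_ge0 => t _; rewrite E; exact: nd.2.
have [C C0 hC] := expRN_expR_le.
apply: (@le_lt_trans _ _ (\int[lam]_tau (C%:E * (dil tau * cutoff 1 1 tau)%:E)))%E.
  under eq_integral do rewrite E.
  apply: nn_le_integral => // [|tau].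
    by apply: nnmeasM; [exact: nnmeas_cst|exact: nnmeas_cutoff].
  by rewrite -EFinM lee_fin mulr1 mulrCA ler_wpM2l ?expR_ge0.
rewrite nn_integralZl //; last exact: nnmeas_cutoff.
by rewrite lte_mul_pinfty // dil_cutoff_lty.
Qed.

Lemma dil_const_gt0 : 0 < dil_const.
Proof.
have nd := nnmeas_dil_gauss 1.
pose c : R := expR (- expR 1).
rewrite -lte_fin -dil_constE; apply: (@lt_le_trans _ _ c%:E); first by rewrite lte_fin expR_gt0.
have -> : c%:E = (\int[lam]_tau (c%:E * (\1_(`[0%R, 1%R]%classic) tau)%:E))%E.
  rewrite nn_integralZl ?expR_ge0 //.
    by rewrite integral_indic //= setIT lebesgue_measure_itv /= lte_fin ltr01 sube0 mule1.
  by apply: nnmeas_EFin => //; exact: measurable_indic.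
apply: nn_le_integral.
- apply: nnmeasM; first by apply: nnmeas_cst; rewrite lee_fin expR_ge0.
  by apply: nnmeas_EFin => //; exact: measurable_indic.
- by move: nd; under eq_fun do rewrite mulr1.
move=> tau; rewrite -EFinM lee_fin indicE mem_setE in_itv /=.
case: (boolP (_ && _)) => [/andP[t0 t1]|_]; last by rewrite mulr0 mulr_ge0 ?expR_ge0.
rewrite mulr1 -[leLHS]mul1r ler_pM ?expR_ge0 //.
  by rewrite -expR0 ler_expR mulr_ge0 // divr_ge0 // ltW.
by rewrite ler_expR lerN2 ler_expR.
Qed.

Lemma integral_dil_gauss d : 0 < d ->
  (\int[lam]_tau (dil tau * expR (- (expR tau * d)))%:E =
    (dil_const * d `^ (- (alpha / 2)))%:E)%E.
Proof.
move=> d0; rewrite -(integral_translate1 (- ln d) (nnmeas_dil_gauss d)).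
have E tau : dil (tau - ln d) * expR (- (expR (tau - ln d) * d)) =
    d `^ (- (alpha / 2)) * (dil tau * expR (- expR tau)).
  have -> : dil (tau - ln d) = d `^ (- (alpha / 2)) * dil tau.
    by rewrite /powR gt_eqF // /dil -expRD; congr expR; ring.
  by rewrite expRD [expR (- ln d)]expRN (lnK d0) divfK ?gt_eqF // mulrA.
under eq_integral do rewrite E EFinM.
rewrite nn_integralZl ?powR_ge0 //; last by have := nnmeas_dil_gauss 1; under eq_fun do rewrite mulr1.
by rewrite dil_constE -EFinM mulrC.
Qed.

End Dilations.

Section CintegralReal.
Context {d} {T : measurableType d} {R : realType}.
Variable m : {measure set T -> \bar R}.

Lemma CintegralR (u : T -> R) : Cintegral m (fun x => (u x)%:C) = (\int[m]_x u x)%:C.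
Proof. by apply: complex_eq => //=; rewrite Rintegral_cst // mul0r. Qed.

End CintegralReal.

(** * Fourier transforms damped by a Gaussian *)

Section Damped.
Context {R : realType} {n : nat}.
Local Notation V := 'rV[R]_n.
Local Notation mu := (lebesgueRn R n).
Local Notation lam := (@lebesgue_measure R).
Implicit Types (h : V -> R[i]) (x y xi : V) (t : R).

Lemma Cintegrable_gaussianM t h : 0 <= t -> Cintegrable mu h ->
  Cintegrable mu (fun y => (gaussian t y)%:C * h y).
Proof.
move=> t0 ch; apply: (eq_Cintegrable (f := fun y => h y * (gaussian t y)%:C)).
  by move=> y; rewrite mulrC.
apply: (@Cintegrable_bounded _ _ _ _ 1) => // [|y].
  by apply: CmeasR; exact: measurable_gaussian.
by rewrite normcR ger0_norm ?gaussian_ge0 // gaussian_le1.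
Qed.

Lemma damped_le_average t h xi A : 0 < t -> Cintegrable mu h -> 0 <= A ->
  (forall r, 0 < r -> (avg r (fun y => (nc (h y))%:E) 0%R <= A%:E)%E) ->
  nc (fourier (fun y => (gaussian t y)%:C * h y) xi) <= @gaussian_mass R n t * A.
Proof.
move=> t0 ch A0 hA; rewrite -lee_fin.
apply: le_trans (fourier_le xi (Cintegrable_gaussianM (ltW t0) ch)) _.
have nh := nnmeas_normc (Cintegrable_meas ch).
rewrite EFinM; have A0' : (0 <= A%:E)%E by rewrite lee_fin.
apply: le_trans (gaussian_average_le t0 nh A0' hA).
rewrite le_eqVlt; apply/orP; left; apply/eqP; apply: eq_integral => y _.
by rewrite subr0 normcM normcR ger0_norm ?gaussian_ge0 // EFinM.
Qed.

(** Multiplying h by a Gaussian averages its transform against the dual Gaussian, of parameter 1 /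
    (4t); after normalization [gaussian_average_le] applies. *)
Lemma damped_le_hl_max t h xi : 0 < t -> Cintegrable mu h ->
  ((nc (fourier (fun y => (gaussian t y)%:C * h y) xi))%:E <=
   hl_max (fun eta => (nc (fourier h eta))%:E) xi)%E.
Proof.
move=> t0 ch; pose s := (4 * t)^-1; have s0 : 0 < s by rewrite invr_gt0 mulr_gt0.
have mF := Cmeas_fourier (Cintegrable_meas ch).
have nF := nnmeas_normc mF.
have cg := gaussian_Cintegrable s0.
pose phi eta := (gaussian s (eta - xi))%:C : R[i].
have cphi : Cintegrable mu phi.
  have := Cintegrable_affine (- xi) (oner_neq0 R) (cg n).
  by apply: eq_Cintegrable => x; rewrite scale1r.
have [C C0 hC] := fourier_bound ch.
have cpF : Cintegrable mu (fun eta => phi eta * fourier h eta) by exact: (Cintegrable_bounded mF hC).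
have E : Cintegral mu (fun eta => phi eta * fourier h eta) =
    (@gaussian_mass R n s)%:C * fourier (fun y => (gaussian t y)%:C * h y) xi.
  rewrite (fourier_exchange cphi ch) -CintegralZ; last first.
    by apply: Cintegrable_fourier; exact: Cintegrable_gaussianM (ltW t0) ch.
  apply: eq_Cintegral => y.
  rewrite (fourier_translate _ _ (cg n)) (fourier_gaussian y s0).
  have -> : (4 * s)^-1 = t by rewrite /s; field; rewrite gt_eqF.
  by rewrite rmorphM /= [dot xi y]dotC; ring.
have ms0 := @gaussian_mass_gt0 R n s s0.
have : ((@gaussian_mass R n s)%:E * (nc (fourier (fun y => (gaussian t y)%:C * h y) xi))%:E <=
    (@gaussian_mass R n s)%:E * hl_max (fun eta => (nc (fourier h eta))%:E) xi)%E.
  rewrite -EFinM -{1}(gtr0_norm ms0) -normcR -normcM -E.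
  apply: le_trans (normc_Cintegral_le cpF) _.
  have := @gaussian_average_le _ _ s _ xi _ s0 nF ((nnmeas_hl_max nF).2 xi)
    (fun r r0 => avg_le_hl_max xi r0 nF).
  apply: le_trans; rewrite le_eqVlt; apply/orP; left; apply/eqP; apply: eq_integral => y _.
  by rewrite normcM normcR ger0_norm ?gaussian_ge0 // EFinM.
by rewrite lee_pmul2l // lte_fin.
Qed.

Lemma gaussian_mass_expR tau : @gaussian_mass R n (expR tau) =
  Num.sqrt pi ^+ n * expR (- (n%:R / 2 * tau)).
Proof.
rewrite /gaussian_mass -expRN sqrtrM ?pi_ge0 // exprMn; congr (_ * _).
have -> : expR (- tau) = expR (- tau / 2) ^+ 2.
  by rewrite -expRM_natl; congr expR; field.
by rewrite sqrtr_sqr ger0_norm ?expR_ge0 // -expRM_natl; congr expR; field.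
Qed.

End Damped.

(** * The Hedberg estimate *)

Section Hedberg.
Context {R : realType} {n : nat}.
Local Notation V := 'rV[R]_n.
Local Notation mu := (lebesgueRn R n).
Local Notation lam := (@lebesgue_measure R).
Variable alpha : R.
Implicit Types (h : V -> R[i]) (x y xi : V) (t : R).

(** At the origin [powR] returns 0 if alpha is nonzero and 1 if alpha = 0, whereas the superposition
    of Gaussians diverges there. The condition [h 0 = 0] below makes the two sides agree at that
    point. *)
Definition riesz y : R := enorm y `^ (- alpha).

Lemma riesz_ge0 y : 0 <= riesz y. Proof. exact: powR_ge0. Qed.

Lemma rieszE y : riesz y = dot y y `^ (- (alpha / 2)).
Proof.
by rewrite -enorm_sqr -powR_mulrn ?enorm_ge0 // -powRrM /riesz; congr (_ `^ _); field.
Qed.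

Lemma measurable_riesz : measurable_fun setT riesz.
Proof. by apply: (measurableT_comp (measurable_powR _)); exact: measurable_enorm. Qed.

Hypothesis halpha : 0 < alpha < n%:R.

Let a0 : 0 < alpha. Proof. by case/andP: halpha. Qed.
Let an : alpha < n%:R. Proof. by case/andP: halpha. Qed.

Definition riesz_const : R := (dil_const alpha)^-1 * cutoff_const alpha n%:R.

(** Fubini exchanges the superposition with the Fourier integral, and [integral_dil_cutoff]
    evaluates the minimum of the two bounds. The alternative A = 0 yields the bound 0 even where the
    maximal function of the transform is infinite. *)
Lemma riesz_fourier_le h xi (A N : R) : Cintegrable mu h ->
  Cintegrable mu (fun y => (riesz y)%:C * h y) -> h 0 = 0 -> 0 <= A -> 0 <= N ->
  (forall r, 0 < r -> (avg r (fun y => (nc (h y))%:E) 0%R <= A%:E)%E) ->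
  (A = 0 \/ (hl_max (fun eta => (nc (fourier h eta))%:E) xi <= N%:E)%E) ->
  nc (fourier (fun y => (riesz y)%:C * h y) xi) <=
    riesz_const * ((Num.sqrt pi ^+ n * A) `^ (alpha / n%:R) * N `^ (1 - alpha / n%:R)).
Proof.
move=> ch cw h0 A0 N0 hA hN.
have mh := Cintegrable_meas ch.
have d0 : 0 < dil_const alpha by exact: dil_const_gt0 an.
set B := Num.sqrt pi ^+ n * A.
have B0 : 0 <= B by rewrite mulr_ge0 // exprn_ge0 // sqrtr_ge0.
pose F y tau := (dil alpha tau * gaussian (expR tau) y)%:C * (expi (- dot y xi) * h y).
have mF : Cmeasurable (fun z : V * measurableTypeR R => F z.1 z.2).
  apply: CmeasM.
    apply: CmeasR; apply: measurable_funM.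
      by apply: (measurableT_comp (measurable_expR_lin _)).
    apply: measurableT_comp => //; apply: measurableT_comp => //.
    apply: measurable_funM; first exact: measurableT_comp.
    exact: measurable_dot.
  apply: CmeasM; last exact: Cmeas_comp.
  apply: Cmeas_expi; apply: measurableT_comp => //.
  by apply: measurable_dot.
have ncF y tau : nc (F y tau) = dil alpha tau * gaussian (expR tau) y * nc (h y).
  by rewrite /F !normcM normc_expi mul1r normcR ger0_norm // mulr_ge0 ?expR_ge0.
have ng y : nnmeas (fun tau : measurableTypeR R => (dil alpha tau * gaussian (expR tau) y)%:E).
  exact: nnmeas_dil_gauss.
have Ig y : y != 0 -> (\int[lam]_tau (dil alpha tau * gaussian (expR tau) y)%:E =
    (dil_const alpha * riesz y)%:E)%E.
  move=> y0; rewrite (integral_dil_gauss a0 an) ?rieszE // lt_neqAle dot_ge0 andbT eq_sym.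
  by apply: contraNneq y0 => /dot_eq0 ->.
have Iy y : (\int[lam]_tau (nc (F y tau))%:E = (dil_const alpha)%:E * (nc ((riesz y)%:C * h y))%:E)%E.
  under eq_integral do rewrite ncF mulrC EFinM.
  rewrite nn_integralZl ?normc_ge0 //.
  have [->|y0] := eqVneq y 0; first by rewrite h0 mulr0 normc0 mul0e mule0.
  rewrite Ig // -!EFinM normcM normcR ger0_norm ?riesz_ge0 //; congr _%:E; ring.
have nw := nnmeas_normc (Cintegrable_meas cw).
have fin : (\int[mu]_y \int[lam]_tau (nc (F y tau))%:E < +oo)%E.
  under eq_integral do rewrite Iy.
  by rewrite nn_integralZl ?(ltW d0) // lte_mul_pinfty ?lee_fin ?(ltW d0) // Cintegrable_lty.
have E1 : (dil_const alpha)%:C * fourier (fun y => (riesz y)%:C * h y) xi =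
    Cintegral mu (fun y => Cintegral lam (F y)).
  rewrite -CintegralZ; last exact: Cintegrable_fourier.
  apply: eq_Cintegral => y.
  have [->|y0] := eqVneq y 0.
    by rewrite h0 !mulr0 /F; under [RHS]eq_Cintegral do rewrite h0 !mulr0; rewrite CintegralR Rintegral_cst // mul0r.
  have cg : Cintegrable lam (fun tau => (dil alpha tau * gaussian (expR tau) y)%:C).
    apply: (Cintegrable_dom _ (ng y)).
    - by apply: CmeasR; apply/measurable_EFinP; exact: (ng y).1.
    - by move=> tau; rewrite normcR ger0_norm // -lee_fin; exact: (ng y).2.
    - by rewrite Ig // ltry.
  transitivity (Cintegral lam (fun tau => expi (- dot y xi) * h y *
    (dil alpha tau * gaussian (expR tau) y)%:C)); last first.
    by apply: eq_Cintegral => tau; rewrite /F mulrC.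
  rewrite (CintegralZ _ cg) CintegralR /Rintegral Ig // [fine _]/= rmorphM; ring.
have E2 tau : Cintegral mu (F ^~ tau) =
    (dil alpha tau)%:C * fourier (fun y => (gaussian (expR tau) y)%:C * h y) xi.
  rewrite -CintegralZ; last first.
    by apply: Cintegrable_fourier; apply: Cintegrable_gaussianM; rewrite ?expR_ge0.
  by apply: eq_Cintegral => y; rewrite /F rmorphM /=; ring.
have E3 := Cintegral_fubini mF fin.
have bound tau : nc (Cintegral mu (F ^~ tau)) <= dil alpha tau * cutoff n%:R B N tau.
  rewrite E2 normcM normcR ger0_norm ?expR_ge0 // ler_wpM2l ?expR_ge0 //.
  have b1 := damped_le_average xi (expR_gt0 tau) ch A0 hA.
  rewrite /cutoff le_min; apply/andP; split.
    by apply: le_trans b1 _; rewrite gaussian_mass_expR /B mulrAC.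
  case: hN => [hA0|hN].
    by apply: le_trans b1 _; rewrite hA0 mulr0.
  by rewrite -lee_fin (le_trans (damped_le_hl_max xi (expR_gt0 tau) ch)).
have nB := nnmeas_cutoff alpha n%:R B0 N0.
have Ib := integral_dil_cutoff a0 an B0 N0.
have mT : Cmeasurable (fun tau : measurableTypeR R => Cintegral mu (F ^~ tau)).
  apply: (@Cmeas_Cintegral _ _ (measurableTypeR R) V R mu (fun tau y => F y tau)).
  exact: (Cmeas_comp (f := fun z : V * measurableTypeR R => F z.1 z.2) (h := fun z => (z.2, z.1)) mF (measurable_fun_pair measurable_snd measurable_fst)).
have cT : Cintegrable lam (fun tau => Cintegral mu (F ^~ tau)).
  apply: (Cintegrable_dom mT nB) => [tau|]; first by rewrite lee_fin.
  by rewrite Ib ltry.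
rewrite /riesz_const -mulrA ler_pdivlMl // -{1}(gtr0_norm d0) -normcR -normcM E1 E3.
rewrite -lee_fin; apply: le_trans (normc_Cintegral_le cT) _.
rewrite -Ib; apply: nn_le_integral => //; exact: nnmeas_normc.
Qed.

End Hedberg.

Section HedbergLq.
Context {R : realType} {n : nat}.
Local Notation V := 'rV[R]_n.
Local Notation mu := (lebesgueRn R n).
Implicit Types (h : V -> R[i]) (alpha A : R).

Lemma riesz_fourier_Lq alpha : 0 <= alpha < n%:R -> exists2 C, 0 < C & forall h A,
  Cintegrable mu h -> Cintegrable mu (fun y => (riesz alpha y)%:C * h y) -> h 0 = 0 -> 0 <= A ->
  (forall r, 0 < r -> (avg r (fun y => (nc (h y))%:E) 0%R <= A%:E)%E) ->
  (\int[mu]_xi (nc (fourier (fun y => (riesz alpha y)%:C * h y) xi) `^ (2 * n%:R / (n%:R - alpha)))%:E <=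
   (C * A `^ (alpha / n%:R * (2 * n%:R / (n%:R - alpha))))%:E * \int[mu]_y (nc (h y) ^+ 2)%:E)%E.
Proof.
move=> /andP[a0 an]; have n0 : 0 < n%:R :> R by exact: le_lt_trans an.
set q := 2 * n%:R / (n%:R - alpha); set th := alpha / n%:R.
have na0 : 0 < n%:R - alpha by rewrite subr_gt0.
have q0 : 0 < q by rewrite divr_gt0 // mulr_gt0.
have p2 : 0 < (2 * pi) ^+ n :> R by rewrite exprn_gt0 // mulr_gt0 // pi_gt0.
move: a0; rewrite le_eqVlt => /predU1P[a0|a0].
  exists ((2 * pi) ^+ n) => // h A ch _ _ A0 _.
  have -> : q = 2%:R by rewrite /q -a0 subr0 mulfK // gt_eqF.
  have -> : (fun y => (riesz alpha y)%:C * h y) = h.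
    by apply/funext => y; rewrite /riesz -a0 oppr0 powRr0 mul1r.
  rewrite /th -a0 mul0r mul0r powRr0 mulr1.
  under eq_integral do rewrite powR_mulrn ?normc_ge0 //.
  exact: plancherel_le.
have halpha : 0 < alpha < n%:R by rewrite a0.
pose D := @riesz_const R n alpha + 1.
have rc0 : 0 <= @riesz_const R n alpha.
  rewrite mulr_ge0 ?invr_ge0 ?(ltW (dil_const_gt0 a0 an)) //.
  exact: (cutoff_const_ge0 alpha n%:R).
have D0 : 0 < D by rewrite ltr_wpDl.
pose P : R := Num.sqrt pi ^+ n.
have P0 : 0 < P by rewrite exprn_gt0 // sqrtr_gt0 pi_gt0.
pose H : R := 2 ^+ n * 2 ^+ n * @maximal_const R n.
have H0 : 0 < H by rewrite mulr_gt0 ?mulr_gt0 ?exprn_gt0 // addr_gt0 // exprn_gt0.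
have thq : (1 - th) * q = 2%:R.
  by rewrite /th /q; field; rewrite !gt_eqF.
exists (D `^ q * P `^ (th * q) * H * (2 * pi) ^+ n).
  by rewrite mulr_gt0 // mulr_gt0 // mulr_gt0 // powR_gt0.
move=> h A ch cw h0 A0 hA.
have mF := Cmeas_fourier (Cintegrable_meas ch); have nF := nnmeas_normc mF.
have nN := nnmeas_hl_max nF; set N := hl_max _ in nN.
have mw := Cmeas_fourier (Cintegrable_meas cw).
have th0 : th != 0 by rewrite mulf_neq0 ?invr_eq0 ?gt_eqF.
have key xi : ((nc (fourier (fun y => (riesz alpha y)%:C * h y) xi) `^ q)%:E <=
    (D `^ q * (P * A) `^ (th * q))%:E * (N xi * N xi))%E.
  set W := nc _.
  have rl N' : 0 <= N' -> (A = 0 \/ (N xi <= N'%:E)%E) ->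
      W `^ q <= D `^ q * (P * A) `^ (th * q) * (N' * N').
    move=> N'0 hN; have PA : 0 <= P * A by rewrite mulr_ge0 // ltW.
    have h1 := riesz_fourier_le halpha ch cw h0 A0 N'0 hA hN.
    have h2 : W <= D * ((P * A) `^ th * N' `^ (1 - th)).
      apply: le_trans h1 _; rewrite ler_wpM2r ?mulr_ge0 ?powR_ge0 //.
      by rewrite /D lerDl.
    apply: le_trans (ge0_ler_powR (ltW q0) _ _ h2) _.
    - exact: normc_ge0.
    - by rewrite nnegrE mulr_ge0 ?(ltW D0) // mulr_ge0 ?powR_ge0.
    rewrite powRM ?(ltW D0) ?mulr_ge0 ?powR_ge0 // powRM ?powR_ge0 // -!powRrM thq.
    by rewrite powR_mulrn // mulrA -expr2.
  (* If A = 0 the right-hand side is 0 even where [N xi] is infinite, by the convention 0 * oo = 0.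
     The transform has to vanish there, which the choice N' = 0 gives. *)
  have [A00|An0] := eqVneq A 0.
    apply: (@le_trans _ _ 0%E); last first.
      apply: mule_ge0; last by apply: mule_ge0; exact: nN.2.
      by rewrite lee_fin mulr_ge0 ?powR_ge0.
    by rewrite lee_fin (le_trans (rl 0 (lexx _) (or_introl A00))) // !mulr0.
  have PA : 0 < P * A by rewrite mulr_gt0 // lt_def An0.
  have := nN.2 xi; case E : (N xi) => [r| |] // r0.
    rewrite -!EFinM lee_fin; apply: rl; first by rewrite -lee_fin.
    by right; rewrite E.
  by rewrite mulyy gt0_muley ?leey // lte_fin mulr_gt0 // powR_gt0.
have nh2 : nnmeas (fun y => (nc (h y) ^+ 2)%:E).
  apply: nnmeas_EFin; last by move=> x; rewrite sqr_ge0.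
  by apply: measurable_funX; apply: measurable_normc; exact: (Cintegrable_meas ch).
apply: (@le_trans _ _ (\int[mu]_xi ((D `^ q * (P * A) `^ (th * q))%:E * (N xi * N xi))))%E.
  apply: nn_le_integral => //; first exact: measurable_normc_powR.
  apply: nnmeasM; last exact: nnmeasM.
  by apply: nnmeas_cst; rewrite lee_fin mulr_ge0 ?powR_ge0.
have DP0 : 0 <= D `^ q * (P * A) `^ (th * q) by rewrite mulr_ge0 ?powR_ge0.
rewrite nn_integralZl //; last exact: nnmeasM.
rewrite powRM // ?(ltW P0) //.
have -> : ((D `^ q * P `^ (th * q) * H * (2 * pi) ^+ n * A `^ (th * q))%:E * \int[mu]_y (nc (h y) ^+ 2)%:E =
  (D `^ q * (P `^ (th * q) * A `^ (th * q)))%:E * (H%:E * (((2 * pi) ^+ n)%:E * \int[mu]_y (nc (h y) ^+ 2)%:E)))%E.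
  by rewrite !muleA -!EFinM; congr (_%:E * _)%E; ring.
apply: lee_wpmul2l; first by rewrite lee_fin mulr_ge0 ?powR_ge0 // mulr_ge0 ?powR_ge0.
apply: le_trans (integral_hl_max_sq nF) _; apply: lee_wpmul2l; first by rewrite lee_fin ltW.
apply: le_trans (plancherel_le ch).
by rewrite le_eqVlt; apply/orP; left; apply/eqP; apply: eq_integral => xi _; rewrite -EFinM expr2.
Qed.

End HedbergLq.

(** * Flat cutoffs *)

Section FlatFunctions.
Context {R : realType}.
Implicit Types (b c s : R) (j k m : nat).

(** For s > 0 this is s^(-b) e^(-js) exp(- e^(-s) / s), written as a single exponential. The linear
    combinations of these functions are closed under differentiation, all with b >= 0 are bounded,
    and b = j = 0 is the cutoff itself. *)
Definition flat b j s : R :=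
  if 0 < s then expR (- (b * ln s) - j%:R * s - expR (- s - ln s)) else 0.

Lemma flat_ge0 b j s : 0 <= flat b j s.
Proof. by rewrite /flat; case: ifP => // _; exact: expR_ge0. Qed.

Lemma flat_le0 b j s : s <= 0 -> flat b j s = 0.
Proof. by move=> s0; rewrite /flat ltNge s0. Qed.

Lemma flat_shift b j s m : 0 < s -> flat b j s = s ^+ m * flat (b + m%:R) j s.
Proof.
move=> s0; have -> : s ^+ m = expR (m%:R * ln s) by rewrite expRM_natl lnK.
by rewrite /flat s0 -expRD; congr expR; ring.
Qed.

Lemma flat_decay b j s : flat b j s = expR (- (j%:R * s)) * flat b 0 s.
Proof.
rewrite /flat; case: ifP => // _; last by rewrite mulr0.
by rewrite -expRD; congr expR; ring.
Qed.

Lemma flat_bounded b : 0 <= b -> exists2 K, 0 <= K & forall s, flat b 0 s <= K.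
Proof.
move=> b0; pose m := Num.bound b.
have bm : b < m%:R by apply: archi_boundP.
exists (1 + expR 1 ^+ m * m`!%:R); first by rewrite addr_ge0 // mulr_ge0 ?exprn_ge0 ?expR_ge0.
move=> s; rewrite /flat; case: ltP => s0; last by rewrite addr_ge0 // mulr_ge0 ?exprn_ge0 ?expR_ge0.
rewrite mul0r subr0.
have [s1|s1] := leP 1 s.
  apply: (@le_trans _ _ 1); last by rewrite lerDl mulr_ge0 ?exprn_ge0 ?expR_ge0.
  rewrite -expR0 ler_expR; have := ln_ge0 s1; have := expR_ge0 (- s - ln s).
  move=> h1 h2; have := mulr_ge0 b0 h2; lra.
apply: (@le_trans _ _ (expR 1 ^+ m * m`!%:R)); last by rewrite lerDr.
have l0 : ln s <= 0 by rewrite ln_le0 // ltW.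
(* Here u = 1 / (e s), so s^(-m) = e^m u^m, while e^(-s) / s >= u for s <= 1. The singular power is
   thus controlled by u^m e^(-u) <= m!. *)
pose u := expR (- 1 - ln s).
have h1 : u <= expR (- s - ln s) by rewrite ler_expR lerD2r lerN2 ltW.
have h2 := expr_expRN_le m (expR_ge0 (- 1 - ln s)).
apply: (@le_trans _ _ (expR 1 ^+ m * (u ^+ m * expR (- u)))).
  rewrite -!expRM_natl -!expRD ler_expR.
  have := ler_wnM2r l0 (ltW bm); move: h1; rewrite /u; lra.
by rewrite ler_wpM2l // exprn_ge0 // expR_ge0.
Qed.

Lemma is_derive_flat b j s : 0 <= b -> is_derive s 1 (flat b j)
  (- b * flat (b + 1) j s + - j%:R * flat b j s + flat (b + 1) j.+1 s + flat (b + 2) j.+1 s).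
Proof.
move=> b0; have [s0|s0] := leP s 0.
  rewrite !flat_le0 // !mulr0 !addr0.
  have [K K0 hK] := flat_bounded (addr_ge0 b0 (ler0n R 2)).
  (* For s <= 0 the function vanishes at s and is at most K v^2 at s + v, since two powers of the
     variable can be extracted by [flat_shift] when s + v > 0. Hence the derivative is 0. *)
  have hd : is_diff s (flat b j) (fun=> 0 : R).
    apply: (@is_diff_le_sqr R R R (flat b j) \0 s K) => [v|v /=].
      exact: cst_continuous.
    rewrite (flat_le0 _ _ s0) add0r subr0 ger0_norm ?flat_ge0 //.
    have [v0|v0] := leP (v + s) 0.
      by rewrite flat_le0 // mulr_ge0 // exprn_ge0.
    rewrite (flat_shift b j 2 v0) mulrC ler_pM ?flat_ge0 ?sqr_ge0 //.
      rewrite flat_decay -[leRHS]mul1r ler_pM ?expR_ge0 ?flat_ge0 // -expR0 ler_expR.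
      by rewrite oppr_le0 mulr_ge0 // ltW.
    by rewrite real_normK ?num_real // ler_sqr ?nnegrE ?(ltW v0) //; lra.
  have df : differentiable (flat b j) s by case: hd.
  split; first exact/derivable1_diffP.
  by rewrite deriveE //; case: hd => _ ->.
pose phi (s : R) := - (b * ln s) - j%:R * s - expR (- s - ln s).
have hl := is_derive1_ln s0.
have h1 : is_derive s 1 (fun s : R => - (b * ln s) - j%:R * s) (- (b * s^-1) - j%:R * 1).
  have ha := is_deriveN (is_deriveZ b hl).
  exact: (is_deriveB ha (is_deriveZ j%:R (is_derive_id s 1))).
have h2 : is_derive s 1 (fun s : R => - s - ln s) (- 1 - s^-1).
  exact: (is_deriveB (is_deriveN (is_derive_id s 1)) hl).
have h3 : is_derive s 1 (fun s : R => expR (- s - ln s)) (expR (- s - ln s) * (- 1 - s^-1)).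
  exact: is_derive1_comp.
have h4 : is_derive s 1 phi (- (b * s^-1) - j%:R * 1 - expR (- s - ln s) * (- 1 - s^-1)).
  exact: is_deriveB.
have h5 : is_derive s 1 (fun s => expR (phi s)) (expR (phi s) *
    (- (b * s^-1) - j%:R * 1 - expR (- s - ln s) * (- 1 - s^-1))).
  exact: is_derive1_comp.
apply: (@near_eq_is_derive _ _ _ (fun s => expR (phi s))).
  near=> t; rewrite /flat ifT //; near: t; exact: lt_nbhsr.
apply: (is_derive_eq h5).
have sV : s^-1 = expR (- ln s) by rewrite expRN (lnK s0).
rewrite /flat s0.
have -> : expR (- ((b + 1) * ln s) - j%:R * s - expR (- s - ln s)) = expR (phi s) * s^-1.
  by rewrite sV -expRD; congr expR; rewrite /phi; ring.
have -> : expR (- ((b + 1) * ln s) - j.+1%:R * s - expR (- s - ln s)) = expR (phi s) * expR (- s - ln s).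
  by rewrite -expRD; congr expR; rewrite /phi -addn1 natrD; ring.
have -> : expR (- ((b + 2) * ln s) - j.+1%:R * s - expR (- s - ln s)) = expR (phi s) * expR (- s - ln s) * s^-1.
  by rewrite sV -!expRD; congr expR; rewrite /phi -addn1 natrD; ring.
rewrite -/(phi s); ring.
Unshelve. all: by end_near.
Qed.

(** A triple (c, b, j) stands for the term c * flat b j. With this encoding derivatives of every
    order are computed on lists. *)
Definition flat_sum (l : seq (R * R * nat)) s : R :=
  \sum_(t <- l) t.1.1 * flat t.1.2 t.2 s.

(** The formal derivative: the four terms are those of [is_derive_flat]. It preserves b >= 0, hence
    boundedness, and j > 0, hence exponential decay. *)
Definition flat_step (l : seq (R * R * nat)) : seq (R * R * nat) :=
  flatten [seq [:: (- (t.1.1 * t.1.2), t.1.2 + 1, t.2); (- (t.1.1 * t.2%:R), t.1.2, t.2);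
                   (t.1.1, t.1.2 + 1, t.2.+1); (t.1.1, t.1.2 + 2, t.2.+1)] | t <- l].

Lemma flat_sum_nil : flat_sum [::] = fun=> 0.
Proof. by apply/funext => s; rewrite /flat_sum big_nil. Qed.

Lemma flat_sum_cons c b j l : flat_sum ((c, b, j) :: l) = fun s => c * flat b j s + flat_sum l s.
Proof. by apply/funext => s; rewrite /flat_sum big_cons. Qed.

Lemma flat_step_cons c b j l : flat_step ((c, b, j) :: l) =
  [:: (- (c * b), b + 1, j), (- (c * j%:R), b, j), (c, b + 1, j.+1), (c, b + 2, j.+1) & flat_step l].
Proof. by []. Qed.

Lemma is_derive_flat_sum l s : all (fun t => 0 <= t.1.2) l ->
  is_derive s 1 (flat_sum l) (flat_sum (flat_step l) s).
Proof.
elim: l => [_|[[c b] j] l IH /andP[b0 /IH hl]].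
  by rewrite flat_sum_nil; exact: is_derive_cst.
have {}b0 : 0 <= b := b0.
have H := is_deriveD (is_deriveZ c (is_derive_flat j s b0)) hl.
rewrite flat_step_cons !flat_sum_cons; apply: (is_derive_eq H).
have -> (x y : R) : x *: y = x * y by [].
ring.
Qed.

Lemma flat_step_ge0 l : all (fun t => 0 <= t.1.2) l -> all (fun t => 0 <= t.1.2) (flat_step l).
Proof.
elim: l => // -[[c b] j] l IH /andP[b0 /IH hl]; have {}b0 : 0 <= b := b0.
by rewrite flat_step_cons /= hl b0 !addr_ge0.
Qed.

Lemma flat_step_gt0 l : all (fun t => (0 < t.2)%N) l -> all (fun t => (0 < t.2)%N) (flat_step l).
Proof.
elim: l => // -[[c b] j] l IH /andP[j0 /IH hl]; have {}j0 : (0 < j)%N := j0.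
by rewrite flat_step_cons /= hl j0.
Qed.

Lemma flat_sum_bounded l : all (fun t => 0 <= t.1.2) l ->
  exists2 K, 0 <= K & forall s, `|flat_sum l s| <= K.
Proof.
elim: l => [_|[[c b] j] l IH /= /andP[b0 /IH [K K0 hK]]].
  by exists 0 => // s; rewrite flat_sum_nil normr0.
have [K' K'0 hK'] := flat_bounded b0.
exists (`|c| * K' + K) => [|s]; first by rewrite addr_ge0 // mulr_ge0.
rewrite flat_sum_cons; apply: le_trans (ler_normD _ _) _; rewrite lerD //.
rewrite normrM ler_wpM2l // ger0_norm ?flat_ge0 //=.
have [s0|s0] := leP s 0; first by rewrite flat_le0.
rewrite flat_decay (le_trans _ (hK' s)) // ler_piMl ?flat_ge0 // -expR0 ler_expR.
by rewrite oppr_le0 mulr_ge0 // ltW.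
Qed.

Lemma flat_sum_decay l : all (fun t => 0 <= t.1.2) l -> all (fun t => (0 < t.2)%N) l ->
  exists2 K, 0 <= K & forall s, 0 <= s -> `|flat_sum l s| <= K * expR (- s).
Proof.
elim: l => [_ _|[[c b] j] l IH /= /andP[b0 h1] /andP[j0 h2]].
  by exists 0 => // s _; rewrite flat_sum_nil normr0 mul0r.
have [K K0 hK] := IH h1 h2; have [K' K'0 hK'] := flat_bounded b0.
exists (`|c| * K' + K) => [|s s0]; first by rewrite addr_ge0 // mulr_ge0.
rewrite flat_sum_cons; apply: le_trans (ler_normD _ _) _; rewrite mulrDl lerD ?hK //.
rewrite normrM -mulrA ler_wpM2l // ger0_norm ?flat_ge0 //= flat_decay mulrC.
rewrite ler_pM ?flat_ge0 ?expR_ge0 // ler_expR lerN2 ler_peMl // ler1n //.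
Qed.

End FlatFunctions.

Section FlatCutoff.
Context {R : realType} {n : nat}.
Local Notation V := 'rV[R]_n.
Implicit Types (b c s : R) (y : V).

Lemma decay_radial (u : R -> R) :
  (forall m, exists C, forall s, 0 <= s -> s ^+ m * `|u s| <= C) -> decay (fun y => u (dot y y)).
Proof.
move=> hu m; have [C0 h0] := hu 0%N; have [C hC] := hu m.
exists (C0 + C) => y; have d0 := dot_ge0 y.
apply: (@le_trans _ _ ((1 + dot y y ^+ m) * `|u (dot y y)|)).
  rewrite ler_wpM2r // -enorm_sqr -exprM mulnC exprM.
  have : 0 <= (enorm y ^+ m - 2^-1) ^+ 2 by rewrite sqr_ge0.
  have : 0 <= enorm y ^+ m by rewrite exprn_ge0 // enorm_ge0.
  set q := enorm y ^+ m; nra.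
by rewrite mulrDl mul1r lerD ?hC // -[leLHS]mul1r -(expr0 (dot y y)) h0.
Qed.

Lemma smooth_slow_sqrZ c : smooth slow (fun y => c * dot y y).
Proof. by apply: smooth_slowM => [k|]; [exact: smooth_slow_cst|exact: smooth_slow_sqr]. Qed.

Lemma smooth_slow_flat b c : 0 <= b -> smooth slow (fun y => flat b 0 (c * dot y y)).
Proof.
move=> b0; pose L k := iter k (@flat_step R) [:: (1, b, 0%N)].
have L0 k : all (fun t => 0 <= t.1.2) (L k).
  by elim: k => [|k IH] /=; [rewrite b0|exact: flat_step_ge0].
pose H k := flat_sum (L k).
have dH k s : is_derive s 1 (H k) (H k.+1 s) by exact: is_derive_flat_sum.
have sH k : slow (fun y => H k (c * dot y y)).
  by have [K _ hK] := flat_sum_bounded (L0 k); exact: slow_bounded (fun y => hK _).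
move=> k; have := smooth_upto_comp slowD slowM dH sH (smooth_slow_sqrZ c) k 0%N.
by rewrite /H /= flat_sum_cons flat_sum_nil; under eq_fun do rewrite addr0 mul1r.
Qed.

(** Plays the role of a compactly supported bump without any gluing: it is 1 at the origin, and its
    decay comes from 1 - e^(-x) <= x with x = e^(-s) / s. *)
Definition flat_bump y : R := 1 - flat 0 0 (dot y y).

Lemma flat_le1 c : flat 0 0 c <= 1.
Proof.
by rewrite /flat; case: ifP => // _; rewrite !mul0r oppr0 addr0 add0r expR_le1 oppr_le0 expR_ge0.
Qed.

Lemma smooth_decay_flat_bump : smooth decay flat_bump.
Proof.
(* The derivative of 1 - flat 0 0. All its terms have j = 1, so every derivative decays
   exponentially; only the function itself needs a separate argument. *)
pose l1 : seq (R * R * nat) := [:: (-1, 1, 1%N); (-1, 2, 1%N)].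
pose L k := iter k (@flat_step R) l1.
have L0 k : all (fun t => 0 <= t.1.2) (L k).
  by elim: k => [|k IH] /=; [rewrite ?ler01 ?ler0n|exact: flat_step_ge0].
have L1 k : all (fun t => (0 < t.2)%N) (L k).
  by elim: k => [//|k IH] /=; exact: flat_step_gt0.
pose H k s := if k is j.+1 then flat_sum (L j) s else 1 - flat 0 0 s.
have dH k s : is_derive s 1 (H k) (H k.+1 s).
  case: k => [|k] /=; last exact: is_derive_flat_sum.
  have h := is_derive_flat 0%N s (lexx (0 : R)).
  apply: (is_derive_eq (is_deriveB (is_derive_cst (1 : R) s 1) h)).
  by rewrite /L /= !flat_sum_cons flat_sum_nil !add0r; ring.
have sH k : decay (fun y => H k (dot y y)).
  apply: decay_radial => m; case: k => [|k].
    exists (1 + m`!%:R) => s s0; rewrite /H ger0_norm ?subr_ge0 ?flat_le1 //.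
    have f0 := flat_ge0 0 0 s.
    have [s1|s1] := leP 1 s; last first.
      apply: (@le_trans _ _ 1); last by rewrite lerDl.
      rewrite -[leRHS]mul1r ler_pM ?exprn_ge0 ?subr_ge0 ?flat_le1 ?gerBl //.
      by rewrite exprn_ile1 // ltW.
    apply: (@le_trans _ _ (s ^+ m * expR (- s))); last first.
      by apply: le_trans (expr_expRN_le m s0) _; rewrite lerDr.
    rewrite ler_wpM2l ?exprn_ge0 // /flat (lt_le_trans ltr01 s1) !mul0r oppr0 addr0 add0r.
    apply: (@le_trans _ _ (expR (- s - ln s))).
      by rewrite lerBlDr -lerBlDl; have := expR_ge1Dx (- expR (- s - ln s)); lra.
    by rewrite ler_expR gerBl ln_ge0.
  have [K K0 hK] := flat_sum_decay (L0 k) (L1 k).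
  exists (K * m`!%:R) => s s0; apply: (@le_trans _ _ (s ^+ m * (K * expR (- s)))).
    by rewrite ler_wpM2l ?exprn_ge0 // hK.
  by rewrite mulrCA ler_wpM2l // expr_expRN_le.
by move=> k; exact: (smooth_upto_comp decayD decayM dH sH smooth_slow_sqr k 0%N).
Qed.

(** The singular power is absorbed by the parameter b, so its product with the cutoff is again
    smooth, including at the origin. *)
Lemma riesz_flat (alpha c : R) y : 0 < c ->
  riesz alpha y * flat 0 0 (c * dot y y) = c `^ (alpha / 2) * flat (alpha / 2) 0 (c * dot y y).
Proof.
move=> c0; have [d0|d0] := leP (dot y y) 0.
  by rewrite !flat_le0 ?mulr0 // pmulr_rle0.
rewrite rieszE /flat pmulr_rgt0 // d0 /powR !gt_eqF // -!expRD lnM ?posrE //.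
congr expR; ring.
Qed.

End FlatCutoff.

(** * Truncated pairings *)

Section PowerBounds.
Context {d} {T : measurableType d} {R : realType}.
Variable m : {measure set T -> \bar R}.
Implicit Types f g : T -> R[i].

Lemma CLnorm_le (p a : R) f : 0 < p -> (\int[m]_x (nc (f x) `^ p)%:E <= a%:E)%E ->
  (CLnorm m p f <= (a `^ p^-1)%:E)%E.
Proof.
move=> p0 fa; rewrite CLnormE -poweR_EFin.
have i0 : (0 <= \int[m]_x (nc (f x) `^ p)%:E)%E.
  by apply: integral_ge0 => x _; rewrite lee_fin powR_ge0.
apply: gt0_ler_poweR => //; rewrite ?invr_ge0 ?(ltW p0) // in_itv /= leey andbT //.
exact: le_trans fa.
Qed.

Lemma hoelder_bound (p q a b : R) f g : Cmeasurable f -> Cmeasurable g ->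
  0 < p -> 0 < q -> p^-1 + q^-1 = 1 ->
  (\int[m]_x (nc (f x) `^ p)%:E <= a%:E)%E -> (\int[m]_x (nc (g x) `^ q)%:E <= b%:E)%E ->
  (\int[m]_x (nc (f x * g x))%:E <= (a `^ p^-1 * b `^ q^-1)%:E)%E.
Proof.
move=> mf mg p0 q0 pq fa gb; apply: le_trans (normc_hoelder m mf mg p0 q0 pq) _.
by rewrite EFinM; apply: lee_pmul; rewrite ?CLnorm_ge0 ?CLnorm_le.
Qed.

Lemma hoelder_Cintegral (p q a b : R) f g : Cmeasurable f -> Cmeasurable g ->
  0 < p -> 0 < q -> p^-1 + q^-1 = 1 ->
  (\int[m]_x (nc (f x) `^ p)%:E <= a%:E)%E -> (\int[m]_x (nc (g x) `^ q)%:E <= b%:E)%E ->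
  Cintegrable m (fun x => f x * g x) /\
  nc (Cintegral m (fun x => f x * g x)) <= a `^ p^-1 * b `^ q^-1.
Proof.
move=> mf mg p0 q0 pq fa gb; have h := hoelder_bound mf mg p0 q0 pq fa gb.
have c : Cintegrable m (fun x => f x * g x).
  by apply/CintegrableP; split; [exact: CmeasM|exact: le_lt_trans h (ltry _)].
by split => //; rewrite -lee_fin (le_trans (normc_Cintegral_le c)).
Qed.

End PowerBounds.

Section RealSequences.
Context {R : realType}.

Lemma cvg0_powR (u : nat -> R) (r : R) : 0 < r -> (forall k, 0 <= u k) ->
  u @ \oo --> 0 -> (fun k => u k `^ r) @ \oo --> 0.
Proof.
move=> r0 u0 hu; apply/cvgrPdist_le => e e0.
have e'0 : 0 < e `^ r^-1 by rewrite powR_gt0.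
move/cvgrPdist_le : hu => /(_ _ e'0); apply: filterS => k.
rewrite !sub0r !normrN !ger0_norm ?powR_ge0 // => h.
have := ge0_ler_powR (ltW r0) (u0 k) (powR_ge0 e r^-1) h.
by rewrite -powRrM mulVf ?gt_eqF // powRr1 // ltW.
Qed.

Lemma cauchy_le_cvg (x w : nat -> R) : w @ \oo --> 0 ->
  (forall N j k, (N <= j)%N -> (N <= k)%N -> `|x j - x k| <= w N) -> cvg (x @ \oo).
Proof.
move=> w0 h; apply/cauchy_cvgP/cauchy_exP => e e0.
have /cvgrPdist_lt /(_ _ e0) [N _ hN] := w0.
exists (x N); exists N => // k /= Nk; rewrite /ball /=.
apply: le_lt_trans (h N N k (leqnn _) Nk) _.
by have := hN N (leqnn _); rewrite sub0r normrN; apply: le_lt_trans; exact: ler_norm.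
Qed.

End RealSequences.

Section Pairing.
Context {R : realType} {n : nat}.
Local Notation V := 'rV[R]_n.
Local Notation mu := (lebesgueRn R n).
Implicit Types (f g h u v : V -> R[i]) (x y xi : V) (alpha A b e : R) (k : nat).

(** Functions for which the transform of |y|^(-alpha) h is an absolutely convergent integral and the
    Hedberg bound holds. A is any bound on the averages about 0, so that truncations and their
    differences can share it. *)
Definition admissible alpha A h :=
  [/\ Cintegrable mu h, Cintegrable mu (fun y => (riesz alpha y)%:C * h y), h 0 = 0, 0 <= A &
      forall r, 0 < r -> (avg r (fun y => (nc (h y))%:E) 0%R <= A%:E)%E].

Definition exp_lo alpha : R := 2 * n%:R / (n%:R + alpha).
Definition exp_hi alpha : R := 2 * n%:R / (n%:R - alpha).

Lemma exp_conj alpha : 0 <= alpha < n%:R ->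
  [/\ 0 < exp_lo alpha, 0 < exp_hi alpha, 1 <= exp_lo alpha &
      (exp_lo alpha)^-1 + (exp_hi alpha)^-1 = 1].
Proof.
move=> /andP[a0 an]; have n0 : 0 < n%:R :> R by exact: le_lt_trans an.
have p1 : 0 < n%:R + alpha by rewrite ltr_pwDl.
have p2 : 0 < n%:R - alpha by rewrite subr_gt0.
split; rewrite /exp_lo /exp_hi ?divr_gt0 ?mulr_gt0 //.
  by rewrite ler_pdivlMr // mul1r mulr_natl mulr2n lerD2l ltW.
by rewrite !invf_div; field; rewrite gt_eqF.
Qed.

(** The majorant g keeps the constant A, where the triangle inequality would double it. *)
Lemma admissibleB alpha A f h : admissible alpha A f -> admissible alpha A h ->
  (forall g, (forall y, nc (f y - h y) <= nc (g y)) -> Cmeasurable g ->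
    (forall r, 0 < r -> (avg r (fun y => (nc (g y))%:E) 0%R <= A%:E)%E) ->
    admissible alpha A (fun y => f y - h y)).
Proof.
move=> [cf cwf f0 A0 _] [ch cwh h0 _ _] g le mg hA.
have cB := CintegrableB cf ch; split => //.
- apply: (eq_Cintegrable (f := fun y => (riesz alpha y)%:C * f y - (riesz alpha y)%:C * h y)).
    by move=> y; rewrite mulrBr.
  exact: CintegrableB.
- by rewrite f0 h0 subrr.
- move=> r r0; apply: le_trans (hA r r0); apply: avg_le => //.
  + exact: nnmeas_normc (Cintegrable_meas cB).
  + exact: nnmeas_normc.
Qed.

Lemma fourierB f h xi : Cintegrable mu f -> Cintegrable mu h ->
  fourier (fun y => f y - h y) xi = fourier f xi - fourier h xi.
Proof.
move=> cf ch; rewrite /fourier -CintegralB; [|exact: Cintegrable_fourier|exact: Cintegrable_fourier].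
by apply: eq_Cintegral => y; rewrite mulrBr.
Qed.

(** For v = g(x, .) and truncations h of f(x + .), its limit is (2 pi)^n a(x,D)f(x). *)
Definition pairing alpha v h : R[i] :=
  Cintegral mu (fun xi => v xi * fourier (fun y => (riesz alpha y)%:C * h y) xi).

Lemma pairing_bound alpha : 0 <= alpha < n%:R -> exists2 C, 0 < C & forall v h A b e,
  Cmeasurable v -> (\int[mu]_xi (nc (v xi) `^ exp_lo alpha)%:E <= b%:E)%E ->
  admissible alpha A h -> (\int[mu]_y (nc (h y) ^+ 2)%:E <= e%:E)%E ->
  Cintegrable mu (fun xi => v xi * fourier (fun y => (riesz alpha y)%:C * h y) xi) /\
  nc (pairing alpha v h) <=
    b `^ (exp_lo alpha)^-1 * (C * A `^ (alpha / n%:R * exp_hi alpha) * e) `^ (exp_hi alpha)^-1.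
Proof.
move=> ha; have [p0 q0 _ pq] := exp_conj ha; have [C C0 hC] := riesz_fourier_Lq ha.
exists C => // v h A b e mv vb [ch cw h0 A0 hA] he.
apply: hoelder_Cintegral => //; first exact: Cmeas_fourier (Cintegrable_meas cw).
apply: le_trans (hC h A ch cw h0 A0 hA) _; rewrite [X in (_ <= X)%E]EFinM.
by rewrite lee_wpmul2l // lee_fin mulr_ge0 ?powR_ge0 // ltW.
Qed.

Lemma pairingB alpha A v f h b e1 e2 : 0 <= alpha < n%:R -> Cmeasurable v ->
  (\int[mu]_xi (nc (v xi) `^ exp_lo alpha)%:E <= b%:E)%E ->
  admissible alpha A f -> (\int[mu]_y (nc (f y) ^+ 2)%:E <= e1%:E)%E ->
  admissible alpha A h -> (\int[mu]_y (nc (h y) ^+ 2)%:E <= e2%:E)%E ->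
  pairing alpha v (fun y => f y - h y) = pairing alpha v f - pairing alpha v h.
Proof.
move=> ha mv vb af f2 ah h2; have [C _ hC] := pairing_bound ha.
have [if' _] := hC v f A b e1 mv vb af f2; have [ih _] := hC v h A b e2 mv vb ah h2.
rewrite /pairing -CintegralB //; apply: eq_Cintegral => xi; rewrite -mulrBr.
case: af => _ cwf _ _ _; case: ah => _ cwh _ _ _.
rewrite -fourierB //; congr (_ * _); apply: eq_Cintegral => y.
by rewrite mulrBr.
Qed.

Definition ann k y : bool := (k.+1%:R^-1 < enorm y) && (enorm y < k.+1%:R).

Definition annulus k f y : R[i] := ((ann k y)%:R)%:C * f y.

Lemma measurable_ann d (T : measurableType d) k (w : T -> V) : measurable_fun setT w ->
  measurable_fun setT (fun t => (ann k (w t))%:R : R).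
Proof.
move=> mw; apply: (measurableT_comp (f := fun b : bool => b%:R : R)) => //.
by apply: measurable_and; apply: measurable_fun_ltr => //; exact: measurable_enorm.
Qed.

Lemma Cmeas_annulus k f : Cmeasurable f -> Cmeasurable (annulus k f).
Proof. by move=> mf; apply: CmeasM => //; apply: CmeasR; exact: measurable_ann. Qed.

Lemma normc_annulus k f y : nc (annulus k f y) <= nc (f y).
Proof. by rewrite normcM normcR; case: (ann k y); rewrite ?normr1 ?mul1r // normr0 mul0r normc_ge0. Qed.

Lemma nnmeas_normc_sqr f : Cmeasurable f -> nnmeas (fun y => (nc (f y) ^+ 2)%:E).
Proof.
move=> mf; apply: nnmeas_EFin; last by move=> x; rewrite sqr_ge0.
by apply: measurable_funX; exact: measurable_normc.
Qed.

Lemma annulus_sqr_le k f e : Cmeasurable f -> (\int[mu]_y (nc (f y) ^+ 2)%:E <= e%:E)%E ->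
  (\int[mu]_y (nc (annulus k f y) ^+ 2)%:E <= e%:E)%E.
Proof.
move=> mf fe; apply: le_trans fe; apply: nn_le_integral.
- exact: nnmeas_normc_sqr (Cmeas_annulus k mf).
- exact: nnmeas_normc_sqr.
- by move=> y; rewrite lee_fin ler_sqr ?nnegrE ?normc_ge0 // normc_annulus.
Qed.

Lemma annulus_admissible alpha A k f e : 0 <= alpha -> Cmeasurable f ->
  (\int[mu]_y (nc (f y) ^+ 2)%:E <= e%:E)%E -> 0 <= A ->
  (forall r, 0 < r -> (avg r (fun y => (nc (f y))%:E) 0%R <= A%:E)%E) ->
  admissible alpha A (annulus k f).
Proof.
move=> a0 mf fe A0 hA; have mk := Cmeas_annulus k mf.
have nk := nnmeas_normc mk.
have ck : Cintegrable mu (annulus k f).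
  have mB : measurable (eball (0 : V) k.+1%:R) by exact: measurable_eball.
  have nB : nnmeas (fun y => (\1_(eball (0 : V) k.+1%:R) y)%:E : \bar R).
    by apply: nnmeas_EFin => //; exact: measurable_indic.
  have muB : (mu (eball (0 : V) k.+1%:R) < +oo)%E by rewrite mu_eball // ltry.
  have nf := nnmeas_normc_sqr mf.
  (* Local integrability of a square integrable function, from t <= 1 + t^2 on a ball of finite
     measure. *)
  apply: (Cintegrable_dom (G := fun y => ((\1_(eball (0 : V) k.+1%:R) y)%:E + (nc (f y) ^+ 2)%:E)%E)) => //.
  - exact: nnmeasD.
  - move=> y; rewrite -EFinD lee_fin indicE /annulus normcM normcR /ann.
    case: (boolP (_ && _)) => [/andP[_ h]|_]; last first.
      by rewrite normr0 mul0r addr_ge0 // sqr_ge0.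
    rewrite normr1 mul1r mem_set /=; last by rewrite /eball /= subr0.
    by have := sqr_ge0 (nc (f y) - 2^-1); nra.
  - rewrite nn_integralD // integral_indic // setIT.
    by apply: lte_add_pinfty; [exact: muB|exact: le_lt_trans fe (ltry _)].
split => //.
- apply: (Cintegrable_dom (G := fun y => ((k.+1%:R `^ alpha)%:E * (nc (annulus k f y))%:E)%E)).
  + by apply: CmeasM => //; apply: CmeasR; exact: measurable_riesz.
  + by apply: nnmeasM => //; apply: nnmeas_cst; rewrite lee_fin powR_ge0.
  + move=> y; rewrite -EFinM lee_fin normcM normcR ger0_norm ?riesz_ge0 //.
    rewrite /annulus /ann; case: (boolP (_ && _)) => [/andP[h _]|_]; last first.
      by rewrite normcM normcR normr0 mul0r !mulr0.
    rewrite ler_wpM2r ?normc_ge0 // /riesz powRN -[leRHS]invrK lef_pV2 ?posrE.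
    - rewrite -powRN powRN -powR_inv1 // powRAC powR_inv1 //.
      by apply: ge0_ler_powR; rewrite ?nnegrE ?invr_ge0 ?enorm_ge0 // ltW.
    - by rewrite powR_gt0 // (lt_trans _ h) // invr_gt0.
    - by rewrite invr_gt0 powR_gt0.
  + by rewrite nn_integralZl ?powR_ge0 // lte_mul_pinfty ?lee_fin ?powR_ge0 // Cintegrable_lty.
- by rewrite /annulus /ann enorm0 ltNge invr_ge0 ler0n mul0r.
- move=> r r0; apply: le_trans (hA r r0); apply: avg_le => //.
    exact: nnmeas_normc.
  by move=> y; rewrite lee_fin normc_annulus.
Qed.

(** The origin, which lies in no annulus, is left out, so that these sets shrink to nothing at every
    point. *)
Definition off_ann k y : bool := (0 < enorm y) && ~~ ann k y.

Definition ann_tail f k : R := \int[mu]_y (nc (f y) ^+ 2 * (off_ann k y)%:R).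

Lemma annW j k y : (j <= k)%N -> ann j y -> ann k y.
Proof.
move=> jk /andP[h1 h2]; apply/andP; split; last first.
  by apply: lt_le_trans h2 _; rewrite ler_nat.
by apply: le_lt_trans h1; rewrite lef_pV2 ?posrE ?ltr0n // ler_nat.
Qed.

Lemma measurable_off_ann k : measurable_fun setT (fun y => (off_ann k y)%:R : R).
Proof.
have -> : (fun y => (off_ann k y)%:R : R) = (fun y => ((0 < enorm y)%R)%:R * (1 - (ann k y)%:R)).
  by apply/funext => y; rewrite /off_ann; case: (0 < _); case: (ann k y); rewrite /= ?subrr ?subr0 ?mulr0 ?mulr1 ?mul0r.
apply: measurable_funM.
  apply: (measurableT_comp (f := fun b : bool => b%:R : R)) => //.
  by apply: measurable_fun_ltr => //; exact: measurable_enorm.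
by apply: measurable_funB => //; exact: measurable_ann.
Qed.

Lemma off_ann_cvg0 y : (fun k => (off_ann k y)%:R : R) @ \oo --> 0.
Proof.
have [y0|y0] := ltP 0 (enorm y); last first.
  under eq_fun do rewrite /off_ann ltNge y0; exact: cvg_cst.
have big (t : R) : \forall k \near \oo, t < k.+1%:R.
  near=> k; apply: (@lt_trans _ _ k%:R); last by rewrite ltr_nat.
  by near: k; exact: nbhs_infty_gtr.
apply: cvg_near_cst; near=> k; rewrite /off_ann y0 /=.
suff -> : ann k y by [].
apply/andP; split.
  rewrite invf_plt ?posrE //; near: k; exact: big.
near: k; exact: big.
Unshelve. all: by end_near.
Qed.

Lemma nnmeas_ann_tail f k : Cmeasurable f -> nnmeas (fun y => (nc (f y) ^+ 2 * (off_ann k y)%:R)%:E).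
Proof.
move=> mf; apply: nnmeas_EFin; last by move=> y; rewrite mulr_ge0 ?sqr_ge0.
by apply: measurable_funM; [apply: measurable_funX; exact: measurable_normc|exact: measurable_off_ann].
Qed.

Lemma ann_tailE f k e : Cmeasurable f -> (\int[mu]_y (nc (f y) ^+ 2)%:E <= e%:E)%E ->
  (\int[mu]_y (nc (f y) ^+ 2 * (off_ann k y)%:R)%:E = (ann_tail f k)%:E)%E.
Proof.
move=> mf fe; rewrite /ann_tail /Rintegral fineK // ge0_fin_numE; last first.
  by apply: integral_ge0 => y _; exact: (nnmeas_ann_tail k mf).2.
apply: le_lt_trans (le_trans _ fe) (ltry _); apply: nn_le_integral.
- exact: nnmeas_ann_tail.
- exact: nnmeas_normc_sqr.
- by move=> y; rewrite lee_fin ler_piMr ?sqr_ge0 // lern1 leq_b1.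
Qed.

Lemma ann_tail_cvg0 f e : Cmeasurable f -> (\int[mu]_y (nc (f y) ^+ 2)%:E <= e%:E)%E ->
  ann_tail f @ \oo --> 0.
Proof.
move=> mf fe.
have h := @nn_dominated0 _ _ _ mu (fun k y => nc (f y) ^+ 2 * (off_ann k y)%:R) (fun y => nc (f y) ^+ 2).
have cv : (fun k => \int[mu]_y (nc (f y) ^+ 2 * (off_ann k y)%:R)%:E)%E @ \oo --> (0 : R)%:E.
  apply: h.
  - by move=> k; apply/measurable_EFinP; exact: (nnmeas_ann_tail k mf).1.
  - by move=> k y; rewrite mulr_ge0 ?sqr_ge0.
  - by move=> y; apply: cvg0Z; exact: off_ann_cvg0.
  - by apply: measurable_funX; exact: measurable_normc.
  - by move=> k y; rewrite ler_piMr ?sqr_ge0 // lern1 leq_b1.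
  - exact: le_lt_trans fe (ltry _).
exact: fine_cvg cv.
Qed.

Lemma complex_cauchy_cvg (z : nat -> R[i]) (w : nat -> R) : w @ \oo --> 0 ->
  (forall N j k, (N <= j)%N -> (N <= k)%N -> nc (z j - z k) <= w N) ->
  exists l, (fun k => nc (z k - l)) @ \oo --> 0.
Proof.
move=> w0 hz.
have cR : cvg ((fun k => complex.Re (z k)) @ \oo).
  apply: (cauchy_le_cvg w0) => N j k Nj Nk; apply: le_trans (hz N j k Nj Nk).
  by rewrite -Re_opp -Re_add Re_le_normc.
have cI : cvg ((fun k => complex.Im (z k)) @ \oo).
  apply: (cauchy_le_cvg w0) => N j k Nj Nk; apply: le_trans (hz N j k Nj Nk).
  by rewrite -Im_opp -Im_add Im_le_normc.
exists (limn (fun k => complex.Re (z k)) +i* limn (fun k => complex.Im (z k))).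
apply: cvg0_le (cvg0D (cvg0B cR) (cvg0B cI)) => k; rewrite normc_ge0 /=.
by apply: le_trans (normc_le _) _; rewrite Re_add Im_add Re_opp Im_opp.
Qed.

(** Two truncations beyond the N-th differ only on [off_ann N] and share A, so their pairings differ
    by a power of the L^2 tail of f. *)
Lemma pairing_annulus_cvg alpha : 0 <= alpha < n%:R -> exists2 C, 0 < C & forall v f A b e,
  Cmeasurable v -> (\int[mu]_xi (nc (v xi) `^ exp_lo alpha)%:E <= b%:E)%E ->
  Cmeasurable f -> (\int[mu]_y (nc (f y) ^+ 2)%:E <= e%:E)%E -> 0 <= A ->
  (forall r, 0 < r -> (avg r (fun y => (nc (f y))%:E) 0%R <= A%:E)%E) ->
  exists2 l, (fun k => nc (pairing alpha v (annulus k f) - l)) @ \oo --> 0 &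
    nc l <= b `^ (exp_lo alpha)^-1 * (C * A `^ (alpha / n%:R * exp_hi alpha) * e) `^ (exp_hi alpha)^-1.
Proof.
move=> ha; have [C C0 hC] := pairing_bound ha; exists C => // v f A b e mv vb mf fe A0 hA.
have a0 : 0 <= alpha by case/andP: ha.
have [_ q0 _ _] := exp_conj ha.
have adm k := annulus_admissible k a0 mf fe A0 hA.
have sq k := annulus_sqr_le k mf fe.
set B := b `^ _.
pose w k := B * (C * A `^ (alpha / n%:R * exp_hi alpha) * ann_tail f k) `^ (exp_hi alpha)^-1.
have tail0 k : 0 <= ann_tail f k by apply: Rintegral_ge0 => y _; rewrite mulr_ge0 ?sqr_ge0.
have CA0 : 0 <= C * A `^ (alpha / n%:R * exp_hi alpha) by rewrite mulr_ge0 ?powR_ge0 // ltW.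
have w0 : w @ \oo --> 0.
  apply: cvg0Z; apply: cvg0_powR; first by rewrite invr_gt0.
    by move=> k; rewrite mulr_ge0.
  by apply: cvg0Z; exact: ann_tail_cvg0 fe.
have hw N j k : (N <= j)%N -> (N <= k)%N ->
    nc (pairing alpha v (annulus j f) - pairing alpha v (annulus k f)) <= w N.
  move=> Nj Nk; rewrite -(pairingB ha mv vb (adm j) (sq j) (adm k) (sq k)).
  have ab y : nc (annulus j f y - annulus k f y) <= (off_ann N y)%:R * nc (f y).
    rewrite /annulus -mulrBl normcM ler_wpM2r ?normc_ge0 // -rmorphB normcR /off_ann.
    have [y0|y0] := ltP 0 (enorm y); last first.
      have an0 m : ann m y = false.
        by apply/negbTE; rewrite /ann negb_and -leNgt (le_trans y0) // invr_ge0.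
      by rewrite !an0 subrr normr0.
    case: (boolP (ann N y)) => [aN|_]; first by rewrite (annW Nj aN) (annW Nk aN) subrr normr0.
    by case: (ann j y); case: (ann k y); rewrite /= ?subrr ?subr0 ?sub0r ?normrN ?normr0 ?normr1.
  have abf y : nc (annulus j f y - annulus k f y) <= nc (f y).
    by apply: le_trans (ab y) _; rewrite ler_piMl ?normc_ge0 // lern1 leq_b1.
  have aB := admissibleB (adm j) (adm k) abf mf hA.
  apply: (hC v _ A b (ann_tail f N) mv vb aB _).2.
  rewrite -(ann_tailE N mf fe); apply: nn_le_integral.
  - by apply: nnmeas_normc_sqr; case: aB => /Cintegrable_meas.
  - exact: nnmeas_ann_tail.
  move=> y; rewrite lee_fin; apply: (@le_trans _ _ (((off_ann N y)%:R * nc (f y)) ^+ 2)).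
    by rewrite ler_sqr ?nnegrE ?normc_ge0 // mulr_ge0 ?normc_ge0.
  by rewrite exprMn mulrC; case: (off_ann N y); rewrite ?expr1n // expr0n.
have [l hl] := complex_cauchy_cvg w0 hw; exists l => //.
apply/ler_addgt0Pr => d d0; move/cvgrPdist_lt : hl => /(_ _ d0)[k _ /(_ k (leqnn _))].
rewrite sub0r normrN ger0_norm ?normc_ge0 // normcB_sym => hk.
have := normcD (l - pairing alpha v (annulus k f)) (pairing alpha v (annulus k f)); rewrite subrK.
move/le_trans; apply; rewrite addrC lerD //; last exact: ltW.
exact: (hC v _ A b e mv vb (adm k) (sq k)).2.
Qed.

End Pairing.

(** * Fourier transforms of products, dilates and Riesz weights *)

Section SchwartzFourierMore.
Context {R : realType} {n : nat}.
Local Notation V := 'rV[R]_n.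
Local Notation mu := (lebesgueRn R n).
Implicit Types (f h psi phi : V -> R[i]) (x y xi eta : V).

Lemma fourier_fourier f y : schwartz f -> fourier (fourier f) y = ((2 * pi) ^+ n)%:C * f (- y).
Proof.
move=> sf; rewrite -(fourier_inversion (- y) sf); apply: eq_Cintegral => xi.
by rewrite dotNl [dot y xi]dotC.
Qed.

(** The multiplication formula against the modulated function [th], with the double transform of f
    on the other side. The evenness of psi absorbs the reflection. *)
Lemma fourier_mul_convolution psi f xi : schwartz psi -> schwartz f -> (forall y, psi (- y) = psi y) ->
  schwartz (fun y => psi y * f y) ->
  ((2 * pi) ^+ n)%:C * fourier (fun y => psi y * f y) xi =
  Cintegral mu (fun eta => fourier f eta * fourier psi (eta - xi)).
Proof.
move=> sp sf ev spf; have cp := schwartz_Cintegrable sp.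
pose th y := expi (dot xi y) * psi y.
have cth : Cintegrable mu th by apply: Cintegrable_unimod => //; exact: measurable_dot.
have cF := schwartz_Cintegrable (schwartz_fourier sf).
transitivity (Cintegral mu (fun eta => fourier f eta * fourier th eta)); last first.
  by apply: eq_Cintegral => eta; rewrite /th fourier_modulate.
rewrite (fourier_exchange cF cth).
pose g y := ((2 * pi) ^+ n)%:C * (expi (- dot y xi) * (psi y * f y)).
have cg : Cintegrable mu g by apply: CintegrableZ; apply: Cintegrable_fourier; exact: schwartz_Cintegrable.
rewrite -CintegralZ; last by apply: Cintegrable_fourier; exact: schwartz_Cintegrable.
transitivity (Cintegral mu (fun y => g (- y))); first by rewrite (Cintegral_reflect cg).
apply: eq_Cintegral => y; rewrite /g /th (fourier_fourier y sf) dotNl opprK ev [dot xi y]dotC.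
ring.
Qed.

Lemma fourier_dilate psi (m : R) xi : 0 < m -> Cintegrable mu psi ->
  fourier (fun y => psi (m *: y)) xi = ((m ^+ n)^-1)%:C * fourier psi (m^-1 *: xi).
Proof.
move=> m0 cp; have mn0 : m != 0 by rewrite gt_eqF.
pose g y := expi (- dot y (m^-1 *: xi)) * psi y.
have cg : Cintegrable mu g by exact: Cintegrable_fourier.
have E : (m ^+ n)%:C * Cintegral mu (fun y => g (m *: y + 0)) = Cintegral mu g.
  by rewrite -(Cintegral_affine 0 mn0 cg) gtr0_norm.
rewrite /fourier -/(Cintegral mu g) -E mulrA -rmorphM mulVf ?expf_neq0 // mul1r.
apply: eq_Cintegral => y; rewrite /g addr0 dotZl dotZr mulVKf //.
Qed.

(** The amplitude m^(-n) contributes m^(-np) and the change of variables m^n; the exponent is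
    negative for p > 1. *)
Lemma integral_fourier_dilate (p m : R) psi : 0 < m -> 0 < p -> schwartz psi ->
  (\int[mu]_xi (nc (fourier (fun y => psi (m *: y)) xi) `^ p)%:E =
   (m `^ (n%:R - n%:R * p))%:E * \int[mu]_xi (nc (fourier psi xi) `^ p)%:E)%E.
Proof.
move=> m0 p0 sp; have cp := schwartz_Cintegrable sp.
have mF := Cmeas_fourier (Cintegrable_meas cp).
have nF := measurable_normc_powR p mF.
have mi0 : m^-1 != 0 by rewrite invr_eq0 gt_eqF.
have nFm : nnmeas (fun xi => (nc (fourier psi (m^-1 *: xi + 0)) `^ p)%:E).
  exact: measurable_normc_powR (Cmeas_affine _ _ mF).
have H := integral_affine 0 mi0 nF.1 nF.2.
apply: (@etrans _ _ ((m `^ (n%:R - n%:R * p))%:E * ((`|m^-1| ^+ n)%:E *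
    \int[mu]_xi (nc (fourier psi (m^-1 *: xi + 0)) `^ p)%:E)))%E; last by congr (_ * _)%E; exact: H.
apply: (@etrans _ _ (\int[mu]_xi ((((m ^+ n)^-1) `^ p)%:E * (nc (fourier psi (m^-1 *: xi + 0)) `^ p)%:E)))%E.
  apply: eq_integral => xi _; rewrite fourier_dilate // addr0 normcM normcR.
  by rewrite ger0_norm ?invr_ge0 ?exprn_ge0 ?(ltW m0) // powRM ?invr_ge0 ?exprn_ge0 ?normc_ge0 ?(ltW m0) // EFinM.
rewrite nn_integralZl ?powR_ge0 // muleA -EFinM.
suff -> : ((m ^+ n)^-1) `^ p = m `^ (n%:R - n%:R * p) * `|m^-1| ^+ n by [].
rewrite gtr0_norm ?invr_gt0 // -!powR_mulrn ?invr_ge0 ?(ltW m0) // -!powRN -!powRrM.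
rewrite -[m^-1]powR_inv1 ?(ltW m0) // -powRrM -powRD; last by rewrite (gt_eqF m0) implybT.
by congr (_ `^ _); ring.
Qed.

(** The multiplier |.|^alpha cancels the weight |y|^(-alpha) that appears in the double transform;
    at the origin, where there is nothing to cancel, f vanishes. *)
Lemma frac_lap_riesz (alpha : R) f : 0 <= alpha -> f 0 = 0 -> Cmeasurable f -> Cintegrable mu f ->
  schwartz (fun y => (riesz alpha y)%:C * f y) -> forall xi,
  frac_lap_schwartz alpha (fourier (fun y => (riesz alpha y)%:C * f y)) xi = fourier f xi.
Proof.
move=> a0 f0 mf cf; set psi := (fun y => _) => sp xi; rewrite /frac_lap_schwartz.
have E y : enorm y `^ alpha * riesz alpha y = 1 \/ y = 0.
  have [->|y0] := eqVneq y 0; [by right|left].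
  rewrite /riesz powRN mulfV // powR_eq0 negb_and.
  by apply/orP; left; apply: contraNneq y0 => /enorm_eq0 ->.
have Ef y : (enorm y `^ alpha)%:C * psi y = f y.
  rewrite /psi mulrA -rmorphM; have [->|->] := E y; first by rewrite mul1r.
  by rewrite f0 mulr0.
pose g y := ((2 * pi) ^+ n)%:C * (expi (- dot y xi) * f y).
have cg : Cintegrable mu g by apply: CintegrableZ; exact: Cintegrable_fourier.
transitivity (@fourier_cst R n * Cintegral mu (fun y => g (- y))).
  congr (_ * _); apply: eq_Cintegral => y; rewrite /g dotNl opprK (fourier_fourier y sp).
  by rewrite -Ef enormN; ring.
rewrite (Cintegral_reflect cg) CintegralZ; last exact: Cintegrable_fourier.
rewrite mulrA /fourier_cst -rmorphM mulVf ?mul1r //.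
by rewrite expf_neq0 // mulf_neq0 // gt_eqF // pi_gt0.
Qed.

Lemma avg_schwartz_le f : schwartz f -> exists2 A, 0 <= A &
  forall r, 0 < r -> (avg r (fun y => (nc (f y))%:E) 0%R <= A%:E)%E.
Proof.
move=> sf; have [C C0 hC] := schwartz_weight sf; exists C => // r r0.
have nf := nnmeas_normc (schwartz_meas sf).
have nC : nnmeas (fun _ : V => C%:E) by exact: nnmeas_cst.
apply: (@le_trans _ _ (avg r (fun=> C%:E) (0 : V))).
  apply: avg_le => // y; rewrite lee_fin; apply: le_trans (hC y) _.
  by rewrite ler_piMr // weight_le1.
rewrite /avg; under eq_integral do rewrite muleC.
by rewrite nn_integralZl // ?integral_ball_kernel ?mule1 //; exact: nnmeas_ball_kernel.
Qed.

End SchwartzFourierMore.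

(** * Identification with the integral for Schwartz functions *)

Section Link.
Context {R : realType} {n : nat}.
Local Notation V := 'rV[R]_n.
Local Notation mu := (lebesgueRn R n).
Implicit Types (f h u v psi phi : V -> R[i]) (x y xi eta : V) (alpha : R) (k : nat).

(** The complementary parts at distance less and more than about 1 / (k + 1) from the origin;
    [high_cut] vanishes there to infinite order. *)
Definition low_cut k h y : R[i] := (flat_bump (k.+1%:R *: y))%:C * h y.
Definition high_cut k h y : R[i] := (flat 0 0 (k.+1%:R ^+ 2 * dot y y))%:C * h y.

Lemma bump_scale (m : R) y : flat_bump (m *: y) = 1 - flat 0 0 (m ^+ 2 * dot y y).
Proof. by rewrite /flat_bump dotZl dotZr mulrA expr2. Qed.

Lemma high_cutE k h y : high_cut k h y = h y - low_cut k h y.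
Proof.
rewrite /high_cut /low_cut bump_scale rmorphB rmorph1; ring.
Qed.

Lemma bump_bounds y : 0 <= flat_bump y <= 1.
Proof. by rewrite /flat_bump subr_ge0 flat_le1 gerBl flat_ge0. Qed.

Lemma schwartz_bump k : schwartz (fun y : V => (flat_bump (k.+1%:R *: y))%:C).
Proof.
apply: (@schwartz_cpxP _ _ (fun y : V => flat_bump (k.+1%:R *: y))).
have -> : (fun y : V => flat_bump (k.+1%:R *: y)) = (fun y : V => flat_bump (k.+1%:R *: y + 0)).
  by apply/funext => y; rewrite addr0.
by apply: smooth_decay_affine; [rewrite pnatr_eq0|exact: smooth_decay_flat_bump].
Qed.

Lemma schwartz_high_cut k h : schwartz h -> schwartz (high_cut k h).
Proof. by move=> sh; apply: schwartzM => //; exact: smooth_slow_flat. Qed.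

Lemma schwartz_low_cut k h : schwartz h -> schwartz (low_cut k h).
Proof.
move=> sh; rewrite /low_cut.
have -> : (fun y => (flat_bump (k.+1%:R *: y))%:C * h y) =
    (fun y => (1 - flat 0 0 (k.+1%:R ^+ 2 * dot y y))%:C * h y).
  by apply/funext => y; rewrite bump_scale.
apply: (@schwartzM _ _ h (fun y => 1 - flat 0 0 (k.+1%:R ^+ 2 * dot y y)) sh) => j.
apply: (smooth_uptoD slowD); first exact: smooth_slow_cst.
under eq_fun do rewrite -mulN1r mulrC.
by apply: (smooth_slowM (smooth_slow_flat _ (lexx 0))) => j'; exact: smooth_slow_cst.
Qed.

Lemma schwartz_riesz_high_cut alpha k h : 0 <= alpha -> schwartz h ->
  schwartz (fun y => (riesz alpha y)%:C * high_cut k h y).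
Proof.
move=> a0 sh.
have -> : (fun y => (riesz alpha y)%:C * high_cut k h y) =
    (fun y => ((k.+1%:R ^+ 2) `^ (alpha / 2) * flat (alpha / 2) 0 (k.+1%:R ^+ 2 * dot y y))%:C * h y).
  by apply/funext => y; rewrite /high_cut mulrA -rmorphM riesz_flat // exprn_gt0.
apply: (schwartzM sh); apply: smooth_slowM => [j|]; first exact: smooth_slow_cst.
by apply: smooth_slow_flat; rewrite divr_ge0.
Qed.

Lemma high_cut_admissible alpha A k h : 0 <= alpha -> schwartz h -> 0 <= A ->
  (forall r, 0 < r -> (avg r (fun y => (nc (h y))%:E) 0%R <= A%:E)%E) ->
  admissible alpha A (high_cut k h).
Proof.
move=> a0 sh A0 hA; have sk := schwartz_high_cut k sh.
split => //.
- exact: schwartz_Cintegrable.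
- exact: schwartz_Cintegrable (schwartz_riesz_high_cut k a0 sh).
- by rewrite /high_cut dot0l mulr0 flat_le0 // mul0r.
move=> r r0; apply: le_trans (hA r r0); apply: avg_le => //.
- exact: nnmeas_normc (schwartz_meas sk).
- exact: nnmeas_normc (schwartz_meas sh).
move=> y; rewrite lee_fin /high_cut normcM normcR ger0_norm ?flat_ge0 //.
by rewrite ler_piMl ?normc_ge0 // flat_le1.
Qed.

(** The transform of |y|^(-alpha) times the smooth truncation is a Schwartz function, so it can be
    used in the distributional identity, and its fractional Laplacian is the transform of the
    truncation. This is where the relation between u and v enters. *)
Lemma pairing_high_cut alpha u v k h : 0 <= alpha -> is_frac_lap alpha u v -> schwartz h ->
  pairing alpha v (high_cut k h) = Cintegral mu (fun xi => u xi * fourier (high_cut k h) xi).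
Proof.
move=> a0 uv sh; have sk := schwartz_high_cut k sh.
have sr := schwartz_riesz_high_cut k a0 sh.
rewrite /pairing -(uv _ (schwartz_fourier sr)); apply: eq_Cintegral => xi.
rewrite frac_lap_riesz //; [|exact: schwartz_meas|exact: schwartz_Cintegrable].
by rewrite /high_cut dot0l mulr0 flat_le0 // mul0r.
Qed.

(** Difference between the truncation that defines the operator and the one that can be tested. *)
Definition cut_gap k h y : R[i] := annulus k h y - high_cut k h y.

Lemma normc_cut_gap k h y : nc (cut_gap k h y) <= nc (h y).
Proof.
rewrite /cut_gap /annulus /high_cut -mulrBl normcM -rmorphB normcR ler_piMl ?normc_ge0 //.
have f0 := flat_ge0 0 0 (k.+1%:R ^+ 2 * dot y y); have f1 := flat_le1 (k.+1%:R ^+ 2 * dot y y).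
by case: (ann k y); rewrite /= ler_norml; apply/andP; split; lra.
Qed.

Lemma cut_gap_cvg0 h y : (fun k => nc (cut_gap k h y)) @ \oo --> 0.
Proof.
have [y0|y0] := leP (enorm y) 0.
  have -> : (fun k => nc (cut_gap k h y)) = fun=> 0.
    have d0 : dot y y = 0.
      by rewrite -enorm_sqr; apply/eqP; rewrite sqrf_eq0 eq_le y0 enorm_ge0.
    apply/funext => k; rewrite /cut_gap /annulus /high_cut d0 mulr0 flat_le0 // /ann.
    by rewrite ltNge (le_trans y0) ?invr_ge0 // !mul0r subrr normc0.
  exact: cvg_cst.
have [C hC] := smooth_upto_size (@smooth_decay_flat_bump R n 0%N) 1%N.
apply: cvg0_le (cvg0Z (nc (h y)) (cvg0D (off_ann_cvg0 y) (cvg0Z (C / enorm y) (@cvg_harmonic R)))) => k.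
rewrite normc_ge0 /cut_gap /annulus /high_cut -mulrBl normcM -rmorphB normcR mulrC ler_wpM2l ?normc_ge0 //.
have hb : flat_bump (k.+1%:R *: y) <= C / enorm y * @harmonic R k.
  rewrite /harmonic /= -mulrA -invfM ler_pdivlMr ?mulr_gt0 //.
  have /andP[b0 _] := bump_bounds (k.+1%:R *: y).
  have := hC (k.+1%:R *: y); rewrite expr1 enormZ gtr0_norm // ger0_norm //.
  by rewrite mulrC [enorm y * _]mulrC.
have /andP[b0 b1] := bump_bounds (k.+1%:R *: y).
move: hb b0 b1; rewrite bump_scale /off_ann y0 /=; set F := flat _ _ _; set H := _ * harmonic k.
by move=> hb b0 b1; case: (ann k y); rewrite /= ler_norml; apply/andP; split; lra.
Qed.

(** The transform of [low_cut] is a convolution of that of h with that of the bump: apply Hoelder in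
    xi for fixed eta, then integrate in eta. *)
Lemma low_cut_pairing_bound p q u h (a I : R) k :
  0 < p -> 0 < q -> p^-1 + q^-1 = 1 -> Cmeasurable u -> schwartz h ->
  (\int[mu]_xi (nc (u xi) `^ q)%:E <= a%:E)%E ->
  (\int[mu]_xi (nc (fourier (fun y : V => (flat_bump (k.+1%:R *: y))%:C) xi) `^ p)%:E <= I%:E)%E ->
  (\int[mu]_xi (nc (u xi * fourier (low_cut k h) xi))%:E <=
    (((2 * pi) ^+ n)^-1 * (a `^ q^-1 * I `^ p^-1))%:E * \int[mu]_eta (nc (fourier h eta))%:E)%E.
Proof.
move=> p0 q0 pq mu' sh ua; set chi := (fun y : V => _); move=> hI.
have sc : schwartz chi := schwartz_bump k.
have sl := schwartz_low_cut k sh.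
have mc := schwartz_meas (schwartz_fourier sc); have mh := schwartz_meas (schwartz_fourier sh).
have K0 : 0 < ((2 * pi) ^+ n)^-1 :> R by rewrite invr_gt0 exprn_gt0 // mulr_gt0 // pi_gt0.
have even y : chi (- y) = chi y by rewrite /chi scalerN /flat_bump dotNl dotNr opprK.
have ptw xi : ((nc (fourier (low_cut k h) xi))%:E <= ((2 * pi) ^+ n)^-1%:E *
    \int[mu]_eta ((nc (fourier h eta))%:E * (nc (fourier chi (eta - xi)))%:E))%E.
  have cG : Cintegrable mu (fun eta => fourier h eta * fourier chi (eta - xi)).
    have [C C0 hC] := fourier_bound (schwartz_Cintegrable sc).
    apply: (@Cintegrable_bounded _ _ _ _ C) => //.
      by apply: (Cmeas_comp mc); exact: measurable_subrV.
    exact: schwartz_Cintegrable (schwartz_fourier sh).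
  have E := fourier_mul_convolution xi sc sh even sl.
  have EF : fourier (low_cut k h) xi = ((2 * pi) ^+ n)^-1%:C *
      Cintegral mu (fun eta => fourier h eta * fourier chi (eta - xi)).
    rewrite -E mulrA -rmorphM mulVf ?mul1r //.
    by rewrite expf_neq0 // mulf_neq0 // gt_eqF // pi_gt0.
  rewrite EF normcM normcR gtr0_norm // EFinM lee_wpmul2l ?lee_fin ?(ltW K0) //.
  apply: le_trans (normc_Cintegral_le cG) _.
  rewrite le_eqVlt; apply/orP; left; apply/eqP; apply: eq_integral => eta _.
  by rewrite normcM EFinM.
have nu : nnmeas (fun xi => (nc (u xi))%:E) := nnmeas_normc mu'.
have nh := nnmeas_normc mh.
have nz : nnmeas (fun z : V * V => ((nc (fourier h z.2))%:E * (nc (fourier chi (z.2 - z.1)))%:E)%E).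
  apply: nnmeasM; first exact: (nnmeas_snd nh).
  by apply: nnmeas_normc; apply: (Cmeas_comp mc); exact: measurable_subrV.
have nuz : nnmeas (fun z : V * V => ((nc (u z.1))%:E * ((nc (fourier h z.2))%:E * (nc (fourier chi (z.2 - z.1)))%:E))%E).
  by apply: nnmeasM => //; exact: (nnmeas_fst nu).
pose W xi eta := ((nc (u xi))%:E * ((nc (fourier h eta))%:E * (nc (fourier chi (eta - xi)))%:E))%E.
have nI : nnmeas (fun xi => \int[mu]_eta W xi eta)%E := @nnmeas_integral _ _ _ _ _ mu W nuz.
have nuz1 xi : nnmeas (fun eta => ((nc (fourier h eta))%:E * (nc (fourier chi (eta - xi)))%:E)%E).
  apply: nnmeasM => //.
  by apply: nnmeas_normc; apply: (Cmeas_comp mc); exact: measurable_subrV.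
apply: (@le_trans _ _ (((2 * pi) ^+ n)^-1%:E * \int[mu]_xi \int[mu]_eta W xi eta)%E).
  rewrite -nn_integralZl ?(ltW K0) //.
  apply: nn_le_integral.
  - by apply: nnmeas_normc; apply: CmeasM => //; apply: Cmeas_fourier; exact: schwartz_meas.
  - by apply: nnmeasM; [apply: nnmeas_cst; rewrite lee_fin ltW|].
  move=> xi; rewrite normcM EFinM /W nn_integralZl ?normc_ge0 // muleCA.
  by rewrite lee_wpmul2l ?lee_fin ?normc_ge0 //; exact: ptw.
rewrite EFinM -muleA; apply: lee_wpmul2l; first by rewrite lee_fin ltW.
have H0 : 0 <= a `^ q^-1 * I `^ p^-1 by rewrite mulr_ge0 ?powR_ge0.
rewrite -nn_integralZl //.
apply: (le_trans (y := (\int[mu]_eta \int[mu]_xi W xi eta)%E)).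
  rewrite le_eqVlt; apply/orP; left; apply/eqP.
  exact: (@nn_tonelli _ _ _ _ _ mu mu W nuz).
have nuz' : nnmeas (fun z : V * V => ((nc (u z.2))%:E * ((nc (fourier h z.1))%:E * (nc (fourier chi (z.1 - z.2)))%:E))%E).
  apply: nnmeasM; first exact: (nnmeas_snd nu).
  apply: nnmeasM; first exact: (nnmeas_fst nh).
  by apply: nnmeas_normc; apply: (Cmeas_comp mc); exact: measurable_subrV.
apply: nn_le_integral.
- exact: (@nnmeas_integral _ _ _ _ _ mu (fun eta xi => W xi eta) nuz').
- by apply: nnmeasM => //; exact: nnmeas_cst.
move=> eta.
have mt : Cmeasurable (fun xi : V => fourier chi (-1 *: xi + eta)) by exact: Cmeas_affine.
have nmc := measurable_normc_powR p mc.
have hb : (\int[mu]_xi (nc (fourier chi (-1 *: xi + eta)) `^ p)%:E <= I%:E)%E.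
  have m1 : -1 != 0 :> R by rewrite oppr_eq0 oner_eq0.
  have := integral_affine eta m1 nmc.1 nmc.2.
  by rewrite normrN1 expr1n mul1e => H; rewrite [X in (X <= _)%E]H.
have := hoelder_bound mu' mt q0 p0 _ ua hb; rewrite addrC => /(_ pq) hh.
apply: (le_trans (y := ((nc (fourier h eta))%:E * \int[mu]_xi (nc (u xi * fourier chi (-1 *: xi + eta)))%:E)%E)).
  rewrite -nn_integralZl ?normc_ge0 //; last exact: nnmeas_normc (CmeasM mu' mt).
  rewrite le_eqVlt; apply/orP; left; apply/eqP; apply: eq_integral => xi _.
  by rewrite /W normcM EFinM muleCA scaleN1r [- xi + eta]addrC.
by rewrite muleC lee_wpmul2r // lee_fin normc_ge0.
Qed.

Lemma Cintegral_low_cut_cvg0 alpha u h (a : R) : 0 <= alpha < n%:R -> Cmeasurable u -> schwartz h ->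
  (\int[mu]_xi (nc (u xi) `^ (@exp_hi R n alpha))%:E <= a%:E)%E ->
  (fun k => nc (Cintegral mu (fun xi => u xi * fourier (low_cut k h) xi))) @ \oo --> 0.
Proof.
move=> ha mu' sh ua; have [p0 q0 p1 pq] := exp_conj ha.
set p := @exp_lo R n alpha in p0 p1 pq *; set q := @exp_hi R n alpha in q0 pq ua *.
have n0 : 0 < n%:R :> R by case/andP: ha => a0; exact: le_lt_trans.
have sb : schwartz (fun y : V => (flat_bump y)%:C) by apply: schwartz_cpxP; exact: smooth_decay_flat_bump.
have Ilt := schwartz_Lp_lty p1 (schwartz_fourier sb).
have [I I0 hI] : exists2 I : R, 0 <= I & (\int[mu]_xi (nc (fourier (fun y : V => (flat_bump y)%:C) xi) `^ p)%:E = I%:E)%E.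
  have : (0 <= \int[mu]_xi (nc (fourier (fun y : V => (flat_bump y)%:C) xi) `^ p)%:E)%E.
    by apply: integral_ge0 => xi _; rewrite lee_fin powR_ge0.
  by move: Ilt; case: (\int[mu]_xi _)%E => [r| |] // _; rewrite lee_fin => r0; exists r.
have [J J0 hJ] : exists2 J : R, 0 <= J & (\int[mu]_xi (nc (fourier h xi))%:E = J%:E)%E.
  have : (0 <= \int[mu]_xi (nc (fourier h xi))%:E)%E.
    by apply: integral_ge0 => xi _; rewrite lee_fin normc_ge0.
  have := Cintegrable_lty (schwartz_Cintegrable (schwartz_fourier sh)).
  by case: (\int[mu]_xi _)%E => [r| |] // _; rewrite lee_fin => r0; exists r.
(* Positive because p > 1, that is alpha < n. The final rate is s / p = (n - alpha) / 2. *)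
pose s := n%:R * p - n%:R.
have s0 : 0 < s.
  rewrite /s -[X in _ - X]mulr1 -mulrBr mulr_gt0 // subr_gt0 /p /exp_lo.
  case/andP: ha => a0 an; rewrite ltr_pdivlMr ?mul1r ?mulr_natl ?mulr2n ?ltrD2l //.
  by rewrite ltr_pwDl.
pose K := ((2 * pi) ^+ n)^-1 * a `^ q^-1 * J.
pose w k := K * ((@harmonic R k `^ s) * I) `^ p^-1.
have h0 k : 0 < @harmonic R k by rewrite invr_gt0 ltr0n.
have w0 : w @ \oo --> 0.
  apply: cvg0Z; apply: cvg0_powR; first by rewrite invr_gt0.
    by move=> k; rewrite mulr_ge0 ?powR_ge0.
  under eq_fun do rewrite mulrC; apply: cvg0Z; apply: cvg0_powR => //.
    by move=> k; exact: ltW.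
  exact: cvg_harmonic.
apply: cvg0_le w0 => k; rewrite normc_ge0 /=.
have m0 : 0 < k.+1%:R :> R by [].
have hk : (\int[mu]_xi (nc (fourier (fun y : V => (flat_bump (k.+1%:R *: y))%:C) xi) `^ p)%:E <=
    (@harmonic R k `^ s * I)%:E)%E.
  rewrite (integral_fourier_dilate m0 p0 sb) hI -EFinM lee_fin ler_wpM2r //.
  rewrite /harmonic /= -[k.+1%:R^-1]powR_inv1 // -powRrM /s.
  by rewrite (_ : -1 * _ = n%:R - n%:R * p) //; ring.
have hb := low_cut_pairing_bound p0 q0 pq mu' sh ua hk.
have cu : Cintegrable mu (fun xi => u xi * fourier (low_cut k h) xi).
  apply/CintegrableP; split.
    by apply: CmeasM => //; apply: Cmeas_fourier; apply: schwartz_meas; exact: schwartz_low_cut.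
  by apply: le_lt_trans hb _; rewrite hJ -EFinM ltry.
rewrite -lee_fin; apply: le_trans (normc_Cintegral_le cu) _; apply: le_trans hb _.
rewrite hJ -EFinM lee_fin /w /K le_eqVlt; apply/orP; left; apply/eqP; ring.
Qed.

Lemma schwartz_sqr_bound h : schwartz h -> exists e : R, (\int[mu]_y (nc (h y) ^+ 2)%:E <= e%:E)%E.
Proof.
move=> sh; have := schwartz_Lp_lty (ler1n R 2) sh.
under eq_integral do rewrite powR_mulrn ?normc_ge0 //.
have : (0 <= \int[mu]_y (nc (h y) ^+ 2)%:E)%E by apply: integral_ge0 => y _; rewrite lee_fin sqr_ge0.
by case: (\int[mu]_y _)%E => [r| |] // _ _; exists r.
Qed.

(** The distance to the limit splits into the pairing of [cut_gap], controlled by its L^2 norm, and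
    the integral of u against the transform of [low_cut]. *)
Lemma pairing_annulus_schwartz alpha u v h (a b : R) : 0 <= alpha < n%:R ->
  Cmeasurable u -> Cmeasurable v -> is_frac_lap alpha u v -> schwartz h ->
  (\int[mu]_xi (nc (u xi) `^ (@exp_hi R n alpha))%:E <= a%:E)%E ->
  (\int[mu]_xi (nc (v xi) `^ (@exp_lo R n alpha))%:E <= b%:E)%E ->
  Cintegrable mu (fun xi => u xi * fourier h xi) /\
  (fun k => nc (pairing alpha v (annulus k h) - Cintegral mu (fun xi => u xi * fourier h xi))) @ \oo --> 0.
Proof.
move=> ha mu' mv uv sh ua vb; have [p0 q0 p1 pq] := exp_conj ha.
have a0 : 0 <= alpha by case/andP: ha.
have mh := schwartz_meas sh; have [e he] := schwartz_sqr_bound sh.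
have [A A0 hA] := avg_schwartz_le sh.
have uF f : schwartz f -> Cintegrable mu (fun xi => u xi * fourier f xi).
  move=> sf; have := schwartz_Lp_lty p1 (schwartz_fourier sf).
  have : (0 <= \int[mu]_xi (nc (fourier f xi) `^ (@exp_lo R n alpha))%:E)%E.
    by apply: integral_ge0 => xi _; rewrite lee_fin powR_ge0.
  case E : (\int[mu]_xi _)%E => [r| |] // _ _.
  have hr : (\int[mu]_xi (nc (fourier f xi) `^ (@exp_lo R n alpha))%:E <= r%:E)%E by rewrite E.
  have mF := schwartz_meas (schwartz_fourier sf).
  have qp : (@exp_hi R n alpha)^-1 + (@exp_lo R n alpha)^-1 = 1 by rewrite addrC.
  exact: (hoelder_Cintegral mu' mF q0 p0 qp ua hr).1.
split; first exact: uF.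
have [C C0 hC] := pairing_bound ha.
have sq k : schwartz (high_cut k h) := schwartz_high_cut k sh.
have adm k := annulus_admissible k a0 mh he A0 hA.
have admh k := high_cut_admissible k a0 sh A0 hA.
have sqa k := annulus_sqr_le k mh he.
have ngap k : Cmeasurable (cut_gap k h).
  by apply: CmeasB; [exact: Cmeas_annulus|exact: schwartz_meas].
have sqh k : (\int[mu]_y (nc (high_cut k h y) ^+ 2)%:E <= e%:E)%E.
  apply: le_trans he; apply: nn_le_integral.
  - by apply: nnmeas_normc_sqr; exact: schwartz_meas.
  - exact: nnmeas_normc_sqr.
  move=> y; rewrite lee_fin ler_sqr ?nnegrE ?normc_ge0 // /high_cut normcM normcR ger0_norm ?flat_ge0 //.
  by rewrite ler_piMl ?normc_ge0 // flat_le1.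
pose gap k := \int[mu]_y (nc (cut_gap k h y) ^+ 2).
have gapE k : (\int[mu]_y (nc (cut_gap k h y) ^+ 2)%:E = (gap k)%:E)%E.
  rewrite /gap /Rintegral fineK // ge0_fin_numE; last by apply: integral_ge0 => y _; rewrite lee_fin sqr_ge0.
  apply: le_lt_trans (le_trans _ he) (ltry _); apply: nn_le_integral.
  - exact: nnmeas_normc_sqr.
  - exact: nnmeas_normc_sqr.
  by move=> y; rewrite lee_fin ler_sqr ?nnegrE ?normc_ge0 // normc_cut_gap.
have gap0 : gap @ \oo --> 0.
  have cv : (fun k => \int[mu]_y (nc (cut_gap k h y) ^+ 2)%:E)%E @ \oo --> (0 : R)%:E.
    apply: (@nn_dominated0 _ _ _ mu (fun k y => nc (cut_gap k h y) ^+ 2) (fun y => nc (h y) ^+ 2)).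
    - by move=> k; apply: measurable_funX; exact: measurable_normc.
    - by move=> k y; rewrite sqr_ge0.
    - move=> y; have c0 := cut_gap_cvg0 h y; rewrite -(mulr0 (0 : R)).
      by under eq_fun do rewrite expr2; exact: cvgM.
    - by apply: measurable_funX; exact: measurable_normc.
    - by move=> k y; rewrite ler_sqr ?nnegrE ?normc_ge0 // normc_cut_gap.
    - exact: le_lt_trans he (ltry _).
  exact: fine_cvg cv.
pose w k := b `^ (@exp_lo R n alpha)^-1 *
  (C * A `^ (alpha / n%:R * @exp_hi R n alpha) * gap k) `^ (@exp_hi R n alpha)^-1.
have w0 : w @ \oo --> 0.
  apply: cvg0Z; apply: cvg0_powR; first by rewrite invr_gt0.
    move=> k; rewrite mulr_ge0 ?mulr_ge0 ?powR_ge0 ?(ltW C0) //.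
    by apply: Rintegral_ge0 => y _; rewrite sqr_ge0.
  exact: cvg0Z.
apply: cvg0_le (cvg0D w0 (Cintegral_low_cut_cvg0 ha mu' sh ua)) => k; rewrite normc_ge0 andTb.
have aB : admissible alpha A (cut_gap k h).
  by apply: (admissibleB (adm k) (admh k) (g := h)) => // y; exact: normc_cut_gap.
have gE : (\int[mu]_y (nc (cut_gap k h y) ^+ 2)%:E <= (gap k)%:E)%E by rewrite gapE.
have b1 := (hC v _ A b (gap k) mv vb aB gE).2.
have E1 := pairingB ha mv vb (adm k) (sqa k) (admh k) (sqh k).
have E2 := pairing_high_cut k a0 uv sh.
have E3 : Cintegral mu (fun xi => u xi * fourier (high_cut k h) xi) =
    Cintegral mu (fun xi => u xi * fourier h xi) - Cintegral mu (fun xi => u xi * fourier (low_cut k h) xi).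
  rewrite -CintegralB; [|exact: uF|by apply: uF; exact: schwartz_low_cut].
  apply: eq_Cintegral => xi; rewrite -mulrBr -fourierB.
  - by have -> : high_cut k h = (fun y => h y - low_cut k h y) by apply/funext => y; exact: high_cutE.
  - exact: schwartz_Cintegrable.
  - by apply: schwartz_Cintegrable; exact: schwartz_low_cut.
(* Here pA, pG and pH are the pairings of the annulus, the gap and the high part, and Iu and Il the
   integrals of u against the transforms of h and of the low part. *)
have key (pA pG pH Iu Il : R[i]) : pG = pA - pH -> pH = Iu - Il -> pA - Iu = pG - Il.
  by move=> -> ->; ring.
rewrite (key _ _ _ _ _ E1 (etrans E2 E3)); apply: le_trans (normcD _ _) _.
by rewrite normcN lerD2r.
Qed.

End Link.

(** * The extension to L^2 *)

Section Extension.
Context {R : realType} {n : nat}.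
Local Notation V := 'rV[R]_n.
Local Notation mu := (lebesgueRn R n).
Implicit Types (f h u v : V -> R[i]) (x y xi : V) (alpha A b e : R) (k : nat).
Implicit Types (a g : V -> V -> R[i]).

Definition translate f x y : R[i] := f (y + x).

Definition ext_seq alpha g f x k : R[i] := pairing alpha (g x) (annulus k (translate f x)).

(** Upper limits of the real and imaginary parts define a total and measurable function before
    convergence is known, and agree with the limit wherever it exists. *)
Definition extension alpha g f x : R[i] :=
  @fourier_cst R n * (fine (limn_esup (fun k => (complex.Re (ext_seq alpha g f x k))%:E)) +i*
                      fine (limn_esup (fun k => (complex.Im (ext_seq alpha g f x k))%:E))).

Lemma fine_limn_esup_cvg (s : nat -> R) (l : R) : s @ \oo --> l ->
  fine (limn_esup (fun k => (s k)%:E)) = l.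
Proof.
move=> sl; have cs : (fun k => (s k)%:E) @ \oo --> l%:E by apply: cvg_EFin => //; exact: nearW.
by rewrite is_cvg_limn_esupE; [rewrite (cvg_lim _ cs)|apply/cvg_ex; exists l%:E].
Qed.

Lemma cvg_of_normc (z : nat -> R[i]) (l : R[i]) : (fun k => nc (z k - l)) @ \oo --> 0 ->
  (fun k => complex.Re (z k)) @ \oo --> complex.Re l /\ (fun k => complex.Im (z k)) @ \oo --> complex.Im l.
Proof.
move=> zl; split; apply/cvgrPdist_le => e e0;
  move/cvgrPdist_le : zl => /(_ _ e0); apply: filterS => k;
  rewrite sub0r normrN ger0_norm ?normc_ge0 // distrC; apply: le_trans.
  by rewrite -Re_opp -Re_add Re_le_normc.
by rewrite -Im_opp -Im_add Im_le_normc.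
Qed.

Lemma extensionE alpha g f x l : (fun k => nc (ext_seq alpha g f x k - l)) @ \oo --> 0 ->
  extension alpha g f x = @fourier_cst R n * l.
Proof.
move=> /cvg_of_normc[hr hi]; rewrite /extension (fine_limn_esup_cvg hr) (fine_limn_esup_cvg hi).
by case: l {hr hi}.
Qed.

Lemma Cmeas_slice g x : Cmeasurable (fun z : V * V => g z.1 z.2) -> Cmeasurable (g x).
Proof.
move=> mg; exact: (Cmeas_comp mg (measurable_fun_pair (measurable_cst x) (@measurable_id _ _ _))).
Qed.

Lemma Cmeas_ext_seq alpha g f k : Cmeasurable (fun z : V * V => g z.1 z.2) -> Cmeasurable f ->
  Cmeasurable (fun x => ext_seq alpha g f x k).
Proof.
move=> mg mf.
pose F (z : V * V) y := expi (- dot y z.2) * ((riesz alpha y)%:C * annulus k (translate f z.1) y).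
apply: (@Cmeas_Cintegral _ _ V V R mu (fun x xi => g x xi * Cintegral mu (F (x, xi)))).
apply: CmeasM => //.
have -> : (fun z : V * V => Cintegral mu (F (z.1, z.2))) = (fun z => Cintegral mu (F z)).
  by apply/funext => -[].
apply: (@Cmeas_Cintegral _ _ (V * V)%type V R mu F).
have m1 : measurable_fun setT (fun z : V * V * V => z.1.1) by exact: measurableT_comp.
have m2 : measurable_fun setT (fun z : V * V * V => z.1.2) by exact: measurableT_comp.
have m3 : measurable_fun setT (fun z : V * V * V => z.2) by exact: measurable_snd.
apply: CmeasM.
  by apply: Cmeas_expi; apply: measurableT_comp => //; exact: measurable_dot.
apply: CmeasM.
  by apply: CmeasR; apply: measurableT_comp => //; exact: measurable_riesz.
apply: CmeasM; first by apply: CmeasR; exact: measurable_ann.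
by apply: (Cmeas_comp mf); exact: measurable_addrV.
Qed.

Lemma Cmeas_extension alpha g f : Cmeasurable (fun z : V * V => g z.1 z.2) -> Cmeasurable f ->
  Cmeasurable (extension alpha g f).
Proof.
move=> mg mf; apply: CmeasM; first exact: Cmeas_cst.
have h k := Cmeas_ext_seq alpha k mg mf.
split; apply: (measurableT_comp (f := @fine R)) => //; apply: measurable_fun_limn_esup => k;
  apply/measurable_EFinP; [exact: (h k).1|exact: (h k).2].
Qed.

Lemma integral_translate_sqr f x : Cmeasurable f ->
  (\int[mu]_y (nc (translate f x y) ^+ 2)%:E = \int[mu]_y (nc (f y) ^+ 2)%:E)%E.
Proof.
move=> mf; have nf := nnmeas_normc_sqr mf.
exact: (@integral_shift R n x (fun y => (nc (f y) ^+ 2)%:E) nf.1 nf.2).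
Qed.

Lemma Cmeas_translate f x : Cmeasurable f -> Cmeasurable (translate f x).
Proof. by move=> mf; apply: (Cmeas_comp mf); exact: measurable_addrV. Qed.

Lemma avg_translate_le_maximal f x r : Cmeasurable f -> 0 < r ->
  (avg r (fun y => (nc (translate f x y))%:E) 0%R <= maximal f x)%E.
Proof.
move=> mf r0; have nf := nnmeas_normc mf.
have -> : avg r (fun y => (nc (translate f x y))%:E) 0 = avg r (fun y => (nc (f y))%:E) x.
  have nb : nnmeas (fun y => ((ball_kernel r x y)%:E * (nc (f y))%:E)%E).
    by apply: nnmeasM => //; exact: nnmeas_ball_kernel.
  have H := @integral_shift R n x _ nb.1 nb.2.
  rewrite /avg -H; apply: eq_integral => y _.
  by rewrite /ball_kernel addrK subr0.
rewrite -(avg_maximalE x r0 nf); apply: ereal_sup_ubound.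
by exists r => //=; rewrite in_itv /= r0.
Qed.

Lemma maximal_ge0 f x : (0 <= maximal f x)%E.
Proof.
apply: (le_trans (y := ((mu (eball x 1))^-1 * \int[mu]_(y in eball x 1) (nc (f y))%:E)%E)).
  apply: mule_ge0; first by rewrite inve_ge0.
  by apply: integral_ge0 => y _; rewrite lee_fin normc_ge0.
by apply: ereal_sup_ubound; exists 1 => //=; rewrite in_itv /= ltr01.
Qed.

Lemma extension_cvg alpha : 0 <= alpha < n%:R -> exists2 C, 0 < C & forall g f x A b e,
  Cmeasurable (g x) -> (\int[mu]_xi (nc (g x xi) `^ (@exp_lo R n alpha))%:E <= b%:E)%E ->
  Cmeasurable f -> (\int[mu]_y (nc (f y) ^+ 2)%:E <= e%:E)%E -> (maximal f x <= A%:E)%E ->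
  exists2 l, (fun k => nc (ext_seq alpha g f x k - l)) @ \oo --> 0 &
    nc l <= b `^ (@exp_lo R n alpha)^-1 * (C * A `^ (alpha / n%:R * @exp_hi R n alpha) * e) `^ (@exp_hi R n alpha)^-1.
Proof.
move=> ha; have [C C0 hC] := pairing_annulus_cvg ha; exists C => // g f x A b e mg gb mf fe fA.
apply: hC => //.
- exact: Cmeas_translate.
- by rewrite integral_translate_sqr.
- by rewrite -lee_fin (le_trans (maximal_ge0 f x)).
- by move=> r r0; apply: le_trans fA; exact: avg_translate_le_maximal.
Qed.

Lemma extension_le alpha : 0 <= alpha < n%:R -> exists2 c, 0 < c & forall g f x A b e,
  Cmeasurable (g x) -> (\int[mu]_xi (nc (g x xi) `^ (@exp_lo R n alpha))%:E <= b%:E)%E ->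
  Cmeasurable f -> (\int[mu]_y (nc (f y) ^+ 2)%:E <= e%:E)%E -> (maximal f x <= A%:E)%E ->
  nc (extension alpha g f x) <=
    c * A `^ (alpha / n%:R) * b `^ (@exp_lo R n alpha)^-1 * (e `^ 2^-1) `^ (1 - alpha / n%:R).
Proof.
move=> ha; have [C C0 hC] := extension_cvg ha; have [p0 q0 _ _] := exp_conj ha.
have n0 : 0 < n%:R :> R by case/andP: ha => a0; exact: le_lt_trans.
have na0 : 0 < n%:R - alpha by case/andP: ha => _ an; rewrite subr_gt0.
set q := @exp_hi R n alpha in hC q0 *; set th := alpha / n%:R.
have K0 : 0 < ((2 * pi) ^+ n)^-1 :> R by rewrite invr_gt0 exprn_gt0 // mulr_gt0 // pi_gt0.
exists (((2 * pi) ^+ n)^-1 * C `^ q^-1); first by rewrite mulr_gt0 // powR_gt0.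
move=> g f x A b e mg gb mf fe fA.
have A0 : 0 <= A by rewrite -lee_fin (le_trans (maximal_ge0 f x)).
have e0 : 0 <= e.
  by rewrite -lee_fin (le_trans _ fe) // integral_ge0 // => y _; rewrite lee_fin sqr_ge0.
have [l hl lb] := hC g f x A b e mg gb mf fe fA.
rewrite (extensionE hl) normcM /fourier_cst normcR gtr0_norm //.
apply: le_trans (ler_wpM2l (ltW K0) lb) _; rewrite le_eqVlt; apply/orP; left; apply/eqP.
rewrite powRM ?mulr_ge0 ?powR_ge0 ?(ltW C0) // powRM ?powR_ge0 ?(ltW C0) // -!powRrM.
have -> : th * q * q^-1 = th by rewrite mulfK // gt_eqF.
(* This turns e^(1/q), where e bounds the square of the norm of f, into a power 1 - theta of the
   norm. *)
have -> : 2^-1 * (1 - th) = q^-1.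
  by rewrite /th /q /exp_hi; field; rewrite !gt_eqF.
ring.
Qed.

Lemma pairing_lin alpha v f h (z : R[i]) :
  Cintegrable mu (fun y => (riesz alpha y)%:C * f y) -> Cintegrable mu (fun y => (riesz alpha y)%:C * h y) ->
  Cintegrable mu (fun xi => v xi * fourier (fun y => (riesz alpha y)%:C * f y) xi) ->
  Cintegrable mu (fun xi => v xi * fourier (fun y => (riesz alpha y)%:C * h y) xi) ->
  pairing alpha v (fun y => z * f y + h y) = z * pairing alpha v f + pairing alpha v h.
Proof.
move=> cf ch vf vh; have zf := CintegrableZ z vf.
rewrite /pairing -CintegralZ // -CintegralD //; apply: eq_Cintegral => xi.
have F : fourier (fun y => (riesz alpha y)%:C * (z * f y + h y)) xi =
    z * fourier (fun y => (riesz alpha y)%:C * f y) xi + fourier (fun y => (riesz alpha y)%:C * h y) xi.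
  have c1 := Cintegrable_fourier xi cf; have c2 := Cintegrable_fourier xi ch.
  rewrite /fourier -CintegralZ // -CintegralD //; last exact: CintegrableZ.
  by apply: eq_Cintegral => y; ring.
rewrite F; ring.
Qed.

(** The annuli are the same for all functions, so linearity holds at each k and passes to the limit;
    A and e are common bounds for both functions. *)
Lemma extension_lin alpha g f h x (z : R[i]) A b e : 0 <= alpha < n%:R ->
  Cmeasurable (g x) -> (\int[mu]_xi (nc (g x xi) `^ (@exp_lo R n alpha))%:E <= b%:E)%E ->
  Cmeasurable f -> (\int[mu]_y (nc (f y) ^+ 2)%:E <= e%:E)%E -> (maximal f x <= A%:E)%E ->
  Cmeasurable h -> (\int[mu]_y (nc (h y) ^+ 2)%:E <= e%:E)%E -> (maximal h x <= A%:E)%E ->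
  extension alpha g (fun y => z * f y + h y) x = z * extension alpha g f x + extension alpha g h x.
Proof.
move=> ha mg gb mf fe fA mh he hA.
have a0 : 0 <= alpha by case/andP: ha.
have [C _ hC] := extension_cvg ha; have [C' _ hC'] := pairing_bound ha.
have [l1 hl1 _] := hC g f x A b e mg gb mf fe fA.
have [l2 hl2 _] := hC g h x A b e mg gb mh he hA.
have A0 : 0 <= A by rewrite -lee_fin (le_trans (maximal_ge0 f x)).
have cw u k : Cmeasurable u -> (\int[mu]_y (nc (u y) ^+ 2)%:E <= e%:E)%E -> (maximal u x <= A%:E)%E ->
    Cintegrable mu (fun y => (riesz alpha y)%:C * annulus k (translate u x) y) /\
    Cintegrable mu (fun xi => g x xi * fourier (fun y => (riesz alpha y)%:C * annulus k (translate u x) y) xi).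
  move=> mu' ue uA; have mt := Cmeas_translate x mu'.
  have te : (\int[mu]_y (nc (translate u x y) ^+ 2)%:E <= e%:E)%E by rewrite integral_translate_sqr.
  have adm : admissible alpha A (annulus k (translate u x)).
    apply: annulus_admissible te A0 _ => // r r0.
    by apply: le_trans uA; exact: avg_translate_le_maximal.
  split; first by case: adm.
  exact: (hC' (g x) _ A b e mg gb adm (annulus_sqr_le k mt te)).1.
have E k : ext_seq alpha g (fun y => z * f y + h y) x k = z * ext_seq alpha g f x k + ext_seq alpha g h x k.
  have [c1 c2] := cw f k mf fe fA; have [c3 c4] := cw h k mh he hA.
  rewrite /ext_seq -(pairing_lin z c1 c3 c2 c4); apply: eq_Cintegral => xi.
  have -> : annulus k (translate (fun y => z * f y + h y) x) =
    (fun y => z * annulus k (translate f x) y + annulus k (translate h x) y) => //.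
  by apply/funext => y; rewrite /annulus /translate; ring.
have hl : (fun k => nc (ext_seq alpha g (fun y => z * f y + h y) x k - (z * l1 + l2))) @ \oo --> 0.
  apply: cvg0_le (cvg0D (normc_cvgZ z hl1) hl2) => k; rewrite normc_ge0 andTb E.
  by rewrite opprD addrACA; exact: normcD.
rewrite (extensionE hl) (extensionE hl1) (extensionE hl2); ring.
Qed.

Lemma fourier_translate_add f x xi : Cintegrable mu f ->
  fourier (translate f x) xi = expi (dot x xi) * fourier f xi.
Proof.
move=> cf; rewrite -[dot x xi]opprK -dotNl -(fourier_translate _ _ cf).
by apply: eq_Cintegral => y; rewrite /translate opprK.
Qed.

(** The translation by x contributes the factor exp(i x.xi) of the operator. *)
Lemma extension_psido alpha (a g : V -> V -> R[i]) f x (b c : R) : 0 <= alpha < n%:R ->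
  Cmeasurable (a x) -> Cmeasurable (g x) -> is_frac_lap alpha (a x) (g x) -> schwartz f ->
  (\int[mu]_xi (nc (a x xi) `^ (@exp_hi R n alpha))%:E <= c%:E)%E ->
  (\int[mu]_xi (nc (g x xi) `^ (@exp_lo R n alpha))%:E <= b%:E)%E ->
  Cintegrable mu (psido_integrand a f x) /\ extension alpha g f x = psido a f x.
Proof.
move=> ha ma mg ag sf ac gb.
have st : schwartz (translate f x).
  have := schwartz_affine x (oner_neq0 R) sf.
  by rewrite /translate; under eq_fun do rewrite scale1r.
have [ci hl] := pairing_annulus_schwartz ha ma mg ag st ac gb.
have E xi : a x xi * fourier (translate f x) xi = psido_integrand a f x xi.
  by rewrite (fourier_translate_add _ _ (schwartz_Cintegrable sf)) /psido_integrand mulrCA.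
split; first exact: (eq_Cintegrable E ci).
by rewrite (extensionE hl) /psido (eq_Cintegral _ E).
Qed.

End Extension.

(** * Integration of the pointwise bound *)

Section AlmostEverywhere.
Context {d} {T : measurableType d} {R : realType}.
Variable m : {measure set T -> \bar R}.

Lemma ae_lty (F : T -> \bar R) : nnmeas F -> (\int[m]_x F x < +oo)%E ->
  {ae m, forall x, (F x < +oo)%E}.
Proof.
move=> [mF F0] IF; have iF : m.-integrable setT F.
  apply/integrableP; split => //.
  by under eq_integral do rewrite gee0_abs //.
apply: filterS (integrable_ae measurableT iF) => x /(_ I).
by rewrite ge0_fin_numE.
Qed.

Lemma ge0_lty_real (x : \bar R) : (0 <= x)%E -> (x < +oo)%E -> exists2 r : R, 0 <= r & x = r%:E.
Proof. by case: x => [r| |] //; rewrite lee_fin => r0 _; exists r. Qed.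

(** Hoelder with exponents 1 / theta and 1 / (1 - theta) for u^(2 theta) and w^2, where theta = 0 is
    treated apart. It is applied with u the maximal function of f and w the norm of g(x, .). *)
Lemma weighted_hoelder (u w : T -> R) (th U W : R) : 0 <= th < 1 ->
  measurable_fun setT u -> measurable_fun setT w -> (forall x, 0 <= u x) -> (forall x, 0 <= w x) ->
  (\int[m]_x (u x ^+ 2)%:E <= U%:E)%E -> (\int[m]_x (w x `^ (2 / (1 - th)))%:E <= W%:E)%E ->
  (\int[m]_x ((u x `^ th * w x) ^+ 2)%:E <= (U `^ th * W `^ (1 - th))%:E)%E.
Proof.
move=> /andP[th0 th1] mu' mw u0 w0 hU hW.
have W0 : 0 <= W.
  by rewrite -lee_fin (le_trans _ hW) // integral_ge0 // => x _; rewrite lee_fin powR_ge0.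
have t1 : 0 < 1 - th by rewrite subr_gt0.
move: th0; rewrite le_eqVlt => /predU1P[th0|th0].
  move: hW; rewrite -th0 subr0 divr1 powRr0 mul1r powRr1 // => hW.
  apply: le_trans hW; rewrite le_eqVlt; apply/orP; left; apply/eqP; apply: eq_integral => x _.
  by rewrite powRr0 mul1r powR_mulrn.
have mf : Cmeasurable (fun x => (u x `^ (2 * th))%:C).
  by apply: CmeasR; exact: (measurableT_comp (measurable_powR _)).
have mg : Cmeasurable (fun x => (w x ^+ 2)%:C).
  by apply: CmeasR; exact: measurable_funX.
have hf : (\int[m]_x (nc ((u x `^ (2 * th))%:C) `^ th^-1)%:E <= U%:E)%E.
  apply: le_trans hU; rewrite le_eqVlt; apply/orP; left; apply/eqP; apply: eq_integral => x _.
  by rewrite normcR ger0_norm ?powR_ge0 // -powRrM mulfK ?gt_eqF // powR_mulrn.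
have hg : (\int[m]_x (nc ((w x ^+ 2)%:C) `^ (1 - th)^-1)%:E <= W%:E)%E.
  apply: le_trans hW; rewrite le_eqVlt; apply/orP; left; apply/eqP; apply: eq_integral => x _.
  by rewrite normcR ger0_norm ?sqr_ge0 // -powR_mulrn // -powRrM.
have pq : th^-1^-1 + (1 - th)^-1^-1 = 1 by rewrite !invrK addrC subrK.
have thV : 0 < th^-1 by rewrite invr_gt0.
have tV : 0 < (1 - th)^-1 by rewrite invr_gt0.
have := hoelder_bound mf mg thV tV pq hf hg; rewrite !invrK.
apply: le_trans; rewrite le_eqVlt; apply/orP; left; apply/eqP; apply: eq_integral => x _.
rewrite -rmorphM normcR ger0_norm ?mulr_ge0 ?powR_ge0 ?sqr_ge0 //.
by rewrite exprMn mulrC [2 * th]mulrC powRrM powR_mulrn ?powR_ge0 // mulrC.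
Qed.

End AlmostEverywhere.

Section Boundedness.
Context {R : realType} {n : nat}.
Local Notation V := 'rV[R]_n.
Local Notation mu := (lebesgueRn R n).
Implicit Types (f h : V -> R[i]) (x y xi : V) (alpha : R).
Implicit Types (a g : V -> V -> R[i]).

Lemma in_L2P f : in_L2 mu f -> Cmeasurable f /\
  exists2 e : R, 0 <= e & (\int[mu]_y (nc (f y) ^+ 2)%:E = e%:E)%E.
Proof.
move=> [mf]; rewrite CLnorm2E => /lty_poweRy h; split => //; apply: ge0_lty_real.
  by apply: integral_ge0 => y _; rewrite lee_fin sqr_ge0.
by apply: h; rewrite invr_eq0.
Qed.

Lemma ae_hl_max_lty f : in_L2 mu f ->
  {ae mu, forall x, (hl_max (fun y => (nc (f y))%:E) x < +oo)%E}.
Proof.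
move=> /in_L2P[mf [e e0 he]]; have nf := nnmeas_normc mf; have nN := nnmeas_hl_max nf.
have lt : (\int[mu]_x (hl_max (fun y => (nc (f y))%:E) x * hl_max (fun y => (nc (f y))%:E) x) < +oo)%E.
  apply: le_lt_trans (integral_hl_max_sq nf) _.
  have -> : (\int[mu]_x ((nc (f x))%:E * (nc (f x))%:E) = e%:E)%E.
    by rewrite -he; apply: eq_integral => x _; rewrite -EFinM expr2.
  by rewrite -EFinM ltry.
apply: filterS (ae_lty (nnmeasM nN nN) lt) => x.
by have := nN.2 x; case: (hl_max _ x) => [r| |] // _; rewrite ?ltry // mulyy.
Qed.

Lemma nnmeas_CLnorm (p : R) g : Cmeasurable (fun z : V * V => g z.1 z.2) ->
  nnmeas (fun x => CLnorm mu p (g x)).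
Proof.
move=> mg; split; last by move=> x; exact: CLnorm_ge0.
under eq_fun do rewrite CLnormE.
apply: (measurableT_comp (measurable_poweR _)).
have n2 : nnmeas (fun z : V * V => (nc (g z.1 z.2) `^ p)%:E) by exact: measurable_normc_powR.
exact: (@nnmeas_integral _ _ _ _ _ mu (fun x xi => (nc (g x xi) `^ p)%:E) n2).1.
Qed.

Lemma mixed_normE (q p : R) g :
  mixed_norm q p g = ((\int[mu]_x (CLnorm mu p (g x) `^ q)) `^ q^-1)%E.
Proof.
rewrite /mixed_norm unlock /=; congr (_ `^ _)%E; apply: eq_integral => x _.
by rewrite gee0_abs // CLnorm_ge0.
Qed.

Lemma slice_bound (p : R) g x : 0 < p -> (CLnorm mu p (g x) < +oo)%E ->
  exists2 b : R, (\int[mu]_xi (nc (g x xi) `^ p)%:E <= b%:E)%E &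
    CLnorm mu p (g x) = (b `^ p^-1)%:E.
Proof.
move=> p0; rewrite CLnormE => h.
have i0 : (0 <= \int[mu]_xi (nc (g x xi) `^ p)%:E)%E.
  by apply: integral_ge0 => y _; rewrite lee_fin powR_ge0.
have [b b0 hb] := ge0_lty_real i0 (lty_poweRy (invr_neq0 (lt0r_neq0 p0)) h).
by exists b; rewrite hb // poweR_EFin.
Qed.

Lemma ae_slices alpha g : 0 <= alpha < n%:R -> Cmeasurable (fun z : V * V => g z.1 z.2) ->
  (mixed_norm (@exp_hi R n alpha) (@exp_lo R n alpha) g < +oo)%E ->
  {ae mu, forall x, (CLnorm mu (@exp_lo R n alpha) (g x) < +oo)%E}.
Proof.
move=> ha mg; have [p0 q0 _ _] := exp_conj ha; rewrite mixed_normE.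
move=> /(lty_poweRy (invr_neq0 (lt0r_neq0 q0))) lt.
have nG : nnmeas (fun x => CLnorm mu (@exp_lo R n alpha) (g x) `^ (@exp_hi R n alpha))%E.
  split; last by move=> x; exact: poweR_ge0.
  by apply: (measurableT_comp (measurable_poweR _)); exact: (nnmeas_CLnorm _ mg).1.
apply: filterS (ae_lty nG lt) => x; apply: lty_poweRy; exact: lt0r_neq0.
Qed.

Lemma extension_L2 alpha : 0 <= alpha < n%:R -> exists2 c, 0 < c & forall g f,
  Cmeasurable (fun z : V * V => g z.1 z.2) ->
  (mixed_norm (@exp_hi R n alpha) (@exp_lo R n alpha) g < +oo)%E -> in_L2 mu f ->
  (CLnorm mu 2 (extension alpha g f) <=
   c%:E * CLnorm mu 2 f * mixed_norm (@exp_hi R n alpha) (@exp_lo R n alpha) g)%E.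
Proof.
move=> ha; have [c c0 hc] := @extension_le R n alpha ha; have [p0 q0 _ _] := exp_conj ha.
have n0 : 0 < n%:R :> R by case/andP: ha => a0; exact: le_lt_trans.
have th01 : 0 <= alpha / n%:R < 1.
  by case/andP: ha => a0 an; rewrite divr_ge0 // ?(ltW n0) // ltr_pdivrMr // mul1r.
have na0 : 0 < n%:R - alpha by case/andP: ha => _ an; rewrite subr_gt0.
(* The power of w in [weighted_hoelder] is thus q: this is the origin of the outer exponent of the
   mixed norm. *)
have qE : 2 / (1 - alpha / n%:R) = @exp_hi R n alpha.
  by rewrite /exp_hi; field; rewrite !gt_eqF.
set th := alpha / n%:R in hc th01 qE *; set q := @exp_hi R n alpha in q0 qE *.
pose Hc : R := 2 ^+ n * 2 ^+ n * @maximal_const R n.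
have Hc0 : 0 <= Hc by rewrite mulr_ge0 ?mulr_ge0 ?exprn_ge0 // addr_ge0 // exprn_ge0.
(* The power of [Hc] is the theta-th power of the L^2 bound on the maximal function; the 1 makes the
   constant positive at once. *)
exists (c * (1 + Hc `^ (th * 2^-1))); first by rewrite mulr_gt0 // ltr_wpDr ?powR_ge0.
move=> g f mg hg fL2; have [mf [e e0 he]] := in_L2P fL2.
have nG := nnmeas_CLnorm (@exp_lo R n alpha) mg.
have nf := nnmeas_normc mf; have nN := nnmeas_hl_max nf.
(* Real-valued versions for [weighted_hoelder]: [fine] sends +oo to 0, which alters these functions
   only on null sets. *)
pose u x := fine (hl_max (fun y => (nc (f y))%:E) x).
pose w x := fine (CLnorm mu (@exp_lo R n alpha) (g x)).
have u0 x : 0 <= u x by apply: fine_ge0; exact: nN.2.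
have w0 x : 0 <= w x by apply: fine_ge0; exact: nG.2.
have mu' : measurable_fun setT u by apply: (measurableT_comp (f := @fine R)) => //; exact: nN.1.
have mw : measurable_fun setT w by apply: (measurableT_comp (f := @fine R)) => //; exact: nG.1.
have hU : (\int[mu]_x (u x ^+ 2)%:E <= (Hc * e)%:E)%E.
  apply: le_trans (_ : \int[mu]_x (hl_max (fun y => (nc (f y))%:E) x * hl_max (fun y => (nc (f y))%:E) x) <= _)%E.
    apply: nn_le_integral.
    - by apply: nnmeas_EFin => [|x]; [exact: measurable_funX|exact: sqr_ge0].
    - exact: nnmeasM.
    move=> x; rewrite /u; have : (0 <= hl_max (fun y => (nc (f y))%:E) x)%E by exact: nN.2.
    by move: (hl_max _ x) => [r| |] // _; rewrite mulyy leey.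
  apply: le_trans (integral_hl_max_sq nf) _.
  have -> : (\int[mu]_x ((nc (f x))%:E * (nc (f x))%:E) = e%:E)%E.
    by rewrite -he; apply: eq_integral => x _; rewrite -EFinM expr2.
  by rewrite -EFinM.
move: (hg); rewrite mixed_normE => /(lty_poweRy (invr_neq0 (lt0r_neq0 q0))) IG.
have [W W0 hW] : exists2 W : R, 0 <= W & (\int[mu]_x (CLnorm mu (@exp_lo R n alpha) (g x) `^ q) = W%:E)%E.
  by apply: ge0_lty_real IG; apply: integral_ge0 => x _; exact: poweR_ge0.
have hW' : (\int[mu]_x (w x `^ (2 / (1 - th)))%:E <= W%:E)%E.
  rewrite -hW qE; apply: nn_le_integral.
  - apply: nnmeas_EFin => [|x]; last exact: powR_ge0.
    exact: (measurableT_comp (measurable_powR _)).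
  - split; last by move=> x; exact: poweR_ge0.
    by apply: (measurableT_comp (measurable_poweR _)); exact: nG.1.
  move=> x; rewrite /w; have := nG.2 x; case: (CLnorm _ _ _) => [r| |] // _.
  by rewrite poweRyr ?leey // gt_eqF.
have wh := weighted_hoelder th01 mu' mw u0 w0 hU hW'.
pose E := e `^ 2^-1; have E0 : 0 <= E by exact: powR_ge0.
pose K := c * E `^ (1 - th); have K0 : 0 <= K by rewrite mulr_ge0 ?powR_ge0 // ltW.
have mT := Cmeas_extension alpha mg mf.
have key : (\int[mu]_x (nc (extension alpha g f x) `^ 2)%:E <=
    (K ^+ 2 * ((Hc * e) `^ th * W `^ (1 - th)))%:E)%E.
  apply: (@le_trans _ _ (\int[mu]_x ((K ^+ 2)%:E * ((u x `^ th * w x) ^+ 2)%:E)))%E; last first.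
    rewrite nn_integralZl ?sqr_ge0 //; last first.
      apply: nnmeas_EFin => [|x]; last exact: sqr_ge0.
      apply: measurable_funX; apply: measurable_funM => //.
      exact: (measurableT_comp (measurable_powR _)).
    by rewrite [X in (_ <= X)%E]EFinM lee_wpmul2l // lee_fin sqr_ge0.
  apply: ae_ge0_le_integral => //.
  - by move=> x _; rewrite lee_fin powR_ge0.
  - exact: (measurable_normc_powR 2 mT).1.
  - by move=> x _; rewrite -EFinM lee_fin mulr_ge0 ?sqr_ge0.
  - under eq_fun do rewrite -EFinM; apply/measurable_EFinP; apply: measurable_funM => //.
    apply: measurable_funX; apply: measurable_funM => //.
    exact: (measurableT_comp (measurable_powR _)).
  apply: filterS2 (ae_hl_max_lty fL2) (ae_slices ha mg hg) => x ux gx _.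
  have [b hb bE] := slice_bound p0 gx.
  have mx : (maximal f x <= (u x)%:E)%E.
    rewrite /u fineK; last by rewrite ge0_fin_numE // nN.2.
    exact: maximal_le_hl_max.
  have he' : (\int[mu]_y (nc (f y) ^+ 2)%:E <= e%:E)%E by rewrite he.
  have := hc g f x (u x) b e (Cmeas_slice x mg) hb mf he' mx.
  have wE : w x = b `^ (@exp_lo R n alpha)^-1 by rewrite /w bE.
  rewrite -wE -/E -EFinM lee_fin => hT.
  rewrite powR_mulrn ?normc_ge0 // -exprMn ler_sqr ?nnegrE ?normc_ge0 ?mulr_ge0 ?powR_ge0 ?(ltW c0) //.
  apply: le_trans hT _; rewrite le_eqVlt; apply/orP; left; apply/eqP; rewrite /K; ring.
have := CLnorm_le (ltr0n R 2) key.
rewrite [CLnorm mu 2 f]CLnorm2E he poweR_EFin -/E hW poweR_EFin -!EFinM.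
move/le_trans; apply; rewrite lee_fin.
rewrite [(K ^+ 2 * _) `^ _]powRM ?sqr_ge0 ?mulr_ge0 ?powR_ge0 //.
rewrite [(_ * W `^ _) `^ _]powRM ?powR_ge0 // -(powR_mulrn 2 K0) -!powRrM mulfV ?pnatr_eq0 // powRr1 //.
rewrite (powRM _ Hc0 e0).
have -> : (1 - th) * 2^-1 = q^-1 by rewrite -qE invf_div.
have -> : e `^ (th * 2^-1) = E `^ th by rewrite /E -powRrM mulrC.
have EE : E `^ (1 - th) * E `^ th = E.
  by rewrite -powRD ?subrK ?oner_eq0 // powRr1.
rewrite /K [leLHS](_ : _ = c * Hc `^ (th * 2^-1) * (E `^ (1 - th) * E `^ th) * W `^ q^-1); last by ring.
rewrite EE ler_wpM2r ?powR_ge0 // ler_wpM2r // ler_wpM2l ?(ltW c0) // lerDr //.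
Qed.

End Boundedness.

Theorem theorem2p3 (R : realType) (n : nat) (alpha : R)
    (halpha : 0 <= alpha < n%:R) :
  exists2 c : R, 0 < c &
  forall a g : 'rV[R]_n -> 'rV[R]_n -> R[i],
    Cmeasurable (fun z : 'rV[R]_n * 'rV[R]_n => a z.1 z.2) ->
    Cmeasurable (fun z : 'rV[R]_n * 'rV[R]_n => g z.1 z.2) ->
    (\int[lebesgueRn R n]_x \int[lebesgueRn R n]_xi
       (Normc.normc (a x xi) `^ (2 * n%:R / (n%:R - alpha)))%:E < +oo)%E ->
    {ae lebesgueRn R n, forall x, is_frac_lap alpha (a x) (g x)} ->
    (mixed_norm (2 * n%:R / (n%:R - alpha)) (2 * n%:R / (n%:R + alpha)) g
       < +oo)%E ->
  exists T : ('rV[R]_n -> R[i]) -> ('rV[R]_n -> R[i]),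
    [/\ psido_L2_extension a T,
        forall f, in_L2 (lebesgueRn R n) f ->
          (CLnorm (lebesgueRn R n) 2 (T f) <=
           c%:E * CLnorm (lebesgueRn R n) 2 f *
           mixed_norm (2 * n%:R / (n%:R - alpha))
                      (2 * n%:R / (n%:R + alpha)) g)%E &
        forall f, in_L2 (lebesgueRn R n) f ->
          {ae lebesgueRn R n, forall x,
            ((Normc.normc (T f x))%:E <=
             c%:E * maximal f x `^ (alpha / n%:R) *
             CLnorm (lebesgueRn R n) (2 * n%:R / (n%:R + alpha)) (g x) *
             CLnorm (lebesgueRn R n) 2 f `^ (1 - alpha / n%:R))%E}].
Proof.
have ha := halpha; have [p0 q0 _ _] := exp_conj ha.
have [c1 c10 h1] := @extension_le R n alpha ha.
have [c2 c20 h2] := @extension_L2 R n alpha ha.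
(* The pointwise bound and the L^2 bound come with separate constants, both fixed before a and g. *)
exists (c1 + c2); first exact: addr_gt0.
move=> a g ma mg ha_fin uv hg; exists (extension alpha g).
have bound f : in_L2 (lebesgueRn R n) f -> (CLnorm (lebesgueRn R n) 2 (extension alpha g f) <=
    (c1 + c2)%:E * CLnorm (lebesgueRn R n) 2 f * mixed_norm (@exp_hi R n alpha) (@exp_lo R n alpha) g)%E.
  move=> fL2; apply: le_trans (h2 g f mg hg fL2) _.
  rewrite lee_wpmul2r //; first by rewrite mixed_normE poweR_ge0.
  by rewrite lee_wpmul2r ?CLnorm_ge0 // lee_fin lerDr ltW.
have gae := ae_slices ha mg hg.
have max_lty f : in_L2 (lebesgueRn R n) f -> {ae lebesgueRn R n, forall x, (maximal f x < +oo)%E}.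
  move=> fL2; apply: filterS (ae_hl_max_lty fL2) => x; apply: le_lt_trans.
  by apply: maximal_le_hl_max; case: fL2.
split.
- split.
  + move=> f fL2; split; first by apply: Cmeas_extension => //; case: fL2.
    apply: le_lt_trans (bound f fL2) _.
    have [_ fl] := fL2.
    have [r r0 ->] := ge0_lty_real (CLnorm_ge0 _ 2 f) fl.
    have m0 : (0 <= mixed_norm (@exp_hi R n alpha) (@exp_lo R n alpha) g)%E by rewrite mixed_normE poweR_ge0.
    have [s s0 ->] := ge0_lty_real m0 hg.
    by rewrite -!EFinM ltry.
  + move=> z f h fL2 hL2; have [mf [e e0 he]] := in_L2P fL2; have [mh [e' e'0 he']] := in_L2P hL2.
    apply: filterS3 (max_lty f fL2) (max_lty h hL2) gae => x fx hx gx.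
    have [A A0 hA] := ge0_lty_real (maximal_ge0 f x) fx.
    have [A' A'0 hA'] := ge0_lty_real (maximal_ge0 h x) hx.
    have [b hb _] := slice_bound p0 gx.
    apply: (@extension_lin R n alpha g f h x z (A + A') b (e + e')) => //.
    * exact: Cmeas_slice.
    * by rewrite he lee_fin lerDl.
    * by rewrite hA lee_fin lerDl.
    * by rewrite he' lee_fin lerDr.
    * by rewrite hA' lee_fin lerDr.
  + move=> f sf.
    have na2 : nnmeas (fun z : 'rV[R]_n * 'rV[R]_n => (nc (a z.1 z.2) `^ (@exp_hi R n alpha))%:E).
      exact: measurable_normc_powR.
    have na := @nnmeas_integral _ _ _ _ _ (lebesgueRn R n)
      (fun x xi => (nc (a x xi) `^ (@exp_hi R n alpha))%:E) na2.
    apply: filterS3 (ae_lty na ha_fin) uv gae => x ax ux gx.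
    have [b hb _] := slice_bound p0 gx.
    have [r r0 hr] := ge0_lty_real (na.2 x) ax.
    apply: (@extension_psido R n alpha a g f x b r) => //.
    * exact: Cmeas_slice.
    * exact: Cmeas_slice.
    * by rewrite hr.
- exact: bound.
- move=> f fL2; have [mf [e e0 he]] := in_L2P fL2.
  apply: filterS2 (max_lty f fL2) gae => x fx gx.
  have [A A0 hA] := ge0_lty_real (maximal_ge0 f x) fx.
  have [b hb bE] := slice_bound p0 gx.
  have fA : (maximal f x <= A%:E)%E by rewrite hA.
  have fe : (\int[lebesgueRn R n]_y (nc (f y) ^+ 2)%:E <= e%:E)%E by rewrite he.
  have := h1 g f x A b e (Cmeas_slice x mg) hb mf fe fA.
  rewrite [CLnorm _ 2 f]CLnorm2E he hA bE !poweR_EFin -!EFinM lee_fin => hT; apply: le_trans hT _.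
  rewrite ler_wpM2r ?powR_ge0 // ler_wpM2r ?powR_ge0 // ler_wpM2r ?powR_ge0 //.
  by rewrite lerDl ltW.
Qed.
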